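(* Fix nonnegative rational numbers $\varepsilon,\delta$, positive integers $I,J$, nonnegative integers $M_1,\dots,M_I$ and $N_1\ge N_2\ge\dots\ge N_J$, and a constant $C>0$. Assume $(\varepsilon,\delta)$ is nondegenerate: $\nu\varepsilon+2-\frac{l}{[\delta]+1}\delta\ne0$ for all integers $0\le\nu\le\max_iM_i$ and $0\le l\le([\delta]+1)\max_jN_j$. Let $$\mathcal{B}=\{b=(b'_{i,\mu},b''_{j,\nu}):1\le i\le I,\,1\le j\le J,\,0\le\mu\le M_i,\,0\le\nu\le N_j,\ b'_{i,\mu},b''_{j,\nu}\in\mathbb{C},\ b'_{i,\mu}\ne0\text{ for some }i,\mu\}\subseteq\mathbb{C}^a,$$ and for $b\in\mathcal{B}$ let $P_i(b;Z)=\sum_{\mu=0}^{M_i}b'_{i,\mu}Z^\mu$, $Q_j(b;Z)=\sum_{\nu=0}^{N_j}b''_{j,\nu}Z^\nu$, and $$R_b(z)=\frac{\big(\sum_{i=1}^I|P_i(b;z)|^2\big)^{\varepsilon/2}}{\big(\sum_{j=1}^J|Q_j(b;z)|^2\big)^{\delta/2}}.$$ Then there exist $s\in(0,1)$, a finite chain $\mathcal{B}=U_0\supset U_1\supset\dots\supset U_{\mathcal N}=\emptyset$ of subsets of $\mathcal{B}$, each the intersection of $\mathcal{B}$ with an algebraic variety in $\mathbb{C}^a$, and ARPs $T_\lambda=K_\lambda/L_\lambda\in\mathbb{Z}|(B'_{i,\mu},B''_{j,\nu})|$, $0\le\lambda\le\mathcal N-1$, such that: 1. for $b\in U_\lambda\setminus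 U_{\lambda+1}$, $K_\lambda(b)\ne0$ (so $T_\lambda$ is defined and nowhere vanishing on $U_\lambda\setminus U_{\lambda+1}$, with values in $(0,\infty]$); 2. for every $b\in U_\lambda\setminus U_{\lambda+1}$ satisfying $|||Q_1(b;Z)-Z^{N_1}|||<s$ and $|||Q_j(b;Z)|||<C$ for $j>1$, one has $\int_BR_b(z)\,dV\sim T_\lambda(b)$, where $B$ is the unit disk and the implied constants depend only on $I,J,M_i,N_j,\varepsilon,\delta,C$ (in particular the integral is infinite iff $L_\lambda(b)=0$); 3. $U_{\lambda+1}=\{b\in U_\lambda:K_\lambda(b)=0\}=\{b\in U_\lambda:K_\lambda(b)=0\text{ and }L_\lambda(b)=0\}$.
   Context: An absolute rational power (ARP) in variables $X=(X_1,\dots,X_m)$ with coefficients in a subring $A\subseteq\mathbb{C}$ is an expression $R(X)=K(X)/L(X)$ with $K(X)=(\sum_{i}|P_i(X)|^2)^{\varepsilon/2}$, $L(X)=(\sum_j|Q_j(X)|^2)^{\delta/2}$, where the $P_i,Q_j\in A[X]$ are finitely many polynomials, not all $P_i$ zero, and $\varepsilon,\delta$ are nonnegative rationals; $K$ and $L$ are called absolute polynomial powers. The set of such is denoted $A|(X)|$. Its domain is the complement of $\{K=0\}$ (where it takes values in $(0,\infty]$); its strict domain is the complement of $\{K=0\}\cup\{L=0\}$. For a polynomial $Q(Z)=\sum_{\mu=0}^Mb_\mu Z^\mu$, $|||Q|||=\sum_{\mu}|b_\mu|$. $dV$ is Lebesgue measure on $\mathbb{C}$; $[\delta]$ is the integer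 part of $\delta$. *)

(* Defs.v *)
From HB Require Import structures.
From mathcomp Require Import all_boot all_order all_algebra.
From mathcomp Require Import complex.
From mathcomp Require Import mpoly.
From mathcomp Require Import all_classical all_reals all_analysis.

Set Implicit Arguments.
Unset Strict Implicit.
Unset Printing Implicit Defensive.

Import Order.TTheory GRing.Theory Num.Theory.
Local Open Scope ring_scope.
Local Open Scope classical_set_scope.
Local Open Scope complex_scope.

Definition cabs2 {R : realType} (z : R[i]) : R :=
  let: a +i* b := z in a ^+ 2 + b ^+ 2.
Definition cabs {R : realType} (z : R[i]) : R := Num.sqrt (cabs2 z).

(* R(X) = K(X)/L(X), K = (sum_i |P_i|^2)^(eps/2), L = (sum_j|Q_j|^2)^(del/2) *)
Record ARP (n : nat) := MkARP {
  arpP : seq (mpoly.mpoly n int);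
  arpQ : seq (mpoly.mpoly n int);
  arp_eps : rat;
  arp_del : rat;
  arp_eps_ge0 : 0 <= arp_eps;
  arp_del_ge0 : 0 <= arp_del;
  arpP_nz : has (fun p : mpoly.mpoly n int => p != 0) arpP }.

Definition ipeval {R : realType} (n : nat) (x : 'I_n -> R[i])
  (p : mpoly.mpoly n int) : R[i] :=
  mpoly.mmap (fun z : int => z%:~R) x p.

Definition abspolypow {R : realType} (n : nat) (ps : seq (mpoly.mpoly n int))
  (r : rat) (x : 'I_n -> R[i]) : R :=
  powR (\sum_(p <- ps) cabs2 (ipeval x p)) (ratr r / 2).

Definition arpK {R : realType} n (T : ARP n) (x : 'I_n -> R[i]) : R :=
  abspolypow (arpP T) (arp_eps T) x.
Definition arpL {R : realType} n (T : ARP n) (x : 'I_n -> R[i]) : R :=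
  abspolypow (arpQ T) (arp_del T) x.

(* value K/L in (0, +oo] (meaningful on the domain K <> 0) *)
Definition arp_eval {R : realType} n (T : ARP n) (x : 'I_n -> R[i]) : \bar R :=
  if arpL T x == 0 then +oo%E else (arpK T x / arpL T x)%:E.

Definition algebraic_set {R : realType} (n : nat) (V : set ('I_n -> R[i])) :=
  exists ps : seq (mpoly.mpoly n R[i]),
    V = [set x | forall p, p \in ps -> mpoly.meval x p = 0].

(* The coefficient space: coordinates b'_{i,mu} (0<=mu<=M_i) and       *)
(* b''_{j,nu} (0<=nu<=N_j).  Index 1 of the paper is ordinal 0.        *)
Definition Idx (I J : nat) (M : 'I_I -> nat) (N : 'I_J -> nat) : finType :=
  ({i : 'I_I & 'I_(M i).+1} + {j : 'I_J & 'I_(N j).+1})%type.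

Section Coeffs.
Context {R : realType} {I J : nat} {M : 'I_I -> nat} {N : 'I_J -> nat}.

Definition bP (b : Idx M N -> R[i]) (i : 'I_I) (mu : 'I_(M i).+1) : R[i] :=
  b (inl (existT _ i mu)).
Definition bQ (b : Idx M N -> R[i]) (j : 'I_J) (nu : 'I_(N j).+1) : R[i] :=
  b (inr (existT _ j nu)).
Arguments bP b i mu : clear implicits.
Arguments bQ b j nu : clear implicits.

Definition bpoint (b : Idx M N -> R[i]) : 'I_#|Idx M N| -> R[i] :=
  fun k => b (enum_val k).

Definition Pb (b : Idx M N -> R[i]) (i : 'I_I) (z : R[i]) : R[i] :=
  \sum_(mu < (M i).+1) bP b i mu * z ^+ mu.
Definition Qb (b : Idx M N -> R[i]) (j : 'I_J) (z : R[i]) : R[i] :=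
  \sum_(nu < (N j).+1) bQ b j nu * z ^+ nu.

Definition Bset : set (Idx M N -> R[i]) :=
  [set b | exists i mu, bP b i mu != 0].

Definition Rb (eps del : rat) (b : Idx M N -> R[i]) (z : R[i]) : \bar R :=
  let K := powR (\sum_(i < I) cabs2 (Pb b i z)) (ratr eps / 2) in
  let L := powR (\sum_(j < J) cabs2 (Qb b j z)) (ratr del / 2) in
  if L == 0 then +oo%E else (K / L)%:E.

Definition norm3Q1 (b : Idx M N -> R[i]) (j1 : 'I_J) : R :=
  \sum_(nu < (N j1).+1) cabs (bQ b j1 nu - (nu == N j1 :> nat)%:R).
Definition norm3Q (b : Idx M N -> R[i]) (j : 'I_J) : R :=
  \sum_(nu < (N j).+1) cabs (bQ b j nu).

End Coeffs.

Definition unit_disk {R : realType} : set (R * R) :=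
  [set xy | xy.1 ^+ 2 + xy.2 ^+ 2 < 1].

Definition disk_integral {R : realType} (I J : nat) (M : 'I_I -> nat)
  (N : 'I_J -> nat) (eps del : rat) (b : Idx M N -> R[i]) : \bar R :=
  (\int[(@lebesgue_measure R \x @lebesgue_measure R)%E]_(xy in unit_disk)
     Rb eps del b (xy.1 +i* xy.2))%E.

Definition nondegenerate_pair (eps del : rat) (I J : nat) (M : 'I_I -> nat)
  (N : 'I_J -> nat) : Prop :=
  forall nu l : nat, (nu <= \max_(i < I) M i)%N ->
    (l <= (Num.truncn del).+1 * \max_(j < J) N j)%N ->
    nu%:R * eps + 2 - (l%:R / (Num.truncn del).+1%:R) * del != 0.

(* Main.v *)
(**
Write [p_k(w)] and [q_l(w)] for the sizes of the [k]-th, [l]-th Taylor coefficients at [w]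
of [(P_i)] and [(Q_j)].  The integral of [|P|^eps / |Q|^del] over the disk is comparable to
the maximum, over [k] and over finitely many centers [w], of the supremum over [0 < r <= 1] of
[p_k^eps r^(2 + k eps) / (max_l q_l r^l)^del].  As centers one can take the roots of
[Z Q_1 prod_(j > 1) (n Q_1 + Q_j)] with [n] a large integer: at a point [z] whose nearest center
is [w], each factor is as large as its expansion around [w] allows, and the factors span
[Q_1, ..., Q_J], so [|Q(z)|] is comparable to [max_l q_l r^l] with [r = |z - w|].
Nondegeneracy says that no exponent [2 + k eps - l del] vanishes, so dyadic sums over [r] are
dominated by their largest term, and linear programming duality turns the supremum over [r] into
[p_k^eps] divided by a maximum of products of two rational powers of the [q_l].

The integral is thus a power of the largest of finitely many ratios [f_i / g_i] of maxima of
absolute values of integral polynomials in the coefficients and in a root [w].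
Integer combinations replace each maximum by a single polynomial up to constants, and the
coefficients of [prod_i (1 + Y (g_i + S f_i))] in [Y] and [S], being symmetric in the roots, are
integral polynomials in [b].  The top nonzero power of [Y] counts the pairs [(f_i, g_i) <> (0, 0)],
which defines the strata; the coefficients of [S] there determine the largest ratio.
*)

Require Import Defs.
From HB Require Import structures.
From mathcomp Require Import all_boot all_order all_algebra.
From mathcomp Require Import complex.
From mathcomp Require Import perm mpoly.
From mathcomp Require Import all_classical all_reals all_analysis.
From mathcomp Require Import measurable_realfun.
From mathcomp Require Import ring lra zify.

Set Implicit Arguments.
Unset Strict Implicit.
Unset Printing Implicit Defensive.

Import Order.TTheory GRing.Theory Num.Theory.
Local Open Scope ring_scope.
Local Open Scope classical_set_scope.

(** * Symmetric functions of the roots *)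

Section SymmetricInRoots.
Local Open Scope ring_scope.

(** The obstacle: the centers are not polynomial in [b], and their order is arbitrary, while each
    [T_λ] must be integral in [b] and comparable to the integral with uniform constants. So the
    ratios are reached only through one product over all centers, in which a pair (0, 0), at an
    unknown position, must contribute the harmless factor 1. A given number k of nonzero pairs needs
    two ARPs. In the first, numerator and denominator carry a common factor that forces L to vanish
    wherever K does. Where this K vanishes although some coefficient of Y^k survives, one of the g_i
    is 0 and the integral is infinite; the second ARP records this by an empty denominator. The
    numerical choices: a common denominator [n0] of ε and δ, together with N_1!, which every
    difference l' - l divides, makes all exponents integral after raising to the power [n0] N_1!.
    The value s = 2^-(N_1+1) keeps all centers in the disk of radius 1/2, so that suitable squares
    near them stay inside the unit disk. The integer n satisfies n s >= C, so that n Q_1 dominates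
    Q_j outside that smaller disk. *)

Lemma mmap_comp_mpoly (B L : comNzRingType) (phi : {rmorphism B -> L}) n k
    (t : {mpoly B[n]}) (S : n.-tuple {mpoly B[k]}) (x : 'I_k -> L) :
  mmap phi x (t \mPo S) = mmap phi (fun i => mmap phi x (tnth S i)) t.
Proof.
rewrite comp_mpolyEX raddf_sum /= [RHS]/mmap; apply: eq_bigr => m _.
rewrite mmapZ comp_mpolyX rmorph_prod /= /mmap1; congr (_ * _).
by apply: eq_bigr => i _; rewrite rmorphXn.
Qed.

Lemma mmap_mesym (B : comNzRingType) (L : idomainType) (phi : {rmorphism B -> L}) n
    (x : n.-tuple L) (k : nat) :
  (k <= n)%N ->
  mmap phi (tnth x) (mesym n B k) = (-1) ^+ k * (\prod_(c <- x) ('X - c%:P))`_(n - k).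
Proof.
move=> kn; have kn' : (k < n.+1)%N by [].
rewrite (mroots_coeff x (Ordinal kn')) mulrA -expr2 sqrr_sign mul1r /=.
rewrite /mesym !raddf_sum /=; apply: eq_bigr => i _; rewrite !rmorph_prod /=.
by apply: eq_bigr => j _; rewrite mmapX mmap1U mevalXU.
Qed.

Lemma symmetric_prod_horner (B : comNzRingType) n (Phi : {poly B}) :
  \prod_(t < n) (map_poly (@mpolyC n B) Phi).['X_t] \is symmetric.
Proof.
apply/issymP => s; rewrite rmorph_prod /=.
rewrite [RHS](reindex_inj (@perm_inj _ s)) /=; apply: eq_bigr => t _.
rewrite -(horner_map (msym s)) /= -map_poly_comp.
have -> : map_poly (msym s \o mpolyC n (R:=B)) Phi = map_poly (mpolyC n (R:=B)) Phi.
  by apply: eq_map_poly => c /=; rewrite /msym mmapC.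
by rewrite /msym mmapX mmap1U.
Qed.

(* [Psi] is the resultant of [Wm] and [Phi], so it does not depend on [phi]. *)
Lemma prod_horner_roots (B : comNzRingType) n (Wm Phi : {poly B}) :
  exists Psi : B, forall (L : idomainType) (phi : {rmorphism B -> L}) (x : n.-tuple L),
    map_poly phi Wm = \prod_(c <- x) ('X - c%:P) ->
    phi Psi = \prod_(t < n) (map_poly phi Phi).[tnth x t].
Proof.
have [T [TE _]] := sym_fundamental (@symmetric_prod_horner _ n Phi).
(* By Vieta the signed coefficients of [Wm] are the elementary symmetric functions of its roots;
   they replace the variables of [T]. Neither [phi] nor [x] enters the choice. *)
exists (T.@[fun i : 'I_n => (-1) ^+ i.+1 * Wm`_(n - i.+1)]) => L phi x WE.
have := congr1 (mmap phi (tnth x)) TE.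
rewrite mmap_comp_mpoly rmorph_prod /= => TE'.
transitivity (mmap phi (fun i => mmap phi (tnth x) (tnth [tuple mesym n B i0.+1 | i0 < n] i)) T).
  have -> : (fun i => mmap phi (tnth x) (tnth [tuple mesym n B i0.+1 | i0 < n] i))
      = (fun i : 'I_n => phi ((-1) ^+ i.+1 * Wm`_(n - i.+1))).
    apply/funext => i.
    by rewrite tnth_mktuple mmap_mesym // rmorphM rmorphXn rmorphN1 -WE coef_map.
  rewrite mevalE rmorph_sum /= /mmap; apply: eq_bigr => m _.
  rewrite rmorphM rmorph_prod; congr (_ * _); apply: eq_bigr => i _.
  by rewrite rmorphXn.
rewrite TE'; apply: eq_bigr => t _.
rewrite -horner_map /= -map_poly_comp mmapX mmap1U; congr (_.[_]).
by apply: eq_map_poly => c /=; rewrite mmapC.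
Qed.

End SymmetricInRoots.

(** * Moduli and coefficient norms *)

Section Modulus.
Context {R : realType}.
Implicit Types (x y z : R[i]) (p q : {poly R[i]}).

Lemma cabs2_ge0 z : 0 <= cabs2 z.
Proof. by case: z => a b; rewrite /= addr_ge0 // sqr_ge0. Qed.

Lemma cabs_ge0 z : 0 <= cabs z.
Proof. exact: sqrtr_ge0. Qed.

Lemma sqr_cabs z : cabs z ^+ 2 = cabs2 z.
Proof. by rewrite sqr_sqrtr ?cabs2_ge0. Qed.

(** The bridge to the norm of the complex field: the algebraic laws of [cabs] are pulled back along
    the injective embedding of the reals. *)
Lemma cabsE z : (cabs z)%:C%C = `|z|.
Proof. by case: z => a b; rewrite normc_def. Qed.

Lemma complexR_inj : injective (fun a : R => a%:C%C).
Proof. by move=> a b []. Qed.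

Lemma cabsM x y : cabs (x * y) = cabs x * cabs y.
Proof. by apply: complexR_inj; rewrite rmorphM /= !cabsE normrM. Qed.

Lemma cabsD x y : cabs (x + y) <= cabs x + cabs y.
Proof.
have := ler_normD x y; rewrite -!cabsE -rmorphD /= lecE /=.
by case/andP.
Qed.

Lemma cabsN x : cabs (- x) = cabs x.
Proof. by apply: complexR_inj; rewrite /= !cabsE normrN. Qed.

Lemma cabsB x y : cabs (x - y) <= cabs x + cabs y.
Proof. by rewrite -(cabsN y) cabsD. Qed.

Lemma cabsBC x y : cabs (x - y) = cabs (y - x).
Proof. by rewrite -cabsN opprB. Qed.

Lemma cabs0 : cabs (0 : R[i]) = 0.
Proof. by apply: complexR_inj; rewrite /= cabsE normr0. Qed.

Lemma cabs1 : cabs (1 : R[i]) = 1.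
Proof. by apply: complexR_inj; rewrite /= cabsE normr1. Qed.

Lemma cabs_nat n : cabs (n%:R : R[i]) = n%:R.
Proof. by apply: complexR_inj; rewrite /= cabsE normr_nat rmorph_nat. Qed.

Lemma cabs_eq0 z : (cabs z == 0) = (z == 0).
Proof.
rewrite -(normr_eq0 z) -cabsE; apply/eqP/eqP => [->//|].
by move=> /(@complexR_inj _ 0).
Qed.

Lemma cabs_gt0 z : (0 < cabs z) = (z != 0).
Proof. by rewrite lt0r cabs_ge0 andbT cabs_eq0. Qed.

Lemma cabsX z n : cabs (z ^+ n) = cabs z ^+ n.
Proof. by elim: n => [|n IH]; rewrite ?expr0 ?cabs1 // !exprS cabsM IH. Qed.

Lemma cabs_prod (T : Type) (s : seq T) (P : pred T) (F : T -> R[i]) :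
  cabs (\prod_(i <- s | P i) F i) = \prod_(i <- s | P i) cabs (F i).
Proof. by apply: (big_morph _ cabsM cabs1). Qed.

Lemma cabs_sum (T : Type) (s : seq T) (P : pred T) (F : T -> R[i]) :
  cabs (\sum_(i <- s | P i) F i) <= \sum_(i <- s | P i) cabs (F i).
Proof.
elim/big_rec2: _ => [|i y1 y2 _ IH]; first by rewrite cabs0.
by apply: le_trans (cabsD _ _) _; rewrite lerD2l.
Qed.

(** Weighted l^1 norm of the coefficients: [nrm 1] is |||.|||, and [nrm r] majorises [p] on the disk
    of radius [r]. Applied to a translate of [p] it measures the size of the local expansion without
    cancellation. *)
Definition nrm (r : R) p : R := \sum_(i < size p) cabs p`_i * r ^+ i.

Lemma nrmE r p n : (size p <= n)%N -> nrm r p = \sum_(i < n) cabs p`_i * r ^+ i.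
Proof.
move=> pn; rewrite /nrm (big_ord_widen n (fun i => cabs p`_i * r ^+ i) pn) big_mkcond /=.
apply: eq_bigr => i _; case: ltnP => // h.
by rewrite nth_default // cabs0 mul0r.
Qed.

Lemma nrm_ge0 r p : 0 <= r -> 0 <= nrm r p.
Proof. by move=> r0; apply: sumr_ge0 => i _; rewrite mulr_ge0 ?cabs_ge0 ?exprn_ge0. Qed.

Lemma nrm0 r : nrm r 0 = 0.
Proof. by rewrite /nrm size_poly0 big_ord0. Qed.

Lemma nrmD r p q : 0 <= r -> nrm r (p + q) <= nrm r p + nrm r q.
Proof.
move=> r0; set n := maxn (size p) (size q).
rewrite !(@nrmE r _ n) ?size_polyD ?leq_maxl ?leq_maxr // -big_split /=.
apply: ler_sum => i _; rewrite coefD -mulrDl ler_wpM2r ?exprn_ge0 //.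
exact: cabsD.
Qed.

Lemma nrmZ r c p : nrm r (c *: p) = cabs c * nrm r p.
Proof.
rewrite !(@nrmE r _ (size p)) ?size_scale_leq // mulr_sumr.
by apply: eq_bigr => i _; rewrite coefZ cabsM mulrA.
Qed.

Lemma nrm_cons r p c : nrm r (p * 'X + c%:P) = r * nrm r p + cabs c.
Proof.
rewrite (@nrmE r _ (size p).+1); last first.
  by rewrite -cons_poly_def size_cons_poly; case: ifP.
rewrite big_ord_recl coefD coefMX coefC /= add0r expr0 mulr1 addrC; congr (_ + _).
rewrite /nrm mulr_sumr; apply: eq_bigr => i _.
by rewrite coefD coefMX coefC /= addr0 exprS mulrCA.
Qed.

Lemma nrmMX r p : nrm r (p * 'X) = r * nrm r p.
Proof. by have := nrm_cons r p 0; rewrite cabs0 !addr0. Qed.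

Lemma nrmC r c : nrm r c%:P = cabs c.
Proof. by have := nrm_cons r 0 c; rewrite nrm0 mul0r mulr0 !add0r. Qed.

Lemma nrmX r : nrm r 'X = r.
Proof. by rewrite -['X]mul1r nrmMX nrmC cabs1 mulr1. Qed.

Lemma nrmM r p q : 0 <= r -> nrm r (p * q) <= nrm r p * nrm r q.
Proof.
move=> r0; elim/poly_ind: p => [|p c IH]; first by rewrite mul0r !nrm0 mul0r.
rewrite nrm_cons mulrDl -mulrA ['X * q]mulrC mulrA mul_polyC.
apply: le_trans (nrmD _ _ r0) _; rewrite nrmMX nrmZ mulrDl lerD2r -mulrA.
by rewrite ler_wpM2l.
Qed.

Lemma nrm_prod (T : Type) (s : seq T) (P : pred T) (F : T -> {poly R[i]}) r : 0 <= r ->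
  nrm r (\prod_(i <- s | P i) F i) <= \prod_(i <- s | P i) nrm r (F i).
Proof.
move=> r0; elim/big_rec2: _ => [|i y1 y2 _ IH]; first by rewrite nrmC cabs1.
by apply: le_trans (nrmM _ _ r0) _; rewrite ler_wpM2l ?nrm_ge0.
Qed.

Lemma nrm_XsubC r c : nrm r ('X - c%:P) = r + cabs c.
Proof. by rewrite -['X]mul1r -polyCN nrm_cons cabsN nrmC cabs1 mulr1. Qed.

Lemma cabs_horner_le r p z : cabs z <= r -> cabs p.[z] <= nrm r p.
Proof.
move=> zr; rewrite horner_coef; apply: le_trans (cabs_sum _ _ _) _.
apply: ler_sum => i _; rewrite cabsM cabsX ler_wpM2l ?cabs_ge0 //.
by rewrite lerXn2r // nnegrE ?cabs_ge0 // (le_trans _ zr) ?cabs_ge0.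
Qed.

Lemma cabs_coef_le r p k : 0 <= r -> cabs p`_k * r ^+ k <= nrm r p.
Proof.
move=> r0; rewrite (@nrmE r p (maxn (size p) k.+1)) ?leq_maxl //.
have kn : (k < maxn (size p) k.+1)%N by rewrite leq_max ltnSn orbT.
rewrite (bigD1 (Ordinal kn)) //= lerDl.
by apply: sumr_ge0 => i _; rewrite mulr_ge0 ?cabs_ge0 ?exprn_ge0.
Qed.

(* Newton interpolation: [p = p(x) + (X - x) h] with [h] small at the other nodes. *)
Lemma nrm_interpolation (D d : nat) : exists2 K : R, 0 < K &
  forall p (s : seq nat) (eta : R), (size p <= d)%N -> (d <= size s)%N -> uniq s ->
    (forall x : nat, x \in s -> (x <= D)%N) -> (0 <= eta) ->
    (forall x : nat, x \in s -> cabs p.[x%:R] <= eta) -> nrm 1 p <= K * eta.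
Proof.
elim: d => [|d [K K0 IH]].
  exists 1 => // p s eta; rewrite leqn0 size_poly_eq0 => /eqP -> _ _ _ e0 _.
  by rewrite nrm0 mul1r.
(* The value at [x] costs 1 and the factor X - x has norm at most 1 + D. At the other nodes [h] is
   at most 2 eta, because distinct integers differ by at least 1. *)
exists (1 + (1 + D%:R) * (2 * K)).
  by rewrite addr_gt0 // !mulr_gt0 // ltr_pwDl.
move=> p [//|x s] eta sp ss /= /andP[xs us] sD e0 se.
have xD : (x <= D)%N by apply: sD; rewrite inE eqxx.
pose h := (p - p.[x%:R]%:P) %/ ('X - (x%:R)%:P).
have ph : p = h * ('X - (x%:R)%:P) + p.[x%:R]%:P.
  rewrite /h divpK ?subrK // dvdp_XsubCl rootE !hornerE subrr //.
have sh : (size h <= d)%N.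
  rewrite /h size_divp ?polyXsubC_eq0 // size_XsubC /= leq_subLR add1n.
  rewrite (leq_trans (size_polyD _ _)) // geq_max sp /= size_polyN.
  by rewrite (leq_trans (size_polyC_leq1 _)).
have hs : nrm 1 h <= K * (2 * eta).
  apply: (IH h s) => //; first by move=> y ys; apply: sD; rewrite inE ys orbT.
    by rewrite mulr_ge0.
  move=> y ys.
  have yx : y != x by apply: contraNneq xs => <-.
  have hy : h.[y%:R] * (y%:R - x%:R) = p.[y%:R] - p.[x%:R].
    by rewrite {1}ph !hornerE addrK.
  have : cabs (h.[y%:R] * (y%:R - x%:R)) <= 2 * eta.
    rewrite hy (le_trans (cabsB _ _)) // mulr_natl mulr2n lerD //; apply: se.
      by rewrite inE ys orbT.
    by rewrite inE eqxx.
  apply: le_trans; rewrite cabsM ler_peMr ?cabs_ge0 //.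
  wlog yx' : x y {sp ss xs us sD se xD ph sh ys hy h} yx / (x < y)%N.
    move=> H; case: (ltngtP x y) => [xy|xy|xy]; first exact: H.
      by rewrite cabsBC; apply: H => //; rewrite eq_sym.
    by rewrite xy eqxx in yx.
  by rewrite -natrB ?(ltnW yx') // cabs_nat ler1n subn_gt0.
rewrite ph (le_trans (nrmD _ _ ler01)) // nrmC addrC mulrDl mul1r lerD //.
  by apply: se; rewrite inE eqxx.
rewrite (le_trans (nrmM _ _ ler01)) // nrm_XsubC cabs_nat mulrC.
have -> : (1 + D%:R) * (2 * K) * eta = (1 + D%:R) * (K * (2 * eta)) by ring.
by rewrite ler_pM ?addr_ge0 ?nrm_ge0 // lerD2l ler_nat.
Qed.

(** A node is bad for [g i] if the value there is below a fixed fraction of the norm. More than [d]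
    bad nodes would, by interpolation, bound the norm by half of itself; it is then 0, and no node
    is bad. Hence all the bad nodes together cannot fill #|I| d + 1 places. *)
Lemma common_good_node (I : finType) (d : nat) : exists2 c : R, 0 < c &
  forall g : I -> {poly R[i]}, (forall i, (size (g i) <= d)%N) ->
  exists2 x : nat, (x <= #|I| * d)%N & forall i, c * nrm 1 (g i) <= cabs (g i).[x%:R].
Proof.
set D := (#|I| * d)%N.
have [K K0 HK] := nrm_interpolation D d.
exists ((2 * K)^-1); first by rewrite invr_gt0 mulr_gt0.
move=> g sg.
pose bad i : {set 'I_D.+1} := [set x : 'I_D.+1 | cabs (g i).[(x : nat)%:R] < (2 * K)^-1 * nrm 1 (g i)]%SET.
have badd i : (#|bad i| <= d)%N.
  rewrite leqNgt; apply/negP => db.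
  have n0 := nrm_ge0 (g i) (@ler01 R).
  have : nrm 1 (g i) <= K * ((2 * K)^-1 * nrm 1 (g i)).
    apply: (HK _ (map (@nat_of_ord _) (enum (bad i)))) => //.
    - by rewrite size_map -cardE ltnW.
    - by rewrite map_inj_uniq ?enum_uniq //; exact: val_inj.
    - by move=> x /mapP[y _ ->]; rewrite -ltnS ltn_ord.
    - by rewrite mulr_ge0 // invr_ge0 mulr_ge0 // ltW.
    - by move=> x /mapP[y]; rewrite mem_enum inE => /ltW h ->.
  have -> : K * ((2 * K)^-1 * nrm 1 (g i)) = nrm 1 (g i) / 2.
    by field; rewrite gt_eqF.
  move=> h; have n00 : nrm 1 (g i) = 0 by lra.
  have : (0 < #|bad i|)%N by apply: leq_trans db.
  case/card_gt0P => x; rewrite inE n00 mulr0 ltNge cabs_ge0 //.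
have cb : (#|(\bigcup_i bad i)%SET| <= D)%N.
  apply: (@leq_trans (\sum_i #|bad i|)).
    elim/big_rec2: _ => [|i n U _ leUn]; first by rewrite cards0.
    by rewrite (leq_trans (leq_card_setU _ _)) // leq_add2l.
  apply: (@leq_trans (\sum_(i : I) d)); last by rewrite sum_nat_const.
  exact: leq_sum.
have : (0 < #|(~: \bigcup_i bad i)%SET|)%N.
  by rewrite cardsCs finset.setCK card_ord subn_gt0 ltnS.
case/card_gt0P => x; rewrite inE => /finset.bigcupP xb.
exists x => [|i]; first by rewrite -ltnS ltn_ord.
rewrite leNgt; apply/negP => h; apply: xb; exists i => //.
by rewrite inE.
Qed.

End Modulus.

(** * Reading a maximal ratio off elementary symmetric functions *)

Section ProductRatio.
Variables (R : realType) (I : finType) (S : {set I}) (f g : I -> R) (n : nat).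
Variables (C : nat -> R) (c K : R).
Hypotheses (f0 : forall i, 0 <= f i) (Sn : (#|S| <= n)%N).
Hypotheses (c0 : 0 < c) (K0 : 0 < K).
(** The [C m] behave like the coefficients of the product as a polynomial in rho, but only up to
    constants: these two bounds are what survives once each entry is replaced by integer
    combinations. Everything below is deduced from them. *)
Hypothesis lowC : forall rho : R, 0 <= rho ->
  c * \prod_(i in S) (g i + rho * f i) <= \sum_(m < n.+1) rho ^+ m * C m.
Hypothesis upC : forall (rho : R) m, 0 <= rho -> (m <= n)%N ->
  rho ^+ m * C m <= K * \prod_(i in S) (g i + rho * f i).
Hypothesis g0 : forall i, i \in S -> 0 < g i.

Let G := \prod_(i in S) g i.
Let X := \sum_(i in S) f i / g i.

Let G_gt0 : 0 < G.
Proof. exact: prodr_gt0. Qed.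

Let prodE rho : \prod_(i in S) (g i + rho * f i) =
  G * \prod_(i in S) (1 + rho * (f i / g i)).
Proof.
rewrite -big_split /=; apply: eq_bigr => i iS.
by field; rewrite gt_eqF // g0.
Qed.

Let C0_ge : c * G <= C 0%N.
Proof.
have := lowC (lexx 0); rewrite prodE big_ord_recl /= expr0 mul1r [X in _ + X]big1.
  by rewrite addr0 [X in G * X]big1 ?mulr1 // => i _; rewrite mul0r addr0.
by move=> i _; rewrite /= expr0n mul0r.
Qed.

Let C0_le : C 0%N <= K * G.
Proof.
have := upC (lexx 0) (leq0n n); rewrite prodE expr0 mul1r.
by rewrite [X in G * X]big1 ?mulr1 // => i _; rewrite mul0r addr0.
Qed.

Let C0_gt0 : 0 < C 0%N.
Proof. by apply: lt_le_trans C0_ge; rewrite mulr_gt0. Qed.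

Let x0 i : i \in S -> 0 <= f i / g i.
Proof. by move=> iS; rewrite divr_ge0 // ltW // g0. Qed.

Lemma sum_ratio_ge0 : 0 <= X.
Proof. exact: sumr_ge0. Qed.

(** For y >= X and rho = 1/y each factor 1 + rho f_i/g_i is at most 2, so the upper bound gives C_m
    <= y^m K 2^n G, while G <= C_0/c. Then y = X if X > 0, and y tends to 0 otherwise. *)
Lemma coef_ratio_le m : (0 < m <= n)%N -> C m / C 0%N <= K * 2 ^+ n / c * X ^+ m.
Proof.
move=> /andP[m0 mn].
have H y : 0 < y -> X <= y -> C m / C 0%N <= K * 2 ^+ n / c * y ^+ m.
  move=> y0 Xy; have yi0 : 0 <= y^-1 by rewrite invr_ge0 ltW.
  rewrite ler_pdivrMr //.
  have := upC yi0 mn; rewrite prodE exprVn => h.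
  have {h} : C m <= y ^+ m * (K * (G * \prod_(i in S) (1 + y^-1 * (f i / g i)))).
    by rewrite -ler_pdivrMl ?exprn_gt0.
  move/le_trans; apply.
  have -> : K * 2 ^+ n / c * y ^+ m * C 0%N = y ^+ m * (K * (2 ^+ n * (C 0%N / c))) by ring.
  rewrite ler_wpM2l ?exprn_ge0 ?(ltW y0) // ler_wpM2l ?(ltW K0) //.
  rewrite mulrC ler_pM ?(ltW G_gt0) //.
  - by apply: prodr_ge0 => i iS; rewrite addr_ge0 // mulr_ge0 // x0.
  - apply: (@le_trans _ _ (\prod_(i in S) 2)).
      apply: ler_prod => i iS.
      have a0 : 0 <= y^-1 * (f i / g i) by rewrite mulr_ge0 // x0.
      rewrite addr_ge0 //=.
      rewrite -[2]/(1 + 1) lerD2l mulrC ler_pdivrMr // mul1r (le_trans _ Xy) //.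
      by rewrite /X (bigD1 i) //= lerDl sumr_ge0 // => j /andP[jS _]; rewrite x0.
    by rewrite prodr_const ler_weXn2l ?ler1n.
  - by rewrite ler_pdivlMr // mulrC.
have := sum_ratio_ge0; rewrite le_eqVlt => /predU1P[X0|X0]; last exact: H.
have kc : 0 < K * 2 ^+ n / c by rewrite !mulr_gt0 ?invr_gt0 ?exprn_gt0.
rewrite -X0 expr0n gtn_eqF //= mulr0 leNgt; apply/negP => Cm.
set k := K * 2 ^+ n / c in H kc; set z := C m / C 0%N in Cm H.
(* Small enough that k y^m <= k y <= z/2, against z <= k y^m. *)
pose y := Num.min 1 (z / (2 * k)).
have y0 : 0 < y by rewrite lt_min ltr01 /= divr_gt0 // mulr_gt0.
have Xy : X <= y by rewrite -X0 ltW.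
have := H y y0 Xy; rewrite leNgt => /negP; apply.
apply: (@le_lt_trans _ _ (k * y)).
  rewrite (ler_wpM2l (ltW kc)) // -[leRHS]expr1 ler_wiXn2l ?(ltW y0) //.
  by rewrite ge_min lexx.
apply: (@le_lt_trans _ _ (k * (z / (2 * k)))).
  by rewrite (ler_wpM2l (ltW kc)) // ge_min lexx orbT.
have -> : k * (z / (2 * k)) = z / 2 by field; rewrite gt_eqF.
by rewrite ltr_pdivrMr // mulr_natr mulr2n ltrDl.
Qed.

(** With rho = 1/y every term rho^m C_m is at most C_0, so the lower bound caps the product of the 1
    + rho f_i/g_i, and that product is at least 1 + X/y. *)
Lemma sum_ratio_le y : 0 < y ->
  (forall m, (0 < m <= n)%N -> C m / C 0%N <= y ^+ m) -> X <= K * n.+1%:R / c * y.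
Proof.
move=> y0 Cy.
have yi0 : 0 <= y^-1 by rewrite invr_ge0 ltW.
have sumle : 1 + X / y <= \prod_(i in S) (1 + y^-1 * (f i / g i)).
  have -> : X / y = \sum_(i in S) y^-1 * (f i / g i) by rewrite mulrC mulr_sumr.
  suff h : forall s : seq I, all (mem S) s -> 0 <= \sum_(i <- s) y^-1 * (f i / g i) /\
     1 + \sum_(i <- s) y^-1 * (f i / g i) <= \prod_(i <- s) (1 + y^-1 * (f i / g i)).
    rewrite -!big_enum /=; have [|//] := h (enum S).
    by apply/allP => i; rewrite mem_enum.
  elim=> [|i s IH] /=; first by rewrite !big_nil addr0.
  move=> /andP[iS /IH[t0 h]]; rewrite !big_cons.
  have a0 : 0 <= y^-1 * (f i / g i) by rewrite mulr_ge0 // x0.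
  split; first by rewrite addr_ge0.
  rewrite (le_trans _ (ler_wpM2l _ h)) ?addr_ge0 //.
  have := mulr_ge0 a0 t0; lra.
have := lowC yi0; rewrite prodE => h.
have : c * (G * (1 + X / y)) <= K * G * n.+1%:R.
  apply: (@le_trans _ _ (\sum_(m < n.+1) y^-1 ^+ m * C m)).
    apply: le_trans h; rewrite ler_wpM2l ?(ltW c0) // ler_wpM2l ?(ltW G_gt0) //.
  apply: (@le_trans _ _ (\sum_(m < n.+1) K * G)); last first.
    by rewrite sumr_const card_ord mulr_natr.
  apply: ler_sum => m _; apply: le_trans C0_le.
  rewrite exprVn ler_pdivrMl ?exprn_gt0 // mulrC -ler_pdivrMl // mulrC.
  case: (posnP m) => [->|m0]; first by rewrite divff ?gt_eqF.
  by apply: Cy; rewrite m0 -ltnS ltn_ord.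
have -> : K * G * n.+1%:R = c * (G * (K * n.+1%:R / c)) by field; rewrite gt_eqF.
rewrite ler_pM2l // ler_pM2l // => {}h.
rewrite -ler_pdivrMr //; apply: le_trans h; by rewrite lerDr.
Qed.

End ProductRatio.

(** The outer indeterminate is Y and counts pairs; the inner one is S and separates [v] from [u]. A
    pair (0, 0) gives the factor 1. *)
Definition linfac (S : comNzRingType) (u v : S) : {poly {poly S}} :=
  1 + (u%:P + v *: 'X)%:P * 'X.

Lemma prod_lin_coef (S : comNzRingType) (T : Type) (s : seq T) (u : T -> S) :
  (size (\prod_(i <- s) (1 + (u i)%:P * 'X))%R <= (size s).+1)%N /\
  (\prod_(i <- s) (1 + (u i)%:P * 'X))`_(size s) = \prod_(i <- s) u i.
Proof.
elim: s => [|a s [IH1 IH2]] /=; first by rewrite !big_nil size_poly1 coef1.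
rewrite !big_cons; set q := \prod_(_ <- _) (1 + _) in IH1 IH2 *.
have E : (1 + (u a)%:P * 'X) * q = u a *: q * 'X + q.
  by rewrite mulrDl mul1r -mulrA ['X * q]mulrC mulrA mul_polyC addrC.
rewrite E; split.
  rewrite (leq_trans (size_polyD _ _)) // geq_max (leq_trans IH1) // andbT.
  by rewrite (leq_trans (size_polyMleq _ _)) // size_polyX addn2 /= ltnS (leq_trans (size_scale_leq _ _)).
rewrite coefD coefMX /= coefZ IH2 [X in _ + X]nth_default ?addr0 //.
Qed.

(** Only the indices in [Z] contribute to the degree in Y, so the coefficient at #|Z| picks the
    linear form from each of their factors. *)
Lemma prod_linfac_coef (S : comNzRingType) (I : finType) (Z : {set I}) (u v : I -> S) :
  (forall i, i \notin Z -> u i = 0 /\ v i = 0) ->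
  (forall n, (#|Z| < n)%N -> (\prod_i linfac (u i) (v i))`_n = 0) /\
  (\prod_i linfac (u i) (v i))`_#|Z| = \prod_(i in Z) ((u i)%:P + v i *: 'X).
Proof.
move=> uv0.
have -> : \prod_i linfac (u i) (v i) = \prod_(i <- enum Z) (1 + ((u i)%:P + v i *: 'X)%:P * 'X).
  rewrite big_enum /= [LHS](bigID (mem Z)) /= [X in _ * X]big1 ?mulr1 //.
  move=> i /uv0[-> ->].
  by rewrite /linfac scale0r addr0 !polyC0 mul0r addr0.
have [h1 h2] := prod_lin_coef (enum Z) (fun i => (u i)%:P + v i *: 'X).
rewrite -cardE in h1 h2; split; last by rewrite h2 big_enum.
by move=> n zn; rewrite nth_default // (leq_trans h1).
Qed.

Section StratumBounds.
Context {R : realType}.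
Implicit Types (p q : {poly R[i]}).

Lemma nrm_le_pow r p d : 1 <= r -> (size p <= d)%N -> nrm r p <= r ^+ d * nrm 1 p.
Proof.
move=> r1 sp; rewrite /nrm mulr_sumr; apply: ler_sum => i _.
rewrite expr1n mulr1 mulrC ler_wpM2r ?cabs_ge0 // ler_weXn2l //.
by rewrite (leq_trans _ sp) // ltnW.
Qed.

Lemma nrm_addMXn r p q d : (size p <= d)%N -> nrm r (p + q * 'X^d) = nrm r p + r ^+ d * nrm r q.
Proof.
move=> sp; rewrite (@nrmE _ r (p + q * 'X^d) (d + size q)); last first.
  rewrite (leq_trans (size_polyD _ _)) // geq_max (leq_trans sp) ?leq_addr //=.
  by rewrite (leq_trans (size_polyMleq _ _)) // size_polyXn addnS /= addnC.
rewrite big_split_ord /= (nrmE r sp); congr (_ + _).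
  by apply: eq_bigr => i _; rewrite coefD coefMXn ltn_ord addr0.
rewrite /nrm mulr_sumr; apply: eq_bigr => i _.
by rewrite coefD coefMXn ltnNge leq_addr /= addKn nth_default ?add0r ?exprD 1?mulrCA // (leq_trans sp) ?leq_addr.
Qed.

(* The nodes make one integer combination of the entries of each [gP i], [fP i] do duty for
   their norms; the powers of [rho] are kept apart by the coefficients in ['X]. *)
Lemma stratum_coef_bounds (I : finType) (dG dF : nat) :
  exists c K : R, [/\ 0 < c, 0 < K &
  forall (gP fP : I -> {poly R[i]}), (forall i, (size (gP i) <= dG)%N) ->
    (forall i, (size (fP i) <= dF)%N) -> forall Z : {set I},
    let D := (#|I| * (dG + dF))%N in
    let C m := \sum_(t < D.+1) cabs (\prod_(i in Z)
      ((gP i).[t%:R]%:P + (t%:R ^+ dG * (fP i).[t%:R]) *: 'X))`_m in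
    (forall rho : R, 0 <= rho ->
      c * \prod_(i in Z) (nrm 1 (gP i) + rho * nrm 1 (fP i)) <=
      \sum_(m < #|I|.+1) rho ^+ m * C m) /\
    (forall (rho : R) (m : nat), 0 <= rho ->
      rho ^+ m * C m <= K * \prod_(i in Z) (nrm 1 (gP i) + rho * nrm 1 (fP i)))].
Proof.
have [c0 c00 Hc] := @common_good_node R I (dG + dF).
set D := (#|I| * (dG + dF))%N in Hc *.
(* Taking [c] at most 1 lets c^#|Z| be replaced by c^#|I|. [B] absorbs the powers of the node, which
   is at most [D]. *)
pose c := Num.min 1 c0; pose B : R := D.+1%:R ^+ (dG + dF).
have c_gt0 : 0 < c by rewrite lt_min ltr01.
have B1 : 1 <= B by rewrite exprn_ege1 // ler1n.
have B0 : 0 < B by apply: lt_le_trans B1.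
exists (c ^+ #|I|), (D.+1%:R * B ^+ #|I|); split; rewrite ?exprn_gt0 //.
  by rewrite mulr_gt0 ?exprn_gt0 ?ltr0n.
move=> gP fP sG sF Z /=.
pose L t i : {poly R[i]} := ((gP i).[t%:R]%:P + (t%:R ^+ dG * (fP i).[t%:R]) *: 'X).
rewrite -/(L _ _).
have gf0 rho i : 0 <= rho -> 0 <= nrm 1 (gP i) + rho * nrm 1 (fP i).
  by move=> r0; rewrite addr_ge0 ?mulr_ge0 ?nrm_ge0.
have sL t : (size (\prod_(i in Z) L t i)%R <= #|I|.+1)%N.
  rewrite (leq_trans (size_prod_leq _ _)) // leq_subLR addnS ltnS.
  apply: (@leq_trans (\sum_(i in Z) 2)).
    apply: leq_sum => i _; rewrite (leq_trans (size_polyD _ _)) // geq_max.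
    by rewrite (leq_trans (size_polyC_leq1 _)) //= (leq_trans (size_scale_leq _ _)) // size_polyX.
  by rewrite sum_nat_const muln2 -addnn leq_add2l max_card.
split=> [rho r0|rho m r0].
  (* Stacking rho [fP] above [gP] makes the norm exactly the sum of the two norms, so a single node
     serves both. That node depends on rho, which is why [C m] sums over all nodes. *)
  pose h i := gP i + (rho%:C%C *: fP i) * 'X^dG.
  have sh i : (size (h i) <= dG + dF)%N.
    rewrite (leq_trans (size_polyD _ _)) // geq_max (leq_trans (sG i)) ?leq_addr //=.
    rewrite (leq_trans (size_polyMleq _ _)) // size_polyXn addnS /= addnC leq_add2l.
    by rewrite (leq_trans (size_scale_leq _ _)).
  have rC : cabs (rho%:C%C) = rho.
    by apply: complexR_inj; rewrite cabsE ger0_norm // lecR.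
  have nh i : nrm 1 (h i) = nrm 1 (gP i) + rho * nrm 1 (fP i).
    by rewrite nrm_addMXn // expr1n mul1r nrmZ rC.
  have [t tD Ht] := Hc h sh.
  have tD' : (t < D.+1)%N by [].
  apply: (@le_trans _ _ (cabs (\prod_(i in Z) L t i).[rho%:C%C])).
    rewrite horner_prod cabs_prod.
    apply: (@le_trans _ _ (c ^+ #|Z| * \prod_(i in Z) (nrm 1 (gP i) + rho * nrm 1 (fP i)))).
      rewrite ler_wpM2r ?prodr_ge0 //; first by move=> i _; exact: gf0.
      by rewrite ler_wiXn2l ?max_card ?(ltW c_gt0) // ge_min lexx.
    rewrite -prodr_const -big_split /=; apply: ler_prod => i _.
    rewrite mulr_ge0 ?gf0 ?(ltW c_gt0) //=.
    have -> : (L t i).[rho%:C%C] = (h i).[t%:R].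
      by rewrite /L /h !hornerE; ring.
    apply: le_trans (Ht i); rewrite nh ler_wpM2r ?gf0 //.
    by rewrite ge_min lexx orbT.
  rewrite (le_trans (@cabs_horner_le _ rho _ _ _)) ?rC //.
  rewrite (nrmE _ (sL t)); apply: ler_sum => m _.
  rewrite mulrC ler_wpM2l ?exprn_ge0 // (bigD1 (Ordinal tD')) //= lerDl.
  by apply: sumr_ge0 => *; exact: cabs_ge0.
rewrite mulr_sumr -mulrA.
have -> : D.+1%:R * (B ^+ #|I| * \prod_(i in Z) (nrm 1 (gP i) + rho * nrm 1 (fP i)))
   = \sum_(t < D.+1) (B ^+ #|I| * \prod_(i in Z) (nrm 1 (gP i) + rho * nrm 1 (fP i))).
  by rewrite sumr_const card_ord mulr_natl.
apply: ler_sum => t _.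
rewrite mulrC (le_trans (@cabs_coef_le _ rho _ _ _)) //.
rewrite (le_trans (nrm_prod _ _ _ r0)) //.
apply: (@le_trans _ _ (B ^+ #|Z| * \prod_(i in Z) (nrm 1 (gP i) + rho * nrm 1 (fP i)))); last first.
  rewrite ler_wpM2r ?prodr_ge0 //; first by move=> i _; exact: gf0.
  by rewrite ler_weXn2l ?max_card.
rewrite -prodr_const -big_split /=; apply: ler_prod => i _.
rewrite nrm_ge0 //= (le_trans (nrmD _ _ r0)) // nrmC nrmZ nrmX mulrDr.
have D1 : (1 : R) <= D.+1%:R by rewrite ler1n.
have tD : cabs (t%:R : R[i]) <= D.+1%:R by rewrite cabs_nat ler_nat ltnW.
have evle p d : (size p <= d)%N -> cabs p.[t%:R] <= D.+1%:R ^+ d * nrm 1 p.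
  by move=> sp; rewrite (le_trans (cabs_horner_le _ tD)) // nrm_le_pow.
apply: lerD.
  rewrite (le_trans (evle _ _ (sG i))) // ler_wpM2r ?nrm_ge0 // ler_weXn2l //.
  by rewrite leq_addr.
rewrite mulrC mulrCA ler_wpM2l // cabsM cabsX /B exprD -mulrA.
rewrite ler_pM ?exprn_ge0 ?cabs_ge0 ?evle //.
by rewrite lerXn2r // nnegrE ?cabs_ge0.
Qed.

End StratumBounds.

(** * Chains of algebraic subsets *)

Lemma meval_map_mpoly (S L : comNzRingType) (phi : {rmorphism S -> L}) n (x : 'I_n -> L)
    (p : {mpoly S[n]}) : meval x (map_mpoly phi p) = mmap phi x p.
Proof.
elim/mpolyind: p => [|c m p _ _ IH]; first by rewrite raddf0 meval0 mmap0.
by rewrite raddfD mevalD IH mmapD /= map_mpolyZ map_mpolyX mevalZ mevalX mmapZ mmapX.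
Qed.

Section Chains.
Context {R : realType} {I J : nat} {M : 'I_I -> nat} {N : 'I_J -> nat}.
Notation pt := (Idx M N -> R[i]).
Notation A := {mpoly int[#|Idx M N|]}.
Implicit Types (b : pt) (ps Ks Ls : seq A).

Definition ev b : {rmorphism A -> R[i]} := mmap (intmul 1 : {rmorphism int -> R[i]}) (bpoint b).

Definition zset ps : set pt := [set b | Bset b /\ forall p, p \in ps -> ev b p = 0].

Lemma zset_algebraic ps :
  exists V, algebraic_set V /\ zset ps = @Bset R I J M N `&` [set b | V (bpoint b)].
Proof.
exists [set x | forall p, p \in map (map_mpoly (intmul 1 : int -> R[i])) ps -> meval x p = 0].
split; first by eexists.
have E b p : meval (bpoint b) (map_mpoly (intmul 1 : int -> R[i])  p) = ev b p.
  exact: meval_map_mpoly.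
apply/seteqP; split=> b /= [Bb h]; split=> //.
  by move=> p /mapP[q qp ->]; rewrite E h.
by move=> p pp; rewrite -E h // map_f.
Qed.

Section Solvable.
Variables (f : pt -> \bar R) (good : set pt).

(** The conclusion of the theorem for an arbitrary starting set, so that chains can be built from
    the bottom upwards. Item 1 is a consequence of the last clause and is recovered at the end. *)
Definition stratified (U0 : set pt) :=
  exists (NN : nat) (U : nat -> set pt) (T : nat -> ARP #|Idx M N|),
    U 0%N = U0 /\ U NN = set0 /\
    (forall l, (l < NN)%N -> U l.+1 `<=` U l) /\
    (forall l, (l <= NN)%N ->
       exists V, algebraic_set V /\ U l = Bset `&` [set b | V (bpoint b)]) /\
    (exists c1 c2 : R, 0 < c1 /\ 0 < c2 /\
       forall l, (l < NN)%N -> forall b, U l b -> ~ U l.+1 b -> good b ->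
         (c1%:E * arp_eval (T l) (bpoint b) <= f b)%E /\
         (f b <= c2%:E * arp_eval (T l) (bpoint b))%E) /\
    (forall l, (l < NN)%N ->
       U l.+1 = [set b | U l b /\ arpK (T l) (bpoint b) = 0] /\
       U l.+1 = [set b | U l b /\ arpK (T l) (bpoint b) = 0 /\
                         arpL (T l) (bpoint b) = 0]).

Lemma arp_eval_ge0 (T : ARP #|Idx M N|) b : (0 <= arp_eval T (bpoint b))%E.
Proof.
rewrite /arp_eval; case: ifP => // _.
by rewrite lee_fin divr_ge0 // /arpK /arpL /abspolypow powR_ge0.
Qed.

Lemma stratified_cons ps ps' (T : ARP #|Idx M N|) :
  zset ps' = [set b | zset ps b /\ arpK T (bpoint b) = 0] ->
  zset ps' = [set b | zset ps b /\ arpK T (bpoint b) = 0 /\ arpL T (bpoint b) = 0] ->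
  (exists c1 c2 : R, 0 < c1 /\ 0 < c2 /\
     forall b, zset ps b -> ~ zset ps' b -> good b ->
         (c1%:E * arp_eval T (bpoint b) <= f b)%E /\
         (f b <= c2%:E * arp_eval T (bpoint b))%E) ->
  stratified (zset ps') -> stratified (zset ps).
Proof.
move=> E1 E2 [c1 [c2 [c10 [c20 Hc]]]].
move=> [NN [U [TT [U0 [UN [Um [Ua [[d1 [d2 [d10 [d20 Hd]]]] Ue]]]]]]]].
exists NN.+1, (fun l => if l is l'.+1 then U l' else zset ps),
  (fun l => if l is l'.+1 then TT l' else T).
split=> //; split=> //; split; last split; last split.
- case=> [_|l /Um //]; rewrite U0 E1 => b [] //.
- case=> [_|l /Ua //]; exact: zset_algebraic.
(* The chain is finite, so the constants may be merged stratum by stratum. *)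
- exists (Num.min c1 d1), (Num.max c2 d2).
  split; first by rewrite lt_min c10.
  split; first by rewrite lt_max c20.
  + move=> l lN b Ub Ub' gb.
    have [e1 [e2 [e10 [e20 [le1 [le2 [h1 h2]]]]]]] : exists e1 e2, 0 < e1 /\ 0 < e2 /\
        Num.min c1 d1 <= e1 /\ e2 <= Num.max c2 d2 /\
       (e1%:E * arp_eval (if l is l'.+1 then TT l' else T) (bpoint b) <= f b)%E /\
         (f b <= e2%:E * arp_eval (if l is l'.+1 then TT l' else T) (bpoint b))%E.
      case: l lN Ub Ub' => [_|l lN] Ub Ub'.
        exists c1, c2; rewrite ge_min le_max !lexx; do 4! [split=> //].
        by apply: Hc => //; rewrite -U0.
      by exists d1, d2; rewrite ge_min le_max !lexx !orbT; do 4! [split=> //]; apply: Hd.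
    split.
      by apply: le_trans h1; rewrite lee_wpmul2r ?arp_eval_ge0 ?lee_fin.
    by apply: (le_trans h2); rewrite lee_wpmul2r ?arp_eval_ge0 ?lee_fin.
- by case=> [_|l /Ue[]] //; rewrite U0.
Qed.

Definition sqsum Ks b : R := \sum_(p <- Ks) cabs2 (ev b p).

Lemma sqsum_ge0 Ks b : 0 <= sqsum Ks b.
Proof. by apply: sumr_ge0 => p _; exact: cabs2_ge0. Qed.

Lemma sqsum_eq0 Ks b : sqsum Ks b = 0 <-> forall p, p \in Ks -> ev b p = 0.
Proof.
rewrite /sqsum; elim: Ks => [|p s IH]; first by rewrite big_nil.
rewrite big_cons; split=> [/eqP|h].
  rewrite paddr_eq0 ?cabs2_ge0 ?sqsum_ge0 // => /andP[].
  rewrite -sqr_cabs sqrf_eq0 cabs_eq0 => /eqP p0 /eqP /IH h q.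
  by rewrite inE => /predU1P[->|/h].
have /IH -> : forall q, q \in s -> ev b q = 0 by move=> q qs; apply: h; rewrite inE qs orbT.
by rewrite h ?inE ?eqxx // -sqr_cabs cabs0 expr0n addr0.
Qed.

(** A sum of squared moduli vanishes exactly when all its polynomials do, so adjoining [Ks] to the
    equations cuts out the zero locus of K. The first hypothesis makes L vanish there too, as item 3
    demands. *)
Lemma stratified_step ps Ks Ls (e : rat) (e0 : 0 < e) :
  (forall b, zset ps b -> (forall p, p \in Ks -> ev b p = 0) -> forall p, p \in Ls -> ev b p = 0) ->
  (exists c1 c2 : R, 0 < c1 /\ 0 < c2 /\
     forall b, zset ps b -> good b -> 0 < sqsum Ks b ->
       if sqsum Ls b == 0 then f b = +oo%E else
         ((c1 * (powR (sqsum Ks b) (ratr e / 2) / powR (sqsum Ls b) (ratr e / 2)))%:E <= f b)%E /\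
         (f b <= (c2 * (powR (sqsum Ks b) (ratr e / 2) / powR (sqsum Ls b) (ratr e / 2)))%:E)%E) ->
  stratified (zset (ps ++ Ks)) -> stratified (zset ps).
Proof.
move=> KL [c1 [c2 [c10 [c20 Hc]]]].
have zE b : zset (ps ++ Ks) b <-> zset ps b /\ sqsum Ks b = 0.
  rewrite sqsum_eq0; split=> [[Bb h]|[[Bb h] k]].
    by split; [split=> //|] => p pp; apply: h; rewrite mem_cat pp ?orbT.
  by split=> // p; rewrite mem_cat => /orP[/h|/k].
have re : 0 < (ratr e : R) / 2 by rewrite divr_gt0 // ltr0q.
(* An ARP needs a nonzero polynomial in its numerator. If all of [Ks] are zero, adjoining them
   changes nothing and no stratum is inserted. *)
case: (boolP (has (fun p : A => p != 0) Ks)) => [hK|]; last first.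
  move=> /hasPn hK; suff -> : zset (ps ++ Ks) = zset ps by [].
  apply/seteqP; split=> b; first by case/zE.
  move=> zb; apply/zE; split=> //; apply/sqsum_eq0 => p /hK.
  by rewrite negbK => /eqP ->; rewrite rmorph0.
pose T := @MkARP #|Idx M N| Ks Ls e e (ltW e0) (ltW e0) hK.
have KE b : arpK T (bpoint b) = powR (sqsum Ks b) (ratr e / 2) by [].
have LE b : arpL T (bpoint b) = powR (sqsum Ls b) (ratr e / 2) by [].
have p0 (x : R) : 0 <= x -> (powR x (ratr e / 2) == 0) = (x == 0).
  by move=> x0; rewrite powR_eq0 (gt_eqF re) andbT.
apply: (@stratified_cons _ _ T).
- apply/seteqP; split=> b /=; rewrite KE.
    by move/zE => [h1 h2]; split=> //; apply/eqP; rewrite p0 ?h2 ?sqsum_ge0.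
  by move=> [h1 /eqP h2]; apply/zE; split=> //; apply/eqP; rewrite -p0 ?sqsum_ge0.
- apply/seteqP; split=> b /=; rewrite KE LE.
    move/zE => [h1 h2]; split=> //; split; apply/eqP; rewrite p0 ?h2 ?sqsum_ge0 //.
    by apply/eqP/sqsum_eq0; apply: KL => //; exact/sqsum_eq0.
  by move=> [h1 [/eqP h2 _]]; apply/zE; split=> //; apply/eqP; rewrite -p0 ?sqsum_ge0.
- exists c1, c2; do 2! [split=> //] => b zb zb' gb.
  have K0 : 0 < sqsum Ks b.
    by rewrite lt0r sqsum_ge0 andbT; apply/eqP => h; apply: zb'; apply/zE.
  have := Hc b zb gb K0; rewrite /arp_eval LE KE p0 ?sqsum_ge0 //.
  case: ifP => [_ ->|_ [h1 h2]]; last by rewrite -!EFinM.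
  by rewrite !gt0_muley ?lte_fin // leey.
Qed.

(** Without good points the estimate is vacuous; K = L = 1 has no zero, so the next set is empty and
    the chain stops. *)
Lemma stratified_end ps : (forall b, zset ps b -> ~ good b) -> stratified (zset ps).
Proof.
move=> H; apply: (@stratified_step ps [:: 1] [:: 1] 1) => //.
  by exists 1, 1; do 2! [split=> //] => b /H.
have -> : zset (ps ++ [:: 1]) = set0.
  apply/seteqP; split=> b //= [_ /(_ 1)]; rewrite mem_cat inE eqxx orbT => /(_ isT) /eqP.
  by rewrite rmorph1 oner_eq0.
have nz1 : has (fun p : A => p != 0) [:: 1] by rewrite /= oner_neq0.
exists 0%N, (fun=> set0), (fun=> @MkARP _ [:: 1] [::] 0 0 (lexx _) (lexx _) nz1).
do 3! [split=> //]; split.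
  move=> l _; have [V [? hV]] := zset_algebraic [:: 1]; exists V; split=> //.
  rewrite -hV; apply/seteqP; split=> b //= [_ /(_ 1)]; rewrite inE eqxx => /(_ isT) /eqP.
  by rewrite rmorph1 oner_eq0.
by split; first exists 1, 1.
Qed.

End Solvable.
End Chains.

(** * Powers of sums against sums of powers *)

Section PowerSums.
Variable R : realType.

Lemma sum_exp_le (D k : nat) (x : 'I_D -> R) : (forall t, 0 <= x t) ->
  \sum_t x t ^+ k <= D%:R * (\sum_t x t) ^+ k.
Proof.
move=> x0; have -> : D%:R * (\sum_t x t) ^+ k = \sum_(s < D) (\sum_t x t) ^+ k.
  by rewrite sumr_const card_ord mulr_natl.
apply: ler_sum => t _; rewrite lerXn2r ?nnegrE ?sumr_ge0 //.
by rewrite (bigD1 t) //= lerDl sumr_ge0.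
Qed.

Lemma exp_sum_le (D k : nat) (x : 'I_D -> R) : (0 < D)%N -> (forall t, 0 <= x t) ->
  (\sum_t x t) ^+ k <= D%:R ^+ k * \sum_t x t ^+ k.
Proof.
case: D x => // D x _ x0.
pose t := [arg max_(t > ord0) x t]%O.
have tx s : x s <= x t by rewrite /t; case: arg_maxP => // i _; apply.
apply: (@le_trans _ _ ((D.+1%:R * x t) ^+ k)).
  rewrite lerXn2r ?nnegrE ?sumr_ge0 ?mulr_ge0 //.
  have -> : D.+1%:R * x t = \sum_(s < D.+1) x t by rewrite sumr_const card_ord mulr_natl.
  exact: ler_sum.
rewrite exprMn ler_wpM2l ?exprn_ge0 // (bigD1 t) //= lerDl.
by rewrite sumr_ge0 // => s _; rewrite exprn_ge0.
Qed.

(* [V] is a ratio of sums of squares of monomials in the [cm m t] realising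
   [max_m (C_m / C_0) ^ (2 n! / m)], which is comparable to [X ^ (2 n!)]. *)
Lemma ratio_monomial_sums (n D : nat) (kap kap' : R) : (0 < n)%N -> (0 < D)%N ->
  0 < kap -> 0 < kap' -> exists al be : R, [/\ 0 < al, 0 < be &
  forall (cm : nat -> 'I_D -> R) (X : R), (forall m t, 0 <= cm m t) -> 0 <= X ->
  let C m := \sum_t cm m t in 0 < C 0%N ->
  (forall m, (0 < m <= n)%N -> C m / C 0%N <= kap * X ^+ m) ->
  (forall y, 0 < y -> (forall m, (0 < m <= n)%N -> C m / C 0%N <= y ^+ m) -> X <= kap' * y) ->
  let V := (\sum_(x : 'I_n * 'I_D * 'I_D) (cm x.1.1.+1 x.1.2 ^+ (n`! %/ x.1.1.+1) *
     cm 0%N x.2 ^+ (n`! - n`! %/ x.1.1.+1)) ^+ 2) / (\sum_t (cm 0%N t ^+ n`!) ^+ 2) in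
  0 < V -> al * X ^+ (2 * n`!) <= V <= be * X ^+ (2 * n`!)].
Proof.
move=> n0 D0 kap0 kap0'; set a := n`!.
have DR0 : 0 < D%:R :> R by rewrite ltr0n.
have D1 : 1 <= D%:R :> R by rewrite ler1n.
exists ((kap' ^+ (2 * a) * D%:R ^+ (2 * a + 1))^-1), (n%:R * (D%:R ^+ (2 + 2 * a) * (1 + kap) ^+ (2 * a))).
have k1 : 0 < 1 + kap by rewrite addr_gt0.
split.
- by rewrite invr_gt0 mulr_gt0 ?exprn_gt0.
- by rewrite mulr_gt0 ?ltr0n // mulr_gt0 // exprn_gt0.
move=> cm X cm0 X0 C C00 upC lowC V V0.
have a0 : (0 < a)%N := fact_gt0 n.
(* The exponent n!/m brings every C_m/C_0 to the common order X^(n!); the complementary power of C_0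
   brings all terms over one denominator. *)
pose k m := (a %/ m)%N.
have km m : (0 < m <= n)%N -> (m * k m = a)%N.
  by move=> h; rewrite /k mulnC divnK // dvdn_fact.
have ka m : (k m <= a)%N by exact: leq_div.
have kn0 m : (0 < m <= n)%N -> (0 < k m)%N.
  by move=> h; have := km _ h; case: (k m) => //; rewrite muln0 => h0; move: a0; rewrite -h0.
have C0 m : 0 <= C m by exact: sumr_ge0.
pose S k m : R := \sum_t cm m t ^+ k.
have S_ge0 j m : 0 <= S j m by apply: sumr_ge0 => t _; exact: exprn_ge0.
have S0E : \sum_t (cm 0%N t ^+ a) ^+ 2 = S (2 * a)%N 0%N.
  by apply: eq_bigr => t _; rewrite -exprM mulnC.
have S0_gt0 : 0 < S (2 * a)%N 0%N.
  have := exp_sum_le (2 * a) D0 (cm0 0%N); rewrite -/(C 0%N) -/(S _ _) => h.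
  have : 0 < D%:R ^+ (2 * a) * S (2 * a)%N 0%N by apply: lt_le_trans h; rewrite exprn_gt0.
  by rewrite (pmulr_rgt0 _ (exprn_gt0 _ DR0)).
pose W m := S (2 * k m)%N m * S (2 * (a - k m))%N 0%N / S (2 * a)%N 0%N.
have VE : V = \sum_(m < n) W m.+1.
  rewrite /V S0E -mulr_suml; congr (_ / _).
  rewrite -(pair_bigA _ (fun (mt : 'I_n * 'I_D) (t' : 'I_D) => (cm mt.1.+1 mt.2 ^+ (a %/ mt.1.+1) *
     cm 0%N t' ^+ (a - a %/ mt.1.+1)) ^+ 2)) /=.
  rewrite -(pair_bigA _ (fun (m : 'I_n) (t : 'I_D) => \sum_t' (cm m.+1 t ^+ (a %/ m.+1) *
     cm 0%N t' ^+ (a - a %/ m.+1)) ^+ 2)) /=.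
  apply: eq_bigr => m _; rewrite /S big_distrlr /=.
  apply: eq_bigr => t _; apply: eq_bigr => t' _.
  by rewrite exprMn -!exprM ![(_ * 2)%N]mulnC.
have W_ge0 m : 0 <= W m by rewrite /W divr_ge0 // mulr_ge0.
have CV m : (0 < m <= n)%N -> (C m / C 0%N) ^+ (2 * k m) <= D%:R ^+ (2 * a + 1) * W m.
  move=> mn; rewrite /W expr_div_n.
  have -> : C m ^+ (2 * k m) / C 0%N ^+ (2 * k m) =
     C m ^+ (2 * k m) * C 0%N ^+ (2 * (a - k m)) / C 0%N ^+ (2 * a).
    have -> : (2 * a = 2 * k m + 2 * (a - k m))%N by rewrite -mulnDr subnKC.
    by rewrite exprD; field; rewrite !expf_neq0 // gt_eqF.
  rewrite ler_pdivrMr ?exprn_gt0 //.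
  have -> : D%:R ^+ (2 * a + 1) * (S (2 * k m)%N m * S (2 * (a - k m))%N 0%N / S (2 * a)%N 0%N) *
    C 0%N ^+ (2 * a) = D%:R ^+ (2 * a + 1) * C 0%N ^+ (2 * a) *
    (S (2 * k m)%N m * S (2 * (a - k m))%N 0%N) / S (2 * a)%N 0%N by ring.
  rewrite ler_pdivlMr //.
  have -> : D%:R ^+ (2 * a + 1) * C 0%N ^+ (2 * a) * (S (2 * k m)%N m * S (2 * (a - k m))%N 0%N)
     = (D%:R ^+ (2 * k m) * S (2 * k m)%N m) *
       (D%:R ^+ (2 * (a - k m)) * S (2 * (a - k m))%N 0%N) * (D%:R * C 0%N ^+ (2 * a)).
    have -> : (2 * a + 1 = 2 * k m + 2 * (a - k m) + 1)%N by rewrite -mulnDr subnKC.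
    by rewrite !exprD expr1; ring.
  rewrite ler_pM ?mulr_ge0 ?exprn_ge0 //; last exact: sum_exp_le.
  by rewrite ler_pM ?exprn_ge0 //; exact: exp_sum_le.
have WC m : (0 < m <= n)%N -> W m <= D%:R ^+ (2 + 2 * a) * (C m / C 0%N) ^+ (2 * k m).
  move=> mn; rewrite /W expr_div_n ler_pdivrMr //.
  have -> : D%:R ^+ (2 + 2 * a) * (C m ^+ (2 * k m) / C 0%N ^+ (2 * k m)) * S (2 * a)%N 0%N
   = (D%:R * C m ^+ (2 * k m)) * (D%:R * ((D%:R ^+ (2 * a) * S (2 * a)%N 0%N) / C 0%N ^+ (2 * k m))).
    by rewrite !exprD; field; rewrite expf_neq0 // gt_eqF.
  rewrite ler_pM ?sum_exp_le //.
  rewrite (le_trans (sum_exp_le _ (cm0 0%N))) // ler_wpM2l ?(ltW DR0) //.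
  rewrite ler_pdivlMr ?exprn_gt0 // -exprD -mulnDr subnK //.
  exact: exp_sum_le.
apply/andP; split.
  rewrite ler_pdivrMl ?mulr_gt0 ?exprn_gt0 //.
  pose U := D%:R ^+ (2 * a + 1) * V.
  have U0 : 0 < U by rewrite mulr_gt0 ?exprn_gt0.
  (* Chosen so that y^(2 n!) is the bound which [CV] gives for every (C_m/C_0)^(2 n!/m); hence
     C_m/C_0 <= y^m. *)
  pose y := U `^ ((2 * a)%:R^-1).
  have y0 : 0 < y by rewrite powR_gt0.
  have yU : y ^+ (2 * a) = U.
    rewrite -powR_mulrn ?(ltW y0) // /y -powRrM mulVf ?powRr1 ?(ltW U0) //.
    by rewrite pnatr_eq0 -lt0n muln_gt0.
  have Xy : X <= kap' * y.
    apply: lowC => // m mn.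
    rewrite -(@ler_pXn2r _ (2 * k m)) ?muln_gt0 ?kn0 // ?nnegrE ?divr_ge0 ?exprn_ge0 ?(ltW y0) //.
    rewrite -exprM mulnCA km // yU (le_trans (CV _ mn)) // ler_wpM2l ?exprn_ge0 //.
    case: m mn => // m /= mn; rewrite VE (bigD1 (Ordinal mn)) //= lerDl.
    by rewrite sumr_ge0.
  rewrite -mulrA -/U -yU -exprMn lerXn2r // nnegrE ?mulr_ge0 //; exact: ltW.
rewrite VE -mulrA mulr_natl -[X in _ *+ X]card_ord -sumr_const; apply: ler_sum => m _.
have mn : (0 < m.+1 <= n)%N by rewrite ltn_ord.
rewrite (le_trans (WC _ mn)) // -mulrA ler_wpM2l ?exprn_ge0 //.
apply: (@le_trans _ _ ((kap * X ^+ m.+1) ^+ (2 * k m.+1))).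
  apply: lerXn2r; rewrite ?nnegrE; last exact: upC.
    by rewrite divr_ge0.
  by rewrite mulr_ge0 ?exprn_ge0 // ltW.
rewrite exprMn -exprM mulnCA km // ler_wpM2r ?exprn_ge0 //.
apply: (@le_trans _ _ ((1 + kap) ^+ (2 * k m.+1))).
  by rewrite lerXn2r ?nnegrE ?(ltW kap0) ?(ltW k1) // lerDr.
by rewrite ler_weXn2l ?lerDl ?(ltW kap0) // leq_mul2l ka.
Qed.

End PowerSums.

Lemma nrm1_eq0 {R : realType} (p : {poly R[i]}) : nrm 1 p = 0 -> p = 0.
Proof.
move=> p0; apply/polyP => k; rewrite coef0; apply/eqP; rewrite -cabs_eq0.
rewrite eq_le cabs_ge0 andbT -p0.
by have := cabs_coef_le p k (@ler01 R); rewrite expr1n mulr1.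
Qed.

(** * Strata by the number of nonzero pairs *)

Section Stratification.
Context {R : realType} {I J : nat} {M : 'I_I -> nat} {N : 'I_J -> nat}.
Notation pt := (Idx M N -> R[i]).
Notation A := {mpoly int[#|Idx M N|]}.
Variables (f : pt -> \bar R) (good : set pt) (IT : finType) (dG dF : nat).
Variables (c : nat -> nat -> nat -> A) (e : rat) (c1 c2 : R).
Hypotheses (e0 : 0 < e) (c10 : 0 < c1) (c20 : 0 < c2).
Let n := #|IT|.
Let D := (#|IT| * (dG + dF))%N.

(** The coefficients of [gP i] and [fP i] are the entries of the two maxima g_i and f_i. Evaluation
    at [t] forms the integer combination, and t^dG moves the f-entries past the g-entries. *)
Definition combined (gP fP : IT -> {poly R[i]}) (t : nat) : {poly {poly R[i]}} :=
  \prod_i linfac (gP i).[t%:R] (t%:R ^+ dG * (fP i).[t%:R]).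

Hypothesis H : forall b, Bset b -> good b -> exists gP fP : IT -> {poly R[i]},
  [/\ (forall i, (size (gP i) <= dG)%N), (forall i, (size (fP i) <= dF)%N),
      (forall k m t, ev b (c k m t) = (combined gP fP t)`_k`_m),
      (exists i, nrm 1 (fP i) != 0) &
      ((exists2 i, nrm 1 (fP i) != 0 & nrm 1 (gP i) = 0) -> f b = +oo%E) /\
      ((forall i, nrm 1 (fP i) != 0 -> nrm 1 (gP i) != 0) ->
        let X := \sum_i nrm 1 (fP i) / nrm 1 (gP i) in
        ((c1 * X `^ ratr e)%:E <= f b)%E /\ (f b <= (c2 * X `^ ratr e)%:E)%E)].

(** The coefficients of all powers Y^k' with k' > k: at a good point their vanishing means that at
    most [k] pairs are nonzero. *)
Let ps (k : nat) : seq A :=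
  [seq c x.1.1 x.1.2 x.2 | x : 'I_n.+1 * 'I_n.+1 * 'I_D.+1 <- enum {: 'I_n.+1 * 'I_n.+1 * 'I_D.+1} & (k < x.1.1)%N].

Let psP k (b : pt) : zset (ps k) b <-> Bset b /\
  forall k' m t, (k < k' <= n)%N -> (m <= n)%N -> (t <= D)%N -> ev b (c k' m t) = 0.
Proof.
split=> [[Bb h]|[Bb h]]; split=> //.
  move=> k' m t /andP[kk' k'n] mn tD.
  have k1 : (k' < n.+1)%N by []. have m1 : (m < n.+1)%N by []. have t1 : (t < D.+1)%N by [].
  apply: h; apply/mapP; exists (Ordinal k1, Ordinal m1, Ordinal t1) => //.
  by rewrite mem_filter /= kk' mem_enum.
move=> p /mapP[[[k' m] t]]; rewrite mem_filter /= => /andP[kk' _] ->.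
by apply: h; rewrite ?kk' -ltnS ltn_ord.
Qed.

(** The monomials of [ratio_monomial_sums], multiplied by every coefficient with a positive power of
    S. This last factor occurs in [Ls1] as well and cancels in the ratio; it is there to make L
    vanish together with K. *)
Let Ks1 (k : nat) : seq A :=
  [seq (c k x.1.1.1.+1 x.1.1.2 ^+ (n`! %/ x.1.1.1.+1) * c k 0%N x.1.2 ^+ (n`! - n`! %/ x.1.1.1.+1))
     * c k x.2.1.+1 x.2.2 | x : ('I_n * 'I_D.+1 * 'I_D.+1) * ('I_n * 'I_D.+1) <- enum {: ('I_n * 'I_D.+1 * 'I_D.+1) * ('I_n * 'I_D.+1)}].
Let Ls1 (k : nat) : seq A :=
  [seq c k 0%N x.1 ^+ n`! * c k x.2.1.+1 x.2.2 | x : 'I_D.+1 * ('I_n * 'I_D.+1) <- enum {: 'I_D.+1 * ('I_n * 'I_D.+1)}].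
(** Numerator of the second ARP of level [k], for the points where [Ks1] vanishes but exactly [k]
    pairs are nonzero. *)
Let Ks2 (k : nat) : seq A := [seq c k x.1 x.2 | x : 'I_n.+1 * 'I_D.+1 <- enum {: 'I_n.+1 * 'I_D.+1}].

Let cm (b : pt) k m (t : 'I_D.+1) : R := cabs (ev b (c k m t)).

Let sqsum_Ks1 k (b : pt) : sqsum (Ks1 k) b =
  (\sum_(x : 'I_n * 'I_D.+1 * 'I_D.+1) (cm b k x.1.1.+1 x.1.2 ^+ (n`! %/ x.1.1.+1) *
     cm b k 0%N x.2 ^+ (n`! - n`! %/ x.1.1.+1)) ^+ 2) *
  (\sum_(y : 'I_n * 'I_D.+1) cm b k y.1.+1 y.2 ^+ 2).
Proof.
rewrite /sqsum /Ks1 big_map big_enum /= big_distrlr pair_bigA /=.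
by apply: eq_bigr => x _; rewrite -sqr_cabs !rmorphM !rmorphXn !cabsM !cabsX exprMn.
Qed.

Let sqsum_Ls1 k (b : pt) : sqsum (Ls1 k) b =
  (\sum_(t : 'I_D.+1) (cm b k 0%N t ^+ n`!) ^+ 2) *
  (\sum_(y : 'I_n * 'I_D.+1) cm b k y.1.+1 y.2 ^+ 2).
Proof.
rewrite /sqsum /Ls1 big_map big_enum /= big_distrlr pair_bigA /=.
by apply: eq_bigr => x _; rewrite -sqr_cabs rmorphM rmorphXn cabsM cabsX exprMn.
Qed.

(** The polynomials [Ks1] are multiples of coefficients of Y^k, so the two steps together amount to
    the vanishing of that whole level. *)
Let zset_next k : (0 < k <= n)%N ->
  zset ((ps k ++ Ks1 k) ++ Ks2 k) = zset (ps k.-1) :> set pt.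
Proof.
move=> /andP[k0 kn]; apply/seteqP; split=> b.
  move=> [Bb h]; apply/psP; split=> // k' m t /andP[kk' k'n] mn tD.
  have m1 : (m < n.+1)%N by []. have t1 : (t < D.+1)%N by [].
  move: kk'; rewrite -ltnS prednK // ltnS leq_eqVlt => /predU1P[<-|kk'].
    apply: h; rewrite mem_cat; apply/orP; right; apply/mapP.
    by exists (Ordinal m1, Ordinal t1); rewrite ?mem_enum.
  have [_] : zset (ps k) b by split=> // p pp; apply: h; rewrite !mem_cat pp.
  move=> h'; have [_ h''] := (psP k b).1 (conj Bb h'); by apply: h'' => //; rewrite kk'.
move=> /psP[Bb h].
have hk m t : (m <= n)%N -> (t <= D)%N -> ev b (c k m t) = 0.
  by move=> mn tD; apply: h => //; rewrite kn andbT prednK.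
have [_ hps] : zset (ps k) b.
  apply/psP; split=> // k' m t /andP[kk' k'n] mn tD; apply: h => //.
  by rewrite k'n andbT (leq_ltn_trans (leq_pred _)).
split=> // p; rewrite !mem_cat => /orP[/orP[/hps//|]|] /mapP[x _ ->].
  by rewrite rmorphM (hk _ _ (ltn_ord x.2.1)) ?mulr0 // -ltnS ltn_ord.
by apply: hk; rewrite -ltnS ltn_ord.
Qed.

(** Induction on the number [k] of pairs still allowed to be nonzero. Each level prepends two ARPs:
    a finite ratio, or infinity if some g_i vanishes, where K1 is nonzero; then the value infinity
    on the rest of the level. *)
Lemma stratified_Bset : stratified f good Bset.
Proof.
have [cb [Kb [cb0 Kb0 HB]]] := @stratum_coef_bounds R IT dG dF.
have zB : zset (ps n) = @Bset R I J M N.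
  apply/seteqP; split=> b; first by case.
  move=> Bb; apply/psP; split=> // k' m t /andP[kk' k'n].
  by move: (leq_trans kk' k'n); rewrite ltnn.
rewrite -zB.
have Hb (b : pt) : Bset b -> good b -> exists (gP fP : IT -> {poly R[i]}) (Z : {set IT}),
  [/\ [/\ (forall i, i \in Z -> 0 < nrm 1 (gP i) + nrm 1 (fP i)),
      (forall i, i \notin Z -> gP i = 0 /\ fP i = 0),
      (forall k, zset (ps k) b -> (#|Z| <= k)%N),
      (forall k m t, (#|Z| < k)%N -> ev b (c k m t) = 0) &
      (exists2 i, i \in Z & nrm 1 (fP i) != 0)],
      (forall rho : R, 0 <= rho ->
        cb * \prod_(i in Z) (nrm 1 (gP i) + rho * nrm 1 (fP i)) <=
        \sum_(m < n.+1) rho ^+ m * \sum_t cm b #|Z| m t),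
      (forall (rho : R) m, 0 <= rho -> (m <= n)%N ->
        rho ^+ m * (\sum_t cm b #|Z| m t) <= Kb * \prod_(i in Z) (nrm 1 (gP i) + rho * nrm 1 (fP i))) &
      ((exists2 i, i \in Z & nrm 1 (gP i) = 0) -> f b = +oo%E) /\
      ((forall i, i \in Z -> 0 < nrm 1 (gP i)) ->
        let X := \sum_(i in Z) nrm 1 (fP i) / nrm 1 (gP i) in
        ((c1 * X `^ ratr e)%:E <= f b)%E /\ (f b <= (c2 * X `^ ratr e)%:E)%E)].
  move=> Bb gb; have [gP [fP [sG sF cE [i0 fi0] [Hoo Hfin]]]] := H Bb gb.
  (* The pairs other than (0, 0); #|Z| is the degree in Y that identifies the stratum. *)
  pose Z := [set i | nrm 1 (gP i) + nrm 1 (fP i) != 0]%SET.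
  have n0 := fun p : {poly R[i]} => nrm_ge0 p (@ler01 R).
  have Zpos i : i \in Z -> 0 < nrm 1 (gP i) + nrm 1 (fP i).
    by rewrite inE lt0r addr_ge0 // andbT.
  have Z0 i : i \notin Z -> gP i = 0 /\ fP i = 0.
    rewrite inE negbK paddr_eq0 // => /andP[/eqP h1 /eqP h2].
    by split; exact: nrm1_eq0.
  have fZ i : nrm 1 (fP i) != 0 -> i \in Z.
    by apply: contraR => /Z0[_ ->]; rewrite nrm0.
  have [Hlow Hup] := HB gP fP sG sF Z.
  have uv0 t i : i \notin Z -> (gP i).[t%:R] = 0 /\ t%:R ^+ dG * (fP i).[t%:R] = 0.
    by move=> /Z0[-> ->]; rewrite !horner0 mulr0.
  have cmE m t : cm b #|Z| m t = cabs (\prod_(i in Z)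
      ((gP i).[(t : nat)%:R]%:P + ((t : nat)%:R ^+ dG * (fP i).[(t : nat)%:R]) *: 'X))`_m.
    by rewrite /cm cE /combined; have [_ ->] := prod_linfac_coef (uv0 t).
  exists gP, fP, Z; split; [split=> //| | |split].
  (* If all the coefficients of Y^#|Z| vanished, the lower bound at rho = 1 would force the positive
     product over [Z] to be at most 0. *)
  - move=> k /psP[_ zk]; rewrite leqNgt; apply/negP => kZ.
    have := Hlow 1 ler01; rewrite leNgt => /negP; apply.
    rewrite [X in X < _](_ : _ = 0).
      by rewrite mulr_gt0 //; apply: prodr_gt0 => i /Zpos; rewrite mul1r.
    rewrite big1 // => m _; rewrite big1 ?mulr0 // => t _.
    rewrite -cmE /cm zk ?cabs0 //.
    - by rewrite kZ max_card.
    - by rewrite -ltnS ltn_ord.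
    - by rewrite -ltnS ltn_ord.
  - move=> k m t kZ; rewrite cE /combined.
    by have [h _] := prod_linfac_coef (uv0 t); rewrite h // coef0.
  - by exists i0 => //; exact: fZ.
  - move=> rho r0; apply: (le_trans (Hlow _ r0)); apply: ler_sum => m _.
    rewrite le_eqVlt; apply/orP; left; apply/eqP; congr (_ * _).
    by apply: eq_bigr => t _; rewrite cmE.
  - move=> rho m r0 _; apply: le_trans (Hup _ m r0).
    rewrite le_eqVlt; apply/orP; left; apply/eqP; congr (_ * _).
    by apply: eq_bigr => t _; rewrite cmE.
  - move=> [i iZ gi0]; apply: Hoo; exists i => //.
    by have := Zpos i iZ; rewrite gi0 add0r => /gt_eqF ->.
  - move=> gpos X; have [|h1 h2] := Hfin.
      by move=> i /fZ /gpos /gt_eqF ->.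
    have <- : \sum_i nrm 1 (fP i) / nrm 1 (gP i) = X; last by [].
    rewrite (bigID (mem Z)) /= [X in _ + X]big1 ?addr0 // => i /Z0[-> ->].
    by rewrite nrm0 mul0r.
have step k : (0 < k <= n)%N -> stratified f good (zset (ps k.-1)) -> stratified f good (zset (ps k)).
  move=> /andP[k0 kn] sol.
  have n0 : (0 < n)%N by apply: leq_trans kn.
  have gpos (gP fP : IT -> {poly R[i]}) (Z : {set IT}) b (i : IT) :
      0 < \sum_t cm b #|Z| 0%N t ->
      (forall (rho : R) m, 0 <= rho -> (m <= n)%N ->
        rho ^+ m * (\sum_t cm b #|Z| m t) <= Kb * \prod_(i in Z) (nrm 1 (gP i) + rho * nrm 1 (fP i))) ->
      i \in Z -> 0 < nrm 1 (gP i).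
    move=> C0 /(_ 0 0%N (lexx _) (leq0n _)); rewrite expr0 mul1r => h iZ.
    rewrite lt0r nrm_ge0 // andbT; apply/eqP => gi.
    move: (lt_le_trans C0 h); rewrite (bigD1 i) //= gi mul0r addr0 mul0r mulr0 ltxx //.
  pose kap := Kb * 2 ^+ n / cb; pose kap' := Kb * n.+1%:R / cb.
  have kap0 : 0 < kap by rewrite divr_gt0 // mulr_gt0 // exprn_gt0.
  have kap0' : 0 < kap' by rewrite divr_gt0 // mulr_gt0 // ltr0n.
  have [al [be [al0 be0 Hr]]] := ratio_monomial_sums n0 (ltn0Sn D) kap0 kap0'.
  (* The ratio of sums of squares has the size of X^(2 n!), so this exponent returns X^e. *)
  pose E : R := ratr (e / n`!%:R) / 2.
  have nf0 : n`!%:R != 0 :> R by rewrite pnatr_eq0 -lt0n fact_gt0.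
  have EE : (2 * n`!)%:R * E = ratr e.
    rewrite /E rmorphM fmorphV /= ratr_nat natrM; field => //.
  have E0 : 0 < E.
    by rewrite divr_gt0 // ltr0q divr_gt0 // ltr0n fact_gt0.
  apply: (@stratified_step _ _ _ _ _ f good (ps k) (Ks1 k) (Ls1 k) (e / n`!%:R)).
  - by rewrite divr_gt0 // ltr0n fact_gt0.
  - move=> b zb hK p /mapP[[t [m t'] _ ->]] /=.
    have := hK (c k m.+1 t' ^+ (n`! %/ m.+1) * c k 0%N t ^+ (n`! - n`! %/ m.+1) * c k m.+1 t').
    rewrite !rmorphM !rmorphXn => hm; apply/eqP; rewrite mulf_eq0.
    have /eqP : ev b (c k m.+1 t') ^+ (n`! %/ m.+1) * ev b (c k 0%N t) ^+ (n`! - n`! %/ m.+1) *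
       ev b (c k m.+1 t') = 0.
      by apply: hm; apply/mapP; exists (m, t', t, (m, t')); rewrite ?mem_enum.
    rewrite !mulf_eq0 !expf_eq0 fact_gt0 /= -orbA => /or3P[/andP[_ ->]|/andP[_ ->]|->] //;
      by rewrite orbT.
  - exists (c1 * be `^ (- E)), (c2 * al `^ (- E)).
    do 2! [split; first by rewrite mulr_gt0 // powR_gt0].
    move=> b zb gb; rewrite sqsum_Ks1 sqsum_Ls1.
    have [gP [fP [Z [[Zpos Z0 Zk Zc [i0 i0Z fi0]] Hlow Hup [Hoo Hfin]]]]] := Hb b zb.1 gb.
    set SK := \sum_(x : 'I_n * 'I_D.+1 * 'I_D.+1) _; set SY := \sum_(y : 'I_n * 'I_D.+1) _.
    set SL := \sum_(t : 'I_D.+1) _ => SK0.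
    have SY0 : 0 <= SY by apply: sumr_ge0 => y _; rewrite sqr_ge0.
    have SK_ge0 : 0 <= SK by apply: sumr_ge0 => y _; rewrite sqr_ge0.
    have SL_ge0 : 0 <= SL by apply: sumr_ge0 => y _; rewrite sqr_ge0.
    have SY_gt0 : 0 < SY.
      by rewrite lt0r SY0 andbT; apply: contraTneq SK0 => ->; rewrite mulr0 ltxx.
    have SK_gt0 : 0 < SK.
      by rewrite lt0r SK_ge0 andbT; apply: contraTneq SK0 => ->; rewrite mul0r ltxx.
    (* The equations of the stratum give #|Z| <= k; a nonzero K requires a nonzero coefficient of
       Y^k, hence the converse. *)
    have kZ : #|Z| = k.
      apply/eqP; rewrite eqn_leq (Zk _ zb) /= leqNgt; apply/negP => Zk'.
      move: SY_gt0; rewrite /SY big1 ?ltxx // => y _.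
      by rewrite /cm Zc // cabs0 expr0n.
    rewrite kZ in Hlow Hup.
    have SL_C0 : SL = 0 <-> \sum_t cm b k 0%N t = 0.
      split=> h.
        apply: big1 => t _; apply/eqP.
        have /(_ t isT) /eqP := psumr_eq0P (fun (t : 'I_D.+1) _ => sqr_ge0 (cm b k 0%N t ^+ n`!)) h.
        by rewrite !expf_eq0 fact_gt0.
      apply: big1 => t _.
      have /(_ t isT) ct := psumr_eq0P (fun (t : 'I_D.+1) _ => cabs_ge0 (ev b (c k 0%N t))) h.
      by rewrite /cm ct -exprM expr0n muln_eq0 orbF gtn_eqF ?fact_gt0.
    (* L = 0 means C_0 = 0; the lower bound at rho = 0 then annihilates the product of the g_i, so
       one of them is 0 while its f_i is not. *)
    case: (eqVneq (SL * SY) 0) => [/eqP|SLY].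
      rewrite mulf_eq0 (gt_eqF SY_gt0) orbF => /eqP SL0.
      apply: Hoo.
      have := Hlow 0 (lexx _); rewrite big_ord_recl /= (SL_C0.1 SL0) mulr0 add0r [X in _ <= X]big1; last first.
        by move=> m _; rewrite [X in X * _](_ : _ = 0) ?mul0r // exprS mul0r.
      rewrite pmulr_rle0 // => h.
      have : \prod_(i in Z) (nrm 1 (gP i) + 0 * nrm 1 (fP i)) == 0.
        rewrite eq_le h prodr_ge0 // => i _.
        by rewrite mul0r addr0 nrm_ge0.
      by rewrite prodf_seq_eq0 => /hasP[i _ /andP[iZ]]; rewrite mul0r addr0 => /eqP; exists i.
    have SL_gt0 : 0 < SL.
      by rewrite lt0r SL_ge0 andbT; apply: contraNneq SLY => ->; rewrite mul0r.
    have C00 : 0 < \sum_t cm b k 0%N t.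
      rewrite lt0r sumr_ge0 ?andbT; last by move=> t _; exact: cabs_ge0.
      by apply: contraTneq SL_gt0 => /SL_C0 ->; rewrite ltxx.
    have gpos' i : i \in Z -> 0 < nrm 1 (gP i).
      by apply: (gpos gP fP Z b); rewrite ?kZ.
    have [] := Hfin gpos'; set X := \sum_(i in Z) _ => X1 X2.
    have f0 i : 0 <= nrm 1 (fP i) by exact: nrm_ge0.
    have Zn : (#|Z| <= n)%N by exact: max_card.
    have cm0 m : 0 <= \sum_t cm b k m t by apply: sumr_ge0 => t _; exact: cabs_ge0.
    have X0 : 0 <= X by exact: sum_ratio_ge0.
    have := Hr (cm b k) X (fun _ _ => cabs_ge0 _) X0 C00
      (fun m mn => coef_ratio_le f0 Zn cb0 Kb0 Hlow Hup gpos' mn)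
      (fun y y0 h => sum_ratio_le f0 cb0 Hlow Hup gpos' y0 h).
    rewrite -/SK -/SL => /(_ (divr_gt0 SK_gt0 SL_gt0)) /andP[].
    rewrite -/E; set V := SK / SL => V1 V2.
    have V0 : 0 <= V by rewrite divr_ge0.
    have -> : (SK * SY) `^ E / (SL * SY) `^ E = V `^ E.
      have -> : SK = V * SL by rewrite /V divfK ?gt_eqF.
      rewrite (powRM _ (mulr_ge0 V0 SL_ge0) SY0) (powRM _ V0 SL_ge0) (powRM _ SL_ge0 SY0); field.
      by rewrite !gt_eqF ?powR_gt0.
    have XE : X `^ ratr e = (X ^+ (2 * n`!)) `^ E by rewrite -powR_mulrn // -powRrM EE.
    have be1 : be `^ (- E) * V `^ E <= X `^ ratr e.
      rewrite powRN ler_pdivrMl ?powR_gt0 // XE -powRM ?(ltW be0) ?exprn_ge0 //.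
      by apply: ge0_ler_powR; rewrite ?(ltW E0) ?nnegrE // mulr_ge0 ?exprn_ge0 // ltW.
    have al1 : X `^ ratr e <= al `^ (- E) * V `^ E.
      rewrite powRN ler_pdivlMl ?powR_gt0 // XE -powRM ?(ltW al0) ?exprn_ge0 //.
      by apply: ge0_ler_powR; rewrite ?(ltW E0) ?nnegrE // mulr_ge0 ?exprn_ge0 // ltW.
    split.
      by apply: le_trans X1; rewrite lee_fin -mulrA ler_wpM2l ?(ltW c10).
    by apply: (le_trans X2); rewrite lee_fin -mulrA ler_wpM2l ?(ltW c20).
  (* The empty denominator is 0, so this ARP takes the value infinity wherever its numerator is
     nonzero. *)
  apply: (@stratified_step _ _ _ _ _ f good (ps k ++ Ks1 k) (Ks2 k) [::] 1) => //.
    exists 1, 1; do 2! [split=> //] => b zb gb.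
    have [gP [fP [Z [[Zpos Z0 Zk Zc [i0 i0Z fi0]] Hlow Hup [Hoo Hfin]]]]] := Hb b zb.1 gb.
    move=> SK0; rewrite {1}/sqsum big_nil eqxx; apply: Hoo.
    have kZ : #|Z| = k.
      apply/eqP; rewrite eqn_leq Zk /=; last first.
        by split; [exact: zb.1|move=> p pp; apply: zb.2; rewrite mem_cat pp].
      rewrite leqNgt; apply/negP => Zk'.
      move: SK0; have -> : sqsum (Ks2 k) b = 0; last by rewrite ltxx.
      by apply/sqsum_eq0 => p /mapP[x _ ->]; rewrite Zc.
    rewrite kZ in Hlow Hup.
    have cm0 m : 0 <= \sum_t cm b k m t by apply: sumr_ge0 => t _; exact: cabs_ge0.
    apply: contrapT => hg.
    have gpos' i : i \in Z -> 0 < nrm 1 (gP i).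
      move=> iZ; rewrite lt0r nrm_ge0 // andbT; apply/eqP => gi.
      by apply: hg; exists i.
    have C00 : 0 < \sum_t cm b k 0%N t.
      have := Hlow 0 (lexx _); rewrite big_ord_recl /= expr0 mul1r [X in _ + X]big1; last first.
        by move=> m _; rewrite [X in X * _](_ : _ = 0) ?mul0r // exprS mul0r.
      rewrite addr0; apply: lt_le_trans; rewrite mulr_gt0 // prodr_gt0 // => i iZ.
      by rewrite mul0r addr0 gpos'.
    have [t0 ct0] : exists t0 : 'I_D.+1, ev b (c k 0%N t0) != 0.
      apply: contrapT => /forallNP h; move: C00; rewrite big1 ?ltxx // => t _.
      by have /negP := h t; rewrite negbK => /eqP; rewrite /cm => ->; rewrite cabs0.
    (* If all g_i were positive, some constant coefficient would be nonzero; the vanishing of [Ks1]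
       then kills all higher powers of S. *)
    have Cm m : (0 < m <= n)%N -> \sum_t cm b k m t = 0.
      case: m => // m /= mn; apply: big1 => t _.
      have : ev b (c k m.+1 t ^+ (n`! %/ m.+1) * c k 0%N t0 ^+ (n`! - n`! %/ m.+1) * c k m.+1 t) = 0.
        apply: zb.2; rewrite mem_cat; apply/orP; right.
        by apply/mapP; exists (Ordinal mn, t, t0, (Ordinal mn, t)); rewrite ?mem_enum.
      rewrite !rmorphM !rmorphXn => /eqP.
      rewrite !mulf_eq0 !expf_eq0 (negbTE ct0) andbF orbF => /orP[/andP[_]|] /eqP h;
        by rewrite /cm h cabs0.
    have f0 i : 0 <= nrm 1 (fP i) by exact: nrm_ge0.
    have Zn : (#|Z| <= n)%N by exact: max_card.
    have X0 : 0 < \sum_(i in Z) nrm 1 (fP i) / nrm 1 (gP i).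
      rewrite (bigD1 i0) //= ltr_pwDl ?divr_gt0 ?gpos' //; first by rewrite lt0r fi0 nrm_ge0.
      by apply: sumr_ge0 => i /andP[iZ _]; rewrite divr_ge0 // ltW // gpos'.
    set X := \sum_(i in Z) _ in X0.
    have y0 : 0 < X / (2 * kap') by rewrite divr_gt0 // mulr_gt0.
    (* With C_m = 0 for m > 0 every positive y is admissible; this one yields X <= X/2, although X
       is positive. *)
    have : X <= kap' * (X / (2 * kap')).
      apply: (sum_ratio_le f0 cb0 Hlow Hup gpos' y0) => m mn.
      by rewrite Cm // mul0r exprn_ge0 // ltW.
    have -> : kap' * (X / (2 * kap')) = X / 2 by field; rewrite gt_eqF.
    by rewrite leNgt ltr_pdivrMr // mulr_natr mulr2n ltrDl X0.
  by rewrite zset_next // k0.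
suff : forall k, (k <= n)%N -> stratified f good (zset (ps k)) by exact.
elim=> [_|k IH kn]; last by apply: step => //; apply: IH; exact: ltnW.
(* At level 0 no pair is nonzero, yet at a good point some f_i is nonzero. *)
apply: stratified_end => b zb gb.
  have [gP [fP [Z [[_ _ Zk _ [i0 i0Z _]] _ _ _]]]] := Hb b zb.1 gb.
  by have := Zk 0%N zb; rewrite leqn0 cards_eq0 => /eqP Z0; rewrite Z0 inE in i0Z.
Qed.

End Stratification.

(** * Integral polynomials for symmetric functions of the roots *)

(** The coefficient of X^i is, up to sign, an elementary symmetric function of degree [size s - i]
    in the roots, hence homogeneous of that degree. *)
Lemma coef_prod_scaled_roots (L : comNzRingType) (a : L) (s : seq L) i : (i <= size s)%N ->
  (\prod_(c <- s) ('X - (a * c)%:P))`_i =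
  a ^+ (size s - i) * (\prod_(c <- s) ('X - c%:P))`_i.
Proof.
have big_size (f : L -> L) (t : seq L) : (\prod_(c <- t) ('X - (f c)%:P))`_(size t).+1 = 0.
  by rewrite nth_default // -(big_map f xpredT (fun c => 'X - c%:P)) size_prod_XsubC size_map.
elim: s i => [|c s IH] i /=; first by rewrite leqn0 => /eqP ->; rewrite !big_nil mul1r.
rewrite !big_cons !mulrBl !coefB !coefXM !coefCM.
case: i => [_|i] /=; first by rewrite IH // !subn0 exprS; ring.
rewrite ltnS leq_eqVlt subSS => /predU1P[->|si].
  by rewrite (big_size (fun c => a * c)) (big_size id) IH // subnn; ring.
by rewrite (IH _ si) (IH _ (ltnW si)) -(subnSK si) exprS; ring.
Qed.

Section RootFamilies.
Variables (A : comNzRingType) (W : {poly A}) (n d : nat).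
Let w := W`_n.

(* Replacing roots [x] of [W] by [w * x] makes [W] monic and keeps the coefficients integral. *)
Definition monicized : {poly A} := \poly_(i < n) (W`_i * w ^+ (n.-1 - i)) + 'X^n.

(** Compensates the scaling of the roots: its value at w x is w^d times that of [F] at x. The factor
    w^d is common to all entries and drops out of every ratio. *)
Definition homogenized (F : {poly A}) : {poly A} := \poly_(i < d) (F`_i * w ^+ (d - i)).

Lemma homogenized_horner (L : fieldType) (phi : {rmorphism A -> L}) (F : {poly A}) (x : L) :
  (size F <= d)%N ->
  (map_poly phi (homogenized F)).[phi w * x] = phi w ^+ d * (map_poly phi F).[x].
Proof.
move=> sF.
rewrite (@horner_coef_wide _ d _ (phi w * x)); last first.
  by rewrite (leq_trans (size_poly _ _)) // size_poly.
rewrite (@horner_coef_wide _ d _ x); last first.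
  by rewrite (leq_trans (size_poly _ _)).
rewrite mulr_sumr; apply: eq_bigr => i _.
rewrite !coef_map /= coef_poly ltn_ord rmorphM rmorphXn exprMn.
have -> : phi w ^+ d = phi w ^+ (d - i) * phi w ^+ i by rewrite -exprD subnK // ltnW.
by ring.
Qed.

Lemma monicized_roots (L : fieldType) (phi : {rmorphism A -> L}) (x : n.-tuple L) :
  phi w != 0 -> map_poly phi W = phi w *: \prod_(c <- x) ('X - c%:P) ->
  map_poly phi monicized = \prod_(c <- [tuple of map (fun c => phi w * c) x]) ('X - c%:P).
Proof.
move=> w0 WE; pose p := \prod_(c <- x) ('X - c%:P).
have sp : size p = n.+1 by rewrite size_prod_XsubC size_tuple.
have pn : p`_n = 1.
  have /monicP : p \is monic by exact: monic_prod_XsubC.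
  by rewrite /lead_coef sp.
have -> : \prod_(c <- [tuple of map (fun c => phi w * c) x]) ('X - c%:P) =
    \poly_(i < n.+1) (p`_i * phi w ^+ (n - i)).
  rewrite /= big_map; apply/polyP => i; rewrite coef_poly ltnS.
  case: leqP => [iN|iN].
    by rewrite coef_prod_scaled_roots size_tuple // mulrC.
  by rewrite nth_default // -(big_map (fun c => phi w * c) xpredT (fun c => 'X - c%:P))
    size_prod_XsubC size_map size_tuple.
apply/polyP => i; rewrite coef_map /monicized coefD coefXn !coef_poly ltnS.
case: (ltngtP i n) => [iN|iN|->]; rewrite ?ltnn ?leqnn ?eqxx /= ?addr0 ?add0r ?rmorph0 ?rmorph1 //; last first.
  by rewrite pn subnn expr0 mulr1.
have -> : phi (W`_i * w ^+ (n.-1 - i)) = (map_poly phi W)`_i * phi w ^+ (n.-1 - i).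
  by rewrite coef_map rmorphM rmorphXn.
rewrite WE coefZ -/p mulrAC -exprS mulrC; congr (_ * _ ^+ _).
by move: iN; clear; lia.
Qed.

End RootFamilies.

Lemma linfacE (S : comNzRingType) (u v : S) :
  1 + (u%:P%:P + ('X)%:P * v%:P%:P) * 'X = linfac u v :> {poly {poly S}}.
Proof. by rewrite /linfac -mul_polyC polyCD polyCM [_%:P * v%:P%:P]mulrC. Qed.

Lemma horner_lin_form (B L : comNzRingType) (psi : {rmorphism B -> L}) (U V : {poly B}) (s y : B) (z : L) :
  (map_poly psi (1 + (U + s%:P * V) * y%:P)).[z] =
  1 + ((map_poly psi U).[z] + psi s * (map_poly psi V).[z]) * psi y.
Proof.
rewrite rmorphD rmorph1 rmorphM rmorphD rmorphM /= !map_polyC /=.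
by rewrite hornerD hornerM hornerD hornerM !hornerC.
Qed.

Section CombinedCoefficients.
Context {R : realType} (A : idomainType) (W : {poly A}) (n kap d dG dF : nat).
Variables (Gs Fs : 'I_kap -> nat -> {poly A}).
Hypothesis sG : forall k j, (size (Gs k j) <= d)%N.
Hypothesis sF : forall k j, (size (Fs k j) <= d)%N.

Let iota (S : comNzRingType) : {rmorphism S -> {poly {poly S}}} := polyC \o polyC.

(** A polynomial in the root, the outermost variable, with coefficients in A[S][Y]: here ['X%:P] is
    S and the ['X] of the last factor is Y. *)
Let lin_poly k (t : nat) : {poly {poly {poly A}}} :=
  1 + (map_poly (@iota A) (\sum_(j < dG) t%:R ^+ j *: homogenized W n d (Gs k j))
    + ('X%:P)%:P * map_poly (@iota A) (t%:R ^+ dG *: \sum_(j < dF) t%:R ^+ j *: homogenized W n d (Fs k j)))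
    * ('X)%:P.

(** The product over all the roots is taken over the coefficient ring A[S][Y], where
    [prod_horner_roots] applies to the monicized polynomial. Its coefficients in Y and S then lie in
    [A] and are chosen before the specialisation [phi]. *)
Lemma combined_coefs_exist : exists c : nat -> nat -> nat -> A,
  forall (phi : {rmorphism A -> R[i]}) (x : n.-tuple R[i]),
    phi W`_n != 0 -> map_poly phi W = phi W`_n *: \prod_(y <- x) ('X - y%:P) ->
  forall m k t, phi (c m k t) = (combined dG
    (fun i : 'I_n * 'I_kap => phi W`_n ^+ d *: \poly_(j < dG) (map_poly phi (Gs i.2 j)).[tnth x i.1])
    (fun i : 'I_n * 'I_kap => phi W`_n ^+ d *: \poly_(j < dF) (map_poly phi (Fs i.2 j)).[tnth x i.1])
    t)`_m`_k.
Proof.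
have : forall t : nat, exists Psi : {poly {poly A}},
    forall (L : idomainType) (phi : {rmorphism {poly {poly A}} -> L}) (x : n.-tuple L),
    map_poly phi (map_poly (@iota A) (monicized W n)) = \prod_(c <- x) ('X - c%:P) ->
    phi Psi = \prod_(t0 < n) (map_poly phi (\prod_k lin_poly k t)).[tnth x t0].
  by move=> t; exact: prod_horner_roots.
move/choice => [Psi HPsi]; exists (fun m k t => (Psi t)`_m`_k) => phi x w0 WE m k t.
pose phi' : {rmorphism {poly {poly A}} -> {poly {poly R[i]}}} := map_poly (map_poly phi).
have -> : phi (Psi t)`_m`_k = (phi' (Psi t))`_m`_k by rewrite /phi' /= !coef_map.
set w := phi W`_n in w0 WE *.
pose y : n.-tuple {poly {poly R[i]}} := [tuple of map (fun c => iota _ (w * c)) x].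
have comp S' (p : {poly A}) : map_poly phi' (map_poly (@iota A) p) = S' ->
    map_poly (@iota R[i]) (map_poly phi p) = S'.
  move=> <-; rewrite -!map_poly_comp; apply: eq_map_poly => c /=.
  by rewrite map_polyC /= map_polyC.
rewrite (HPsi t _ phi' y); last first.
  rewrite -(comp _ (monicized W n) erefl) (monicized_roots w0 WE) rmorph_prod /= !big_map.
  by apply: eq_bigr => c _; rewrite map_polyXsubC.
rewrite /combined -(pair_bigA _ (fun (s : 'I_n) (k : 'I_kap) => linfac
   (w ^+ d *: \poly_(j < dG) (map_poly phi (Gs k j)).[tnth x s]).[t%:R]
   (t%:R ^+ dG * (w ^+ d *: \poly_(j < dF) (map_poly phi (Fs k j)).[tnth x s]).[t%:R]))) /=.
apply: (congr1 (fun q : {poly {poly R[i]}} => q`_m`_k)); apply: eq_bigr => s _; rewrite rmorph_prod horner_prod.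
apply: eq_bigr => k' _; rewrite /lin_poly.
have iota_horner (p : {poly A}) : (map_poly phi' (map_poly (@iota A) p)).[tnth y s] =
    ((map_poly phi p).[w * tnth x s])%:P%:P.
  by rewrite -(comp _ p erefl) tnth_map horner_map.
have evp (q : nat -> {poly A}) e : (forall j, (size (q j) <= d)%N) ->
  (map_poly phi (\sum_(j < e) t%:R ^+ j *: homogenized W n d (q j))).[w * tnth x s] =
  (w ^+ d *: \poly_(j < e) (map_poly phi (q j)).[tnth x s]).[t%:R].
  move=> sq; rewrite rmorph_sum /= horner_sum hornerZ horner_poly mulr_sumr.
  apply: eq_bigr => j _; rewrite map_polyZ hornerZ /= homogenized_horner // rmorphXn rmorph_nat.
  by ring.
rewrite horner_lin_form !iota_horner map_polyZ hornerZ !evp // rmorphXn rmorph_nat.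
have -> : phi' ('X%:P) = 'X%:P by rewrite /phi' /= map_polyC /= map_polyX.
have -> : phi' 'X = 'X by rewrite /phi' /= map_polyX.
exact: linfacE.
Qed.

End CombinedCoefficients.

(** * Integrals over squares in the plane *)

Section Plane.
Context {R : realType}.
Let mu := (@lebesgue_measure R \x @lebesgue_measure R)%E.

Notation plane := (measurableTypeR R * measurableTypeR R)%type.

Definition square (z : R[i]) (h : R) : set plane :=
  `[complex.Re z - h, complex.Re z + h]%classic `*` `[complex.Im z - h, complex.Im z + h]%classic.

Definition topt (z : R[i]) : plane := (complex.Re z, complex.Im z).

Lemma measurable_square z h : measurable (square z h).
Proof. by apply: measurableX; exact: measurable_itv. Qed.

Lemma measure_square z h : 0 <= h -> mu (square z h) = (4 * h ^+ 2)%:E.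
Proof.
move=> h0; rewrite /mu /square product_measure1E; [|exact: measurable_itv|exact: measurable_itv].
rewrite /= !lebesgue_measure_itv /= !lte_fin.
move: h0; rewrite le_eqVlt => /predU1P[<-|h0].
  by rewrite !addr0 !subr0 !ltxx mul0e expr0n mulr0.
have lt2 (a : R) : a - h < a + h by lra.
rewrite !lt2 -!EFinD -EFinM; congr (_%:E); ring.
Qed.

Lemma square_cabs z h (w : R[i]) : cabs (w - z) <= h -> square z h (topt w).
Proof.
case: z => a b; case: w => c d; rewrite /square /topt /= => H.
have := sqr_cabs ((c +i* d)%C - (a +i* b)%C); rewrite /= => E.
have C0 := cabs_ge0 ((c +i* d)%C - (a +i* b)%C).
set C := cabs _ in H E C0.
have H2 : C ^+ 2 <= h ^+ 2 by rewrite lerXn2r ?nnegrE // (le_trans C0).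
have h0 : 0 <= h by apply: le_trans H.
have key (u v : R) : C ^+ 2 = u ^+ 2 + v ^+ 2 -> - h <= u <= h.
  move=> E'; rewrite -ler_norml -(@ler_pXn2r _ 2) ?nnegrE // real_normK ?num_real //.
  by apply: le_trans H2; rewrite E' lerDl sqr_ge0.
have /andP[a1 a2] := key _ _ E.
have /andP[b1 b2] : - h <= d - b <= h by apply: (key _ (c - a)); rewrite E addrC.
by split; rewrite /= in_itv /=; apply/andP; split; lra.
Qed.

Lemma measurable_set1_plane (x : plane) : measurable [set x] /\ mu [set x] = 0%E.
Proof.
have E : [set x] = [set x.1] `*` [set x.2].
  by apply/seteqP; split=> [y /= ->|[y1 y2] /= [-> ->]] //; case: x.
split; first by rewrite E; apply: measurableX; exact: measurable_set1.
rewrite E /mu product_measure1E; [|exact: measurable_set1|exact: measurable_set1].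
by rewrite /= !lebesgue_measure_set1 mul0e.
Qed.

Lemma square_integral_ge (D : set plane) (f : plane -> \bar R) z h v :
  measurable D -> measurable_fun D f -> (forall x, D x -> (0 <= f x)%E) ->
  0 <= h -> 0 <= v -> square z h `<=` D ->
  (forall x, square z h x -> (v%:E <= f x)%E) ->
  ((4 * h ^+ 2 * v)%:E <= \int[mu]_(x in D) f x)%E.
Proof.
move=> mD mf f0 h0 v0 SD vf.
apply: (@le_trans _ _ (\int[mu]_(x in square z h) f x)%E); last first.
  by apply: ge0_subset_integral => //; exact: measurable_square.
apply: (@le_trans _ _ (\int[mu]_(x in square z h) cst v%:E x)%E).
  rewrite integral_cst; last exact: measurable_square.
  by rewrite [X in (_ * X)%E](measure_square z h0) -EFinM lee_fin mulrC.
apply: ge0_le_integral => //; first exact: measurable_square.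
- by apply: measurable_funS mf.
Qed.

(** Off the centers [f] is dominated by the series of the [v t j] times the indicators of the
    squares, overlaps included. A square of half-side 2^-j has area 4 (2^-j)^2, whence the factor
    4. *)
Lemma dyadic_integral_le (D : set plane) (f : plane -> \bar R) n (om : 'I_n -> R[i])
    (v : 'I_n -> nat -> R) (B : R) :
  measurable D -> measurable_fun D f -> (forall x, D x -> (0 <= f x)%E) ->
  (forall t j, 0 <= v t j) ->
  (forall x, D x -> (forall t, x <> topt (om t)) ->
     exists t j, square (om t) (2^-1 ^+ j) x /\ (f x <= (v t j)%:E)%E) ->
  (forall k, \sum_(t < n) \sum_(j < k) v t j * (2^-1 ^+ j) ^+ 2 <= B) ->
  (\int[mu]_(x in D) f x <= (4 * B)%:E)%E.
Proof.
move=> mD mf f0 v0 Hf HB.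
pose F t j (x : plane) : \bar R := (v t j * \1_(square (om t) (2^-1 ^+ j)) x)%:E.
have mF t j : measurable_fun D (F t j).
  apply/measurable_EFinP; apply: measurable_funM => //.
  by apply: measurable_indic; exact: measurable_square.
have F0 t j x : D x -> (0 <= F t j x)%E by move=> _; rewrite lee_fin mulr_ge0.
pose S j x : \bar R := (\sum_(t < n) F t j x)%E.
have mS j : measurable_fun D (S j) by apply: emeasurable_sum.
have S0 j x : D x -> (0 <= S j x)%E by move=> Dx; apply: sume_ge0 => t _; exact: F0.
apply: (@le_trans _ _ (\int[mu]_(x in D) (\sum_(0 <= j <oo) S j x))%E).
  apply: ae_ge0_le_integral => //.
  - by move=> x Dx; apply: nneseries_ge0 => j _ _; exact: S0.
  - by apply: ge0_emeasurable_sum => // j x Dx _; exact: S0.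
  (* The centers lie at distance 0 from themselves and belong to no dyadic scale; being finitely
     many, they form a null set. *)
  - have Nn : mu.-negligible (\bigcup_t [set x | exists2 t' : 'I_n, t' = t :> nat & x = topt (om t')]).
      apply: negligible_bigcup => t.
      case: (ltnP t n) => [tn|nt].
        exists [set topt (om (Ordinal tn))]; split; [exact: (measurable_set1_plane _).1|
          exact: (measurable_set1_plane _).2|].
        by move=> x [t' tt' ->] /=; congr (topt (om _)); exact: val_inj.
      exists set0; split => //.
      by move=> x [t' tt']; move: (ltn_ord t'); rewrite tt' ltnNge nt.
    apply: negligibleS Nn => x /= /not_implyP[Dx].
    apply: contra_notP => hx; have [|t [j [sx fx]]] := Hf x Dx.
      by move=> t xt; apply: hx; exists (t : nat) => //; exists t.
    apply: (le_trans fx); apply: (@le_trans _ _ (S j x)).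
      rewrite /S (bigD1 t) //= -[leLHS]adde0; apply: leeD.
        by rewrite /F indicE mem_set // mulr1.
      by apply: sume_ge0 => s _; exact: F0.
    apply: (@le_trans _ _ (\sum_(0 <= i < j.+1) S i x)%E); last first.
      by apply: nneseries_lim_ge => i _ _; exact: S0.
    rewrite big_nat_recr //= -[leLHS]add0e; apply: leeD => //.
    by apply: sume_ge0 => i _; exact: S0.
rewrite integral_nneseries //; apply: lime_le.
  by apply: is_cvg_nneseries => j _ _; apply: integral_ge0 => x Dx; exact: S0.
apply: nearW => k.
apply: (@le_trans _ _ (\sum_(0 <= j < k) \sum_(t < n) (v t j * (4 * (2^-1 ^+ j) ^+ 2))%:E)%E).
  apply: lee_sum => j _; rewrite /S ge0_integral_sum //; last by move=> t x Dx; exact: F0.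
  apply: lee_sum => t _.
  rewrite /F; under eq_integral do rewrite EFinM.
  rewrite ge0_integralZl_EFin //; last first.
    by apply/measurable_EFinP; apply: measurable_indic; exact: measurable_square.
  rewrite EFinM; apply: lee_wpmul2l; first by rewrite lee_fin.
  rewrite integral_indic //; last exact: measurable_square.
  rewrite -(@measure_square (om t)) ?exprn_ge0 ?invr_ge0 //.
  apply: le_measure; rewrite ?inE; last by move=> x [].
    by apply: measurableI => //; exact: measurable_square.
  exact: measurable_square.
rewrite big_mkord; under eq_bigr do rewrite sumEFin.
rewrite sumEFin lee_fin exchange_big /=.
apply: (@le_trans _ _ (4 * \sum_(t < n) \sum_(j < k) v t j * (2^-1 ^+ j) ^+ 2)).
  rewrite mulr_sumr; apply: ler_sum => t _; rewrite mulr_sumr; apply: ler_sum => j _.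
  by rewrite mulrCA.
by rewrite ler_wpM2l.
Qed.

End Plane.

(** * Measurability of the integrand and of the disk *)

Section Measurability.
Context {R : realType}.
Notation plane := (measurableTypeR R * measurableTypeR R)%type.

Definition cmeasurable (F : plane -> R[i]) :=
  measurable_fun [set: plane] (fun x => complex.Re (F x)) /\
  measurable_fun [set: plane] (fun x => complex.Im (F x)).

Lemma cmeasurable_cst c : cmeasurable (fun=> c).
Proof. by split; exact: measurable_cst. Qed.

Lemma cmeasurableD F G : cmeasurable F -> cmeasurable G -> cmeasurable (fun x => F x + G x).
Proof.
move=> [F1 F2] [G1 G2]; split.
  by under eq_fun do rewrite raddfD /=; exact: measurable_funD.
by under eq_fun do rewrite raddfD /=; exact: measurable_funD.
Qed.

Lemma cmeasurableM F G : cmeasurable F -> cmeasurable G -> cmeasurable (fun x => F x * G x).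
Proof.
move=> [F1 F2] [G1 G2].
have E (x y : R[i]) : complex.Re (x * y) = complex.Re x * complex.Re y - complex.Im x * complex.Im y
   /\ complex.Im (x * y) = complex.Re x * complex.Im y + complex.Im x * complex.Re y.
  by case: x => a b; case: y => c d.
split.
  under eq_fun do rewrite (E _ _).1.
  by apply: measurable_funB; apply: measurable_funM.
under eq_fun do rewrite (E _ _).2.
by apply: measurable_funD; apply: measurable_funM.
Qed.

Lemma cmeasurableX F k : cmeasurable F -> cmeasurable (fun x => F x ^+ k).
Proof.
move=> mF; elim: k => [|k IH].
  by under eq_fun do rewrite expr0; exact: cmeasurable_cst.
by under eq_fun do rewrite exprS; exact: cmeasurableM.
Qed.

Lemma cmeasurable_sum (T : Type) (s : seq T) (F : T -> plane -> R[i]) :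
  (forall i, cmeasurable (F i)) -> cmeasurable (fun x => \sum_(i <- s) F i x).
Proof.
move=> mF; elim: s => [|a s IH].
  by under eq_fun do rewrite big_nil; exact: cmeasurable_cst.
by under eq_fun do rewrite big_cons; exact: cmeasurableD.
Qed.

Lemma measurable_cabs2 F : cmeasurable F -> measurable_fun [set: plane] (fun x => cabs2 (F x)).
Proof.
move=> [F1 F2].
have E (x : R[i]) : cabs2 x = complex.Re x ^+ 2 + complex.Im x ^+ 2 by case: x.
under eq_fun do rewrite E.
by apply: measurable_funD; apply: measurable_funX.
Qed.

Lemma cmeasurable_point : cmeasurable (fun x : plane => (x.1 +i* x.2)%C).
Proof. by split; [exact: measurable_fst|exact: measurable_snd]. Qed.

Lemma measurable_Rb (I J : nat) (M : 'I_I -> nat) (N : 'I_J -> nat) (eps del : rat)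
    (b : Idx M N -> R[i]) :
  measurable_fun [set: plane] (fun x => Rb eps del b (x.1 +i* x.2)%C).
Proof.
have mz := cmeasurable_point.
have mP i : cmeasurable (fun x => Pb b i (x.1 +i* x.2)%C).
  by apply: cmeasurable_sum => mu; apply: cmeasurableM; [exact: cmeasurable_cst|exact: cmeasurableX].
have mQ j : cmeasurable (fun x => Qb b j (x.1 +i* x.2)%C).
  by apply: cmeasurable_sum => mu; apply: cmeasurableM; [exact: cmeasurable_cst|exact: cmeasurableX].
have mpow (F : plane -> R) r : measurable_fun [set: plane] F ->
    measurable_fun [set: plane] (fun x => powR (F x) r).
  exact: (measurableT_comp (measurable_powR r)).
have mSP : measurable_fun [set: plane] (fun x => \sum_(i < I) cabs2 (Pb b i (x.1 +i* x.2)%C)).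
  by apply: measurable_sum => i; exact: measurable_cabs2.
have mSQ : measurable_fun [set: plane] (fun x => \sum_(i < J) cabs2 (Qb b i (x.1 +i* x.2)%C)).
  by apply: measurable_sum => i; exact: measurable_cabs2.
rewrite /Rb; apply: measurable_fun_ifT.
- by apply: measurable_fun_eqr => //; exact: mpow.
- exact: measurable_cst.
- apply/measurable_EFinP; under eq_fun do rewrite -powRN.
  by apply: measurable_funM; exact: mpow.
Qed.

Lemma measurable_unit_disk : measurable (@unit_disk R : set plane).
Proof.
pose f (x : plane) : R := x.1 ^+ 2 + x.2 ^+ 2.
have mf : measurable_fun [set: plane] f.
  by apply: measurable_funD; apply: measurable_funX; [exact: measurable_fst|exact: measurable_snd].
have -> : (@unit_disk R : set plane) = [set: plane] `&` f @^-1` `]-oo, 1[%classic.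
  by apply/seteqP; split=> x; rewrite /unit_disk /= in_itv //=; case.
by apply: mf => //; exact: measurable_itv.
Qed.

End Measurability.

(** * The radial profile *)

Lemma powR_monotone {R : realType} (r x y : R) : 0 <= r -> 0 <= x -> x <= y -> x `^ r <= y `^ r.
Proof. by move=> r0 x0 xy; apply: ge0_ler_powR; rewrite ?nnegrE // (le_trans x0). Qed.

Lemma powR_invr {R : realType} (r x : R) : 0 <= x -> x^-1 `^ r = (x `^ r)^-1.
Proof. by move=> x0; rewrite -powR_inv1 // -powRrM mulN1r powRN. Qed.

Section MonomialProfile.
Variables (R : realType) (N1 : nat) (kap del s0 : R).
Hypotheses (kap0 : 0 <= kap) (del0 : 0 <= del) (s0_gt0 : 0 < s0).

(** The exponent of [r] in the profile when the [l]-th term of [qsum] dominates, with [kap] standing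
    for k ε. *)
Definition slope (l : nat) : R := 2 + kap - l%:R * del.

Hypothesis slope_nz : forall l, (l <= N1)%N -> s0 <= `|slope l|.

Variable q : nat -> R.
Hypothesis q0 : forall l, 0 <= q l.
Hypothesis qN : 0 < q N1.

Definition qsum (r : R) : R := \sum_(l < N1.+1) q l * r ^+ l.
(** Contribution of the annulus of radius [r] about a center, with the factor p_k^ε removed: r^2 is
    its area and r^kap comes from the [k]-th Taylor term of the numerator. *)
Definition profile (r : R) : R := r `^ (2 + kap) / qsum r `^ del.

Lemma qsum_ge l r : 0 <= r -> (l <= N1)%N -> q l * r ^+ l <= qsum r.
Proof.
move=> r0 lN; have lN' : (l < N1.+1)%N by [].
rewrite /qsum (bigD1 (Ordinal lN')) //= lerDl.
by apply: sumr_ge0 => i _; rewrite mulr_ge0 // exprn_ge0.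
Qed.

Lemma qsum_gt0 r : 0 < r -> 0 < qsum r.
Proof.
move=> r0; apply: lt_le_trans (qsum_ge (ltW r0) (leqnn N1)).
by rewrite mulr_gt0 // exprn_gt0.
Qed.

Lemma qsum_le r r' : 0 <= r -> r <= r' -> qsum r <= qsum r'.
Proof.
move=> r0 rr'; apply: ler_sum => l _; rewrite ler_wpM2l //.
by rewrite lerXn2r // nnegrE // (le_trans r0).
Qed.

Lemma profile_gt0 r : 0 < r -> 0 < profile r.
Proof. by move=> r0; rewrite divr_gt0 ?powR_gt0 // qsum_gt0. Qed.

Lemma qsum_dominant r : 0 < r -> exists l, [/\ (l <= N1)%N, 0 < q l & qsum r <= N1.+1%:R * (q l * r ^+ l)].
Proof.
move=> r0; pose F (l : 'I_N1.+1) := q l * r ^+ l.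
pose t := [arg max_(t > ord0) F t]%O.
have Ft s : F s <= F t by rewrite /t; case: arg_maxP => // i _; apply.
have sE : qsum r <= N1.+1%:R * F t.
  have -> : N1.+1%:R * F t = \sum_(s < N1.+1) F t by rewrite sumr_const card_ord mulr_natl.
  by apply: ler_sum => s _; exact: Ft.
exists t; split=> //; first by rewrite -ltnS.
rewrite lt0r q0 andbT; apply: contraTneq sE => qt.
by rewrite /F qt mul0r mulr0 -ltNge qsum_gt0.
Qed.

Lemma monomial_powR l r : 0 < r -> (q l * r ^+ l) `^ del = q l `^ del * r `^ (l%:R * del).
Proof.
move=> r0; rewrite powRM ?exprn_ge0 ?(ltW r0) //; congr (_ * _).
by rewrite -powR_mulrn ?(ltW r0) // -powRrM.
Qed.

Lemma powR_slope l r : 0 < r -> r `^ (2 + kap) = r `^ slope l * r `^ (l%:R * del).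
Proof.
move=> r0; rewrite -powRD ?subrK //.
by apply/implyP => _; exact: lt0r_neq0.
Qed.

Lemma profile_le l r : 0 < r -> (l <= N1)%N -> 0 < q l -> profile r <= r `^ slope l / q l `^ del.
Proof.
move=> r0 lN ql; have rl : 0 < q l * r ^+ l by rewrite mulr_gt0 // exprn_gt0.
apply: (@le_trans _ _ (r `^ (2 + kap) / (q l * r ^+ l) `^ del)).
  rewrite ler_wpM2l ?powR_ge0 // lef_pV2 ?posrE ?powR_gt0 ?qsum_gt0 //.
  by apply: ge0_ler_powR; rewrite ?nnegrE ?(ltW rl) ?(ltW (qsum_gt0 r0)) // qsum_ge // ltW.
rewrite monomial_powR // (powR_slope l r0) le_eqVlt; apply/orP; left; apply/eqP.
by field; rewrite !gt_eqF ?powR_gt0.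
Qed.

Lemma profile_ge l r : 0 < r -> 0 < q l -> qsum r <= N1.+1%:R * (q l * r ^+ l) ->
  r `^ slope l / q l `^ del <= N1.+1%:R `^ del * profile r.
Proof.
move=> r0 ql qr; have rl : 0 < q l * r ^+ l by rewrite mulr_gt0 // exprn_gt0.
have -> : r `^ slope l / q l `^ del = r `^ (2 + kap) / (q l * r ^+ l) `^ del.
  by rewrite monomial_powR // (powR_slope l r0); field; rewrite !gt_eqF ?powR_gt0.
rewrite /profile mulrCA ler_wpM2l ?powR_ge0 // ler_pdivlMr ?powR_gt0 ?qsum_gt0 //.
rewrite mulrC ler_pdivrMr ?powR_gt0 // -powRM ?(ltW rl) //.
by apply: ge0_ler_powR; rewrite ?nnegrE ?(ltW (qsum_gt0 r0)) // mulr_ge0 // ltW.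
Qed.

(** In logarithmic coordinates the profile is concave up to a constant; the monomial dominating at
    [r] provides a supporting line there, of nonzero slope. *)
Lemma profile_ratio (r : R) : 0 < r -> exists2 l, (l <= N1)%N &
  forall r' : R, 0 < r' -> profile r' <= N1.+1%:R `^ del * (r' / r) `^ slope l * profile r.
Proof.
move=> r0; have [l [lN ql qr]] := qsum_dominant r0.
exists l => // r1 r10.
apply: le_trans (profile_le r10 lN ql) _.
rewrite mulrAC; have := profile_ge r0 ql qr.
move/(ler_wpM2r (powR_ge0 (r1 / r) (slope l))); apply: le_trans.
rewrite powRM ?invr_ge0 ?(ltW r10) ?(ltW r0) // -(powR_inv1 (ltW r0)) -powRrM mulN1r powRN.
by rewrite le_eqVlt; apply/orP; left; apply/eqP; field; rewrite !gt_eqF ?powR_gt0.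
Qed.

Lemma geometric_sum_le (rho : R) n : 0 <= rho < 1 -> \sum_(i < n) rho ^+ i <= (1 - rho)^-1.
Proof.
move=> /andP[r0 r1]; have r1' : 0 < 1 - rho by rewrite subr_gt0.
rewrite -[leRHS]mul1r ler_pdivlMr //.
have -> : (\sum_(i < n) rho ^+ i) * (1 - rho) = 1 - rho ^+ n.
  by rewrite -[RHS]opprB subrX1 -opprB; ring.
by rewrite gerBl exprn_ge0.
Qed.

(** Split at the first index from which the sequence decays to the right. The index before it decays
    to the left, so both parts are bounded by geometric series. *)
Lemma unimodal_sum_le (x : nat -> R) (rho c H : R) : 0 <= rho < 1 -> 0 <= c ->
  (forall j, 0 <= x j <= H) ->
  (forall j, (forall i, x (j + i)%N <= c * rho ^+ i * x j) \/
             (forall i, (i <= j)%N -> x (j - i)%N <= c * rho ^+ i * x j)) ->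
  forall n, \sum_(j < n) x j <= 2 * (c * H / (1 - rho)).
Proof.
move=> rho01 c0 xH xP n.
have H0 : 0 <= H by have /andP[h] := xH 0%N; apply: le_trans.
have right j m : (forall i, x (j + i)%N <= c * rho ^+ i * x j) ->
    \sum_(i < m) x (j + i)%N <= c * H / (1 - rho).
  move=> h; apply: (@le_trans _ _ (\sum_(i < m) c * H * rho ^+ i)).
    apply: ler_sum => i _; apply: (le_trans (h i)); rewrite mulrAC ler_wpM2r ?exprn_ge0 //.
      by case/andP: rho01.
    by rewrite ler_wpM2l //; case/andP: (xH j).
  by rewrite -mulr_sumr ler_wpM2l ?mulr_ge0 // geometric_sum_le.
have left j : (forall i, (i <= j)%N -> x (j - i)%N <= c * rho ^+ i * x j) ->
    \sum_(i < j.+1) x i <= c * H / (1 - rho).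
  move=> h; rewrite (reindex_inj rev_ord_inj) /=.
  apply: (@le_trans _ _ (\sum_(i < j.+1) c * H * rho ^+ i)).
    apply: ler_sum => i _; rewrite subSS; apply: (le_trans (h i _)); first by rewrite -ltnS.
    rewrite mulrAC ler_wpM2r ?exprn_ge0 //; first by case/andP: rho01.
    by rewrite ler_wpM2l //; case/andP: (xH j).
  by rewrite -mulr_sumr ler_wpM2l ?mulr_ge0 // geometric_sum_le.
have B0 : 0 <= c * H / (1 - rho).
  by have := right 0%N 0%N; rewrite mulr_ge0 ?mulr_ge0 // invr_ge0 subr_ge0 ltW //; case/andP: rho01.
have [j [jn lj rj]] : exists j, [/\ (j <= n)%N, \sum_(i < j) x i <= c * H / (1 - rho) &
    (j = n \/ forall i, x (j + i)%N <= c * rho ^+ i * x j)].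
  elim: n => [|n [j [jn lj [jE|rj]]]].
  - by exists 0%N; split=> //; [rewrite big_ord0|left].
  - move: lj; rewrite jE => lj.
    have [h|/left h] := xP n; last by exists n.+1; split=> //; left.
    by exists n; split=> //; right.
  - by exists j; split=> //; [exact: leqW|right].
rewrite -(subnKC jn) big_split_ord /= mulr_natl mulr2n; apply: lerD => //.
case: rj => [->|rj]; first by rewrite subnn big_ord0.
exact: right.
Qed.

(** The supporting line has slope at least [s0] in modulus, so along the radii 2^-j the profile
    decays geometrically on one side of each index, with ratio 2^-s0. *)
Lemma profile_dyadic_sum (H : R) : (forall r, 0 < r <= 1 -> profile r <= H) ->
  forall n, \sum_(j < n) profile (2^-1 ^+ j) <=
    2 * (N1.+1%:R `^ del * H / (1 - 2 `^ (- s0))).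
Proof.
move=> HH; have p2 : 0 < 2 :> R by [].
have pj j : 0 < 2^-1 ^+ j :> R by rewrite exprn_gt0 // invr_gt0.
have rho01 : 0 <= (2 `^ (- s0) : R) < 1.
  have : 1 `^ s0 < 2 `^ s0 :> R by apply: gt0_ltr_powR; rewrite ?nnegrE // ltr1n.
  by rewrite powR1 powR_ge0 /= powRN => h; rewrite invf_lt1 ?powR_gt0.
apply: (unimodal_sum_le (x := fun j => profile (2^-1 ^+ j)) rho01 (powR_ge0 _ _)).
  move=> j; rewrite (ltW (profile_gt0 (pj j))) HH // pj /= exprn_ile1 ?invr_ge0 //.
  by rewrite invf_le1 // ler1n.
move=> j; have [l lN hl] := profile_ratio (pj j).
have decay i (u : R) : s0 <= u -> (2^-1 ^+ i) `^ u <= (2 `^ (- s0)) ^+ i.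
  move=> us.
  have -> : (2 `^ (- s0)) ^+ i = (2^-1 ^+ i) `^ s0.
    elim: i => [|i IH]; first by rewrite !expr0 powR1.
    rewrite !exprS powRM ?invr_ge0 ?exprn_ge0 ?invr_ge0 // IH; congr (_ * _).
    by rewrite -(powR_inv1 (ltW p2)) -powRrM mulN1r.
  by apply: ger_powR us; rewrite pj /= exprn_ile1 ?invr_ge0 // invf_le1 // ler1n.
have [sl|sl] := leP 0 (slope l).
  left=> i; apply: (le_trans (hl _ (pj _))).
  rewrite ler_wpM2r ?(ltW (profile_gt0 _)) // ler_wpM2l ?powR_ge0 //.
  rewrite exprD mulrC mulKf ?gt_eqF //; apply: decay.
  by rewrite -(ger0_norm sl) slope_nz.
right=> i ij; apply: (le_trans (hl _ (pj _))).
rewrite ler_wpM2r ?(ltW (profile_gt0 _)) // ler_wpM2l ?powR_ge0 //.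
have -> : 2^-1 ^+ (j - i) / 2^-1 ^+ j = (2^-1 ^+ i)^-1 :> R.
  rewrite -{2}(subnK ij) exprD; field.
  by rewrite !expf_neq0 // invr_eq0.
rewrite -powR_inv1 ?(ltW (pj i)) // -powRrM mulN1r; apply: decay.
by rewrite -(ltr0_norm sl) slope_nz.
Qed.

Lemma profile_le_positive l r : 0 < r <= 1 -> (l <= N1)%N -> 0 < slope l -> 0 < q l ->
  profile r <= (q l `^ del)^-1.
Proof.
move=> /andP[r0 r1] lN sl ql; apply: (le_trans (profile_le r0 lN ql)).
rewrite ler_pdivrMr ?powR_gt0 // mulVf ?gt_eqF ?powR_gt0 //.
have : r `^ slope l <= 1 `^ slope l by apply: ge0_ler_powR; rewrite ?nnegrE // ltW.
by rewrite powR1.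
Qed.

(* The weights make the powers of [r] cancel. *)
Lemma profile_le_pair l l' r : 0 < r -> (l <= N1)%N -> (l' <= N1)%N ->
  0 < slope l -> slope l' < 0 -> 0 < q l -> 0 < q l' ->
  profile r `^ (slope l - slope l') <=
    ((q l `^ del) `^ (- slope l') * (q l' `^ del) `^ slope l)^-1.
Proof.
move=> r0 lN l'N sl sl' ql ql'.
have h1 := profile_le r0 lN ql; have h2 := profile_le r0 l'N ql'.
have p0 := ltW (profile_gt0 r0).
rewrite addrC powRD; last by apply/implyP => _; rewrite gt_eqF // profile_gt0.
have a0 : 0 <= - slope l' by rewrite oppr_ge0 ltW.
apply: (@le_trans _ _ ((r `^ slope l / q l `^ del) `^ (- slope l') *
    (r `^ slope l' / q l' `^ del) `^ slope l)).
  apply: ler_pM; [exact: powR_ge0|exact: powR_ge0|exact: powR_monotone|].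
  by apply: powR_monotone; rewrite // ltW.
rewrite !powRM ?invr_ge0 ?powR_ge0 // -!powRrM.
rewrite mulrACA -powRD; last by apply/implyP => _; rewrite gt_eqF.
have -> : slope l * - slope l' + slope l' * slope l = 0 by ring.
by rewrite powRr0 mul1r invfM !powR_invr ?powR_ge0 // -!powRrM.
Qed.

(** The minimum of 1 and all the [F i], together with the information where it is attained. *)
Lemma exists_threshold (I : eqType) (s : seq I) (F : I -> R) : (forall i, i \in s -> 0 < F i) ->
  exists r : R, [/\ 0 < r <= 1, forall i, i \in s -> r <= F i & r = 1 \/ exists2 i, i \in s & r = F i].
Proof.
elim: s => [|a s IH] F0; first by exists 1; split; rewrite ?ltr01 ?lexx //; left.
have [|r [/andP[r0 r1] rF rE]] := IH; first by move=> i si; apply: F0; rewrite inE si orbT.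
have Fa : 0 < F a by apply: F0; rewrite inE eqxx.
have [ra|ra] := leP r (F a).
  exists r; split; first by rewrite r0.
    by move=> i; rewrite inE => /predU1P[->//|/rF].
  by case: rE => [->|[i si ->]]; [left|right; exists i; rewrite // inE si orbT].
exists (F a); split; first by rewrite Fa (le_trans (ltW ra)).
  by move=> i; rewrite inE => /predU1P[->//|/rF]; apply: le_trans; exact: ltW.
by right; exists a; rewrite // inE eqxx.
Qed.

(* Linear programming duality: the pairwise conditions are the feasibility of
   [y_l <= Lam * r ^ slope l] for all [l] at once. *)
Lemma profile_lower (Lam : R) : 0 < Lam ->
  (forall l, (l <= N1)%N -> 0 < slope l -> q l `^ del <= Lam) ->
  (forall l l', (l <= N1)%N -> (l' <= N1)%N -> 0 < slope l -> slope l' < 0 ->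
    (q l `^ del) `^ (- slope l') * (q l' `^ del) `^ slope l <= Lam `^ (slope l - slope l')) ->
  exists2 r : R, 0 < r <= 2^-1 &
    1 <= 2 `^ (2 + kap) * N1.+1%:R `^ del * Lam * profile r.
Proof.
move=> L0 H1 H2; pose y l := q l `^ del.
(* For a negative slope the condition y_l <= Lam r^(slope l) reads r <= F l. The largest such r <= 1
   is taken: positive slopes are then covered by [H1] if r = 1 and by [H2] if r = F l'. *)
pose F l := (Lam / y l) `^ (- (slope l)^-1).
have y0 l : 0 <= y l by exact: powR_ge0.
have [|r [/andP[r0 r1] rF rE]] := @exists_threshold _
    [seq l <- iota 0 N1.+1 | (slope l < 0) && (0 < y l)] F.
  move=> l; rewrite mem_filter => /andP[/andP[_ yl] _].
  by rewrite powR_gt0 // divr_gt0.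
have yle l : (l <= N1)%N -> y l <= Lam * r `^ slope l.
  move=> lN; have := slope_nz lN; case: (ltgtP (slope l) 0) => [sl _|sl _|->]; last first.
  - by rewrite normr0 => /(lt_le_trans s0_gt0); rewrite ltxx.
  - case: rE => [->|[l' ]]; first by rewrite powR1 mulr1 H1.
    rewrite mem_filter mem_iota add0n ltnS /= => /andP[/andP[sl' yl'] l'N] ->.
    have a0 : 0 < - slope l' by rewrite oppr_gt0.
    have := H2 l l' lN l'N sl sl'; rewrite -/(y l) -/(y l') => h.
    rewrite /F -powRrM.
    have -> : - (slope l')^-1 * slope l = slope l / (- slope l') by rewrite invrN; ring.
    set z := Lam / y l'; have z0 : 0 < z by rewrite divr_gt0.
    have {}h : y l `^ (- slope l') <= Lam `^ (- slope l') * z `^ slope l.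
      rewrite powRM ?invr_ge0 ?(ltW L0) // powR_invr // mulrA.
      rewrite ler_pdivlMr; last exact: powR_gt0.
      rewrite -[Lam `^ _ * _]powRD; last by apply/implyP => _; rewrite gt_eqF.
      by rewrite [- slope l' + _]addrC.
    have -> : y l = (y l `^ (- slope l')) `^ (- slope l')^-1.
      by rewrite -powRrM divff ?gt_eqF // powRr1.
    have -> : Lam * z `^ (slope l / - slope l') = (Lam `^ (- slope l') * z `^ slope l) `^ (- slope l')^-1.
      by rewrite powRM ?powR_ge0 // -!powRrM divff ?gt_eqF // powRr1 // ltW.
    by apply: ge0_ler_powR; rewrite ?nnegrE ?invr_ge0 ?powR_ge0 ?mulr_ge0 ?powR_ge0 // ltW.
  case: (eqVneq (y l) 0) => [->|yl]; first by rewrite mulr_ge0 ?powR_ge0 // ltW.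
  have {}yl : 0 < y l by rewrite lt0r yl y0.
  have : r <= F l by apply: rF; rewrite mem_filter sl yl mem_iota /= add0n ltnS.
  rewrite /F; set z := Lam / y l; have z0 : 0 < z by rewrite divr_gt0.
  have a0 : 0 < - slope l by rewrite oppr_gt0.
  move=> rz; have : r `^ (- slope l) <= z.
    have -> : z = (z `^ (- (slope l)^-1)) `^ (- slope l).
      by rewrite -powRrM mulrNN mulVf ?lt_eqF // powRr1 // ltW.
    by apply: ge0_ler_powR; rewrite ?nnegrE ?powR_ge0 // ltW.
  by rewrite powRN /z ler_pdivlMr // mulrC ler_pdivrMr // powR_gt0.
(* Halving keeps the radius within 1/2, as needed to stay inside the unit disk around a center of
   modulus at most 1/2; it costs 2^(2 + kap). *)
exists (r / 2).
  by rewrite divr_gt0 //= ler_pdivrMr // mulVf.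
have q_le : qsum r `^ del <= N1.+1%:R `^ del * (Lam * r `^ (2 + kap)).
  have [l [lN ql qr]] := qsum_dominant r0.
  apply: (@le_trans _ _ ((N1.+1%:R * (q l * r ^+ l)) `^ del)).
    by apply: ge0_ler_powR; rewrite ?nnegrE ?(ltW (qsum_gt0 r0)) // (le_trans (ltW (qsum_gt0 r0))).
  rewrite powRM ?mulr_ge0 ?exprn_ge0 ?(ltW r0) // ler_wpM2l ?powR_ge0 //.
  rewrite monomial_powR // (powR_slope l r0) mulrA ler_wpM2r ?powR_ge0 //.
  exact: yle.
have r20 : 0 < r / 2 by rewrite divr_gt0.
rewrite /profile mulrA ler_pdivlMr ?powR_gt0 ?qsum_gt0 // mul1r.
apply: (@le_trans _ _ (qsum r `^ del)).
  apply: ge0_ler_powR; rewrite ?nnegrE ?(ltW (qsum_gt0 _)) //.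
  by apply: qsum_le; rewrite ?(ltW r20) // ler_pdivrMr // ler_peMr ?(ltW r0) // ler1n.
apply: (le_trans q_le).
rewrite powRM ?invr_ge0 ?(ltW r0) // -[2^-1](@powR_inv1) // -powRrM mulN1r powRN.
by rewrite le_eqVlt; apply/orP; left; apply/eqP; field; rewrite !gt_eqF ?powR_gt0.
Qed.

End MonomialProfile.

(** * Local expansions of polynomials *)

Section LocalExpansion.
Context {R : realType}.
Implicit Types (p : {poly R[i]}) (z om : R[i]).

Definition shift om p : {poly R[i]} := p \Po ('X + om%:P).

Lemma coef_shift om p k : (shift om p)`_k = p^`N(k).[om].
Proof.
have := @nderiv_taylor_wide _ (maxn (size p) k.+1) (map_poly polyC p) om%:P 'X (mulrC _ _).
rewrite size_map_polyC leq_maxl => /(_ isT).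
rewrite addrC -[X in X = _]/(shift om p) => ->.
rewrite (eq_bigr (fun i : 'I_(maxn (size p) k.+1) => (p^`N(i).[om]) *: 'X^i)); last first.
  by move=> i _; rewrite nderivn_map horner_map /= mul_polyC.
by rewrite -(poly_def _ (fun i => p^`N(i).[om])) coef_poly leq_max ltnSn orbT.
Qed.

Lemma size_shift om p : size (shift om p) = size p.
Proof. by rewrite /shift size_comp_poly2 // size_XaddC. Qed.

Lemma shift_horner om p w : (shift om p).[w] = p.[om + w].
Proof. by rewrite horner_comp !hornerE addrC. Qed.

Lemma shift_eq0 om p : (shift om p == 0) = (p == 0).
Proof. by rewrite -!size_poly_eq0 size_shift. Qed.

Lemma cabs_sub_le z om r : cabs (z - om) <= r -> forall p, cabs p.[z] <= nrm r (shift om p).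
Proof.
move=> zr p; have -> : p.[z] = (shift om p).[z - om] by rewrite shift_horner addrC subrK.
exact: cabs_horner_le.
Qed.

(* At a point [z] at least as close to [om] as to any root of [p], no cancellation
   occurs in the expansion of [p] around [om]. *)
Lemma nrm_shift_le p z om (d : nat) : (size p <= d.+1)%N ->
  (forall x, root p x -> cabs (z - om) <= cabs (z - x)) ->
  nrm (cabs (z - om)) (shift om p) <= 3 ^+ d * cabs p.[z].
Proof.
move=> sp zroot; have [->|p0] := eqVneq p 0.
  by rewrite /shift comp_poly0 nrm0 horner0 cabs0 mulr0.
have [rs pE] := closed_field_poly_normal p.
set r := cabs (z - om) in zroot *; have r0 : 0 <= r := cabs_ge0 _.
have srs : (size rs <= d)%N.
  move: sp; rewrite pE size_scale ?lead_coef_eq0 //.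
  by rewrite -(big_map id xpredT (fun c => 'X - c%:P)) map_id size_prod_XsubC ltnS.
have rroot x : x \in rs -> r <= cabs (z - x).
  move=> xrs; apply: zroot; rewrite pE rootZ ?lead_coef_eq0 //.
  by rewrite -(big_map id xpredT (fun c => 'X - c%:P)) map_id root_prod_XsubC.
rewrite {1}pE /shift linearZ /= rmorph_prod /= nrmZ.
rewrite [in leRHS]pE hornerZ horner_prod cabsM cabs_prod mulrCA.
rewrite ler_wpM2l ?cabs_ge0 // (le_trans (nrm_prod _ _ _ r0)) //.
apply: (@le_trans _ _ (3 ^+ size rs * \prod_(x <- rs) cabs ('X - x%:P).[z])); last first.
  rewrite ler_wpM2r ?prodr_ge0 //; first by move=> *; exact: cabs_ge0.
  by rewrite ler_weXn2l // ler1n.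
elim: rs rroot {pE srs} => [|a s IH] rroot; first by rewrite !big_nil mulr1.
rewrite !big_cons exprS mulrACA ler_pM ?nrm_ge0 ?prodr_ge0 //.
- by move=> i _; exact: nrm_ge0.
- rewrite comp_polyB comp_polyX comp_polyC -addrA -[om%:P - _]opprB -polyCB nrm_XsubC !hornerE.
  have ra : r <= cabs (z - a) by apply: rroot; rewrite inE eqxx.
  (* Origin of the 3: the factor X - a recentred at [om] has norm r + |a - om| <= 2 r + |z - a| <= 3
     |z - a|. *)
  have : cabs (a - om) <= cabs (z - om) + cabs (z - a).
    have -> : a - om = (z - om) - (z - a) by ring.
    exact: cabsB.
  by rewrite -/r; lra.
- by apply: IH => x xs; apply: rroot; rewrite inE xs orbT.
Qed.

Lemma euclid_le_sum (n : nat) (x : 'I_n -> R[i]) :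
  Num.sqrt (\sum_i cabs2 (x i)) <= \sum_i cabs (x i).
Proof.
have s0 : 0 <= \sum_i cabs (x i) by apply: sumr_ge0 => i _; exact: cabs_ge0.
rewrite -(ger0_norm s0) -sqrtr_sqr ler_wsqrtr //.
elim: n x {s0} => [|n IH] x; first by rewrite !big_ord0 expr0n.
rewrite !big_ord_recl sqrrD -sqr_cabs -addrA lerD2l (le_trans (IH _)) // lerDr.
by rewrite mulrn_wge0 // mulr_ge0 ?cabs_ge0 // sumr_ge0 // => i _; exact: cabs_ge0.
Qed.

Lemma cabs_le_euclid (n : nat) (x : 'I_n -> R[i]) i : cabs (x i) <= Num.sqrt (\sum_i cabs2 (x i)).
Proof.
rewrite /cabs ler_wsqrtr // (bigD1 i) //= lerDl.
by apply: sumr_ge0 => j _; exact: cabs2_ge0.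
Qed.

Lemma powR_half (x r : R) : 0 <= x -> x `^ (r / 2) = (Num.sqrt x) `^ r.
Proof. by move=> x0; rewrite -powR12_sqrt // -powRrM mulrC. Qed.

Lemma cabs_expB_le (w w0 : R[i]) (r kap : R) n : 0 <= kap -> cabs w <= r -> cabs w0 <= r ->
  cabs (w - w0) <= kap * r -> cabs (w ^+ n - w0 ^+ n) <= n%:R * kap * r ^+ n.
Proof.
move=> k0 wr w0r ww; elim: n => [|n IH]; first by rewrite !expr0 subrr cabs0 !mul0r.
have r0 : 0 <= r by apply: le_trans wr; exact: cabs_ge0.
have -> : w ^+ n.+1 - w0 ^+ n.+1 = w * (w ^+ n - w0 ^+ n) + (w - w0) * w0 ^+ n.
  by rewrite !exprS; ring.
apply: le_trans (cabsD _ _) _; rewrite !cabsM cabsX.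
have h1 : cabs w * cabs (w ^+ n - w0 ^+ n) <= r * (n%:R * kap * r ^+ n).
  by rewrite ler_pM ?cabs_ge0.
have h2 : cabs (w - w0) * cabs w0 ^+ n <= kap * r * r ^+ n.
  by rewrite ler_pM ?cabs_ge0 ?exprn_ge0 ?cabs_ge0 // lerXn2r ?nnegrE ?cabs_ge0.
apply: (le_trans (lerD h1 h2)).
by rewrite exprS le_eqVlt; apply/orP; left; apply/eqP; rewrite -natr1; ring.
Qed.

(** A move by kap r inside the disk of radius [r] changes the i-th monomial by at most i kap times
    its maximal size, so the error is relative to [nrm r]. *)
Lemma shift_lipschitz p om (z z0 : R[i]) (r kap : R) (d : nat) : (size p <= d.+1)%N -> 0 <= kap ->
  cabs (z - om) <= r -> cabs (z0 - om) <= r -> cabs (z - z0) <= kap * r ->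
  cabs (p.[z] - p.[z0]) <= d%:R * kap * nrm r (shift om p).
Proof.
move=> sp k0 zr z0r zz0.
have r0 : 0 <= r by apply: le_trans zr; exact: cabs_ge0.
have E y : p.[y] = (shift om p).[y - om] by rewrite shift_horner addrC subrK.
rewrite !E !horner_coef -sumrB (le_trans (cabs_sum _ _ _)) // /nrm mulr_sumr.
apply: ler_sum => i _; rewrite -mulrBr cabsM mulrCA ler_wpM2l ?cabs_ge0 //.
have ww : cabs ((z - om) - (z0 - om)) <= kap * r by have -> : (z - om) - (z0 - om) = z - z0 by ring.
apply: le_trans (cabs_expB_le i k0 zr z0r ww) _.
rewrite ler_wpM2r ?exprn_ge0 // ler_wpM2r // ler_nat.
by rewrite -ltnS (leq_trans (ltn_ord i)) // size_shift.
Qed.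

Lemma cabs_real (a : R) : cabs (a%:C%C) = `|a|.
Proof. by rewrite /cabs /= expr0n addr0 sqrtr_sqr. Qed.

Lemma coef_comp_scaleX p (a : R[i]) k : (p \Po (a *: 'X))`_k = p`_k * a ^+ k.
Proof.
rewrite comp_polyE (eq_bigr (fun i : 'I_(size p) => (p`_i * a ^+ i) *: 'X^i)); last first.
  by move=> i _; rewrite exprZn scalerA.
rewrite -(poly_def _ (fun i => p`_i * a ^+ i)) coef_poly.
by case: ltnP => // h; rewrite nth_default // mul0r.
Qed.

(** Interpolation at equally spaced points om + u j finds one where [p] has the size of its
    expansion; the Lipschitz bound propagates this to a disk of comparable radius. *)
Lemma large_on_square (d : nat) : exists c kap : R, [/\ 0 < c, 0 < kap, kap <= 4^-1 &
  forall p om (r : R), (size p <= d.+1)%N -> 0 < r ->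
  exists2 z0, cabs (z0 - om) <= r / 2 &
    forall z, cabs (z - z0) <= kap * r -> c * nrm r (shift om p) <= cabs p.[z]].
Proof.
have [K K0 HK] := @nrm_interpolation R d d.+1.
pose D : R := (2 * d.+1%:R).
have D0 : 0 < D by rewrite mulr_gt0 // ltr0n.
have D1 : 1 <= D by rewrite /D -natrM ler1n.
pose c1 : R := (2 * K * D ^+ d.+1)^-1.
have c10 : 0 < c1 by rewrite invr_gt0 !mulr_gt0 // exprn_gt0.
(* The bound 1/4 keeps the small disk within distance [r] of [om]; the bound c1/D makes the
   variation at most half of the value at its centre. *)
pose kap := Num.min 4^-1 (c1 / D).
have kap0 : 0 < kap by rewrite lt_min invr_gt0 ltr0n /= divr_gt0.
exists (c1 / 2), kap; split; rewrite ?divr_gt0 //; first by rewrite ge_min lexx.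
move=> p om r sp r0.
pose u := r / D; have u0 : 0 < u by rewrite divr_gt0.
pose g := (shift om p) \Po (u%:C%C *: 'X).
have sg : (size g <= d.+1)%N.
  rewrite /g size_comp_poly2 ?size_shift // size_scale ?size_polyX //.
  by apply: contraTneq u0 => /(@complexR_inj _ _ 0) ->; rewrite ltxx.
have gk k : g`_k = (shift om p)`_k * (u%:C%C) ^+ k by exact: coef_comp_scaleX.
have ng : nrm 1 g = nrm u (shift om p).
  rewrite (@nrmE _ 1 g d.+1) // (@nrmE _ u _ d.+1) ?size_shift //.
  by apply: eq_bigr => k _; rewrite expr1n mulr1 gk cabsM cabsX cabs_real ger0_norm // ltW.
have nr : nrm r (shift om p) <= D ^+ d.+1 * nrm u (shift om p).
  rewrite (@nrmE _ r _ d.+1) ?size_shift // (@nrmE _ u _ d.+1) ?size_shift // mulr_sumr.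
  apply: ler_sum => k _; rewrite mulrCA ler_wpM2l ?cabs_ge0 //.
  have -> : r = D * u by rewrite /u mulrC divfK // gt_eqF.
  rewrite exprMn ler_wpM2r ?exprn_ge0 ?(ltW u0) // ler_weXn2l // ltnW //.
have [j jd gj] : exists2 j : nat, (j <= d)%N & (2 * K)^-1 * nrm 1 g <= cabs g.[j%:R].
  apply: contrapT => hj; have n0 : 0 <= nrm 1 g by exact: nrm_ge0.
  have hlt j : (j <= d)%N -> cabs g.[j%:R] < (2 * K)^-1 * nrm 1 g.
    by move=> jd; rewrite ltNge; apply/negP => h; apply: hj; exists j.
  have : nrm 1 g <= K * ((2 * K)^-1 * nrm 1 g).
    apply: (HK g (iota 0 d.+1)) => //.
    - by rewrite size_iota.
    - exact: iota_uniq.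
    - by move=> x; rewrite mem_iota add0n ltnS.
    - by rewrite mulr_ge0 // invr_ge0 mulr_ge0 // ltW.
    - by move=> x; rewrite mem_iota add0n ltnS => /= /hlt /ltW.
  have -> : K * ((2 * K)^-1 * nrm 1 g) = nrm 1 g / 2 by field; rewrite gt_eqF.
  move=> h; have n00 : nrm 1 g = 0 by lra.
  by have := hlt 0%N (leq0n _); rewrite n00 mulr0 ltNge cabs_ge0.
pose z0 := om + u%:C%C * j%:R.
have z0r : cabs (z0 - om) <= r / 2.
  rewrite /z0 addrC addKr cabsM cabs_real cabs_nat ger0_norm ?(ltW u0) //.
  have -> : r / 2 = u * d.+1%:R by rewrite /u /D; field; rewrite addrC natr1 pnatr_eq0.
  by rewrite ler_wpM2l ?(ltW u0) // ler_nat leqW.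
exists z0 => // z zz0.
have pz0 : c1 * nrm r (shift om p) <= cabs p.[z0].
  have -> : p.[z0] = g.[j%:R] by rewrite /g horner_comp !hornerE shift_horner.
  apply: le_trans gj; rewrite ng /c1 invfM -mulrA ler_wpM2l ?invr_ge0 ?mulr_ge0 ?(ltW K0) //.
  by rewrite ler_pdivrMl // exprn_gt0.
have kap4 : kap <= 4^-1 by rewrite ge_min lexx.
have zr : cabs (z - om) <= r.
  have -> : z - om = (z - z0) + (z0 - om) by ring.
  apply: le_trans (cabsD _ _) _; apply: (le_trans (lerD zz0 z0r)).
  have : kap * r <= 4^-1 * r by rewrite ler_wpM2r // ltW.
  by move: r0; lra.
have z0r' : cabs (z0 - om) <= r by apply: (le_trans z0r); move: r0; lra.
have := shift_lipschitz sp (ltW kap0) zr z0r' zz0.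
have n0 : 0 <= nrm r (shift om p) by rewrite nrm_ge0 // ltW.
have dk : d%:R * kap * nrm r (shift om p) <= c1 / 2 * nrm r (shift om p).
  rewrite ler_wpM2r //.
  apply: (@le_trans _ _ (d%:R * (c1 / D))).
    by rewrite ler_wpM2l // ge_min lexx orbT.
  rewrite mulrCA ler_wpM2l ?(ltW c10) // ler_pdivrMr // /D mulKf //.
  by rewrite ler_nat.
move=> h; have h2 : cabs p.[z0] <= cabs p.[z] + cabs (p.[z] - p.[z0]).
  have {1}-> : p.[z0] = p.[z] - (p.[z] - p.[z0]) by ring.
  exact: cabsB.
move: (le_trans h dk) h2 pz0; clear; set a := nrm _ _; set b := cabs _; lra.
Qed.

End LocalExpansion.

(** * Two-sided bounds for the disk integral *)

Section IntegralBounds.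
Context {R : realType}.
Variables (I J M1 N1 : nat) (e d s0 : R).
Hypotheses (I0 : (0 < I)%N) (J0 : (0 < J)%N) (e0 : 0 <= e) (d0 : 0 <= d) (s00 : 0 < s0).
Implicit Types (Ps : 'I_I -> {poly R[i]}) (Qs : 'I_J -> {poly R[i]}).
Notation plane := (measurableTypeR R * measurableTypeR R)%type.
Let mu := (@lebesgue_measure R \x @lebesgue_measure R)%E.

Definition ratio_fun Ps Qs (x : plane) : \bar R :=
  let z := (x.1 +i* x.2)%C in
  let K := powR (\sum_(i < I) cabs2 (Ps i).[z]) (e / 2) in
  let L := powR (\sum_(j < J) cabs2 (Qs j).[z]) (d / 2) in
  if L == 0 then +oo%E else (K / L)%:E.

Definition pco Ps (om : R[i]) k := \sum_i cabs (Ps i)^`N(k).[om].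

Lemma pco_ge0 (I' : nat) (Ps : 'I_I' -> {poly R[i]}) om k : 0 <= \sum_i cabs (Ps i)^`N(k).[om].
Proof. by apply: sumr_ge0 => i _; exact: cabs_ge0. Qed.

Definition qco Qs (om : R[i]) k := \sum_i cabs (Qs i)^`N(k).[om].

Lemma sum_nrm_shift (n D : nat) (ps : 'I_n -> {poly R[i]}) om (r : R) :
  (forall i, (size (ps i) <= D.+1)%N) ->
  \sum_i nrm r (shift om (ps i)) = \sum_(k < D.+1) (\sum_i cabs (ps i)^`N(k).[om]) * r ^+ k.
Proof.
move=> sp; under [RHS]eq_bigr do rewrite mulr_suml.
rewrite exchange_big /=; apply: eq_bigr => i _.
rewrite (@nrmE _ r _ D.+1) ?size_shift //.
by apply: eq_bigr => k _; rewrite coef_shift.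
Qed.

Lemma powR_sum_le (n : nat) (x : 'I_n -> R) : (0 < n)%N -> (forall k, 0 <= x k) ->
  (\sum_k x k) `^ e <= n%:R `^ e * \sum_k x k `^ e.
Proof.
case: n x => // n x _ x0.
pose t := [arg max_(t > ord0) x t]%O.
have tx s : x s <= x t by rewrite /t; case: arg_maxP => // i _; apply.
apply: (@le_trans _ _ ((n.+1%:R * x t) `^ e)).
  apply: powR_monotone => //; first exact: sumr_ge0.
  have -> : n.+1%:R * x t = \sum_(s < n.+1) x t by rewrite sumr_const card_ord mulr_natl.
  exact: ler_sum.
rewrite powRM // ler_wpM2l ?powR_ge0 // (bigD1 t) //= lerDl.
by rewrite sumr_ge0 // => s _; exact: powR_ge0.
Qed.

Lemma cabs_le_ReIm (z : R[i]) : cabs z <= `|complex.Re z| + `|complex.Im z|.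
Proof.
case: z => a b; rewrite /cabs /=.
have ab0 : 0 <= `|a| + `|b| by rewrite addr_ge0.
rewrite -[leRHS](ger0_norm ab0) -sqrtr_sqr ler_wsqrtr //.
rewrite sqrrD !real_normK ?num_real // addrAC lerDl.
by rewrite mulrn_wge0 // mulr_ge0.
Qed.

(** Near [om] there is a square of side of order [r] on which some P_i is at least a constant times
    p_k r^k, whereas |Q| is at most [qsum] on the whole disk of radius [r]. The area of the square
    supplies r^2. *)
Lemma integral_lower : exists2 c : R, 0 < c &
  forall Ps Qs om (r : R) k, (forall i, (size (Ps i) <= M1.+1)%N) ->
  (forall j, (size (Qs j) <= N1.+1)%N) -> measurable_fun [set: plane] (ratio_fun Ps Qs) ->
  cabs om <= 2^-1 -> 0 < r <= 2^-1 -> (k <= M1)%N -> 0 < qco Qs om N1 ->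
  ((c * (pco Ps om k `^ e * profile N1 (k%:R * e) d (qco Qs om) r))%:E <=
     \int[mu]_(x in unit_disk) ratio_fun Ps Qs x)%E.
Proof.
have [c [kap [c0 kap0 kap4 Hc]]] := @large_on_square R M1.
have I0' : 0 < I%:R :> R by rewrite ltr0n.
exists (kap ^+ 2 * (c / I%:R) `^ e).
  by rewrite mulr_gt0 ?exprn_gt0 // powR_gt0 // divr_gt0.
move=> Ps Qs om r k sP sQ mf om2 /andP[r0 r2] kM qN.
have [i pi] : exists i, pco Ps om k <= I%:R * cabs (Ps i)^`N(k).[om].
  pose t := [arg max_(t > Ordinal I0) cabs (Ps t)^`N(k).[om]]%O.
  exists t; have tx s : cabs (Ps s)^`N(k).[om] <= cabs (Ps t)^`N(k).[om].
    by rewrite /t; case: arg_maxP => // i _; apply.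
  by rewrite mulr_natl -[X in _ *+ X]card_ord -sumr_const; apply: ler_sum => s _; exact: tx.
have [z0 z0r Hz0] := Hc (Ps i) om r (sP i) r0.
pose h := kap * r / 2; have h0 : 0 < h by rewrite divr_gt0 // mulr_gt0.
have qr : 0 < qsum N1 (qco Qs om) r by apply: qsum_gt0 => // l; exact: pco_ge0.
have close x : square z0 h x -> cabs ((x.1 +i* x.2)%C - z0) <= kap * r.
  case: z0 {z0r Hz0} => a b; rewrite /square /= !in_itv /= => -[/andP[x1 x2] /andP[x3 x4]].
  apply: (le_trans (cabs_le_ReIm _)) => /=.
  have -> : kap * r = h + h by rewrite /h; field.
  by apply: lerD; rewrite ler_norml; apply/andP; split; lra.
have kr : kap * r <= 4^-1 * r by rewrite ler_wpM2r // ltW.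
pose v := (c / I%:R * (pco Ps om k * r ^+ k)) `^ e / qsum N1 (qco Qs om) r `^ d.
have E : kap ^+ 2 * (c / I%:R) `^ e * (pco Ps om k `^ e * profile N1 (k%:R * e) d (qco Qs om) r) =
    4 * h ^+ 2 * v.
  have p0 : 0 <= pco Ps om k := pco_ge0 _ _ _.
  have rk0 : 0 <= r ^+ k by rewrite exprn_ge0 // ltW.
  have cI0 : 0 <= c / I%:R by rewrite divr_ge0 // ltW.
  rewrite /v /profile (powRM _ cI0 (mulr_ge0 p0 rk0)) (powRM _ p0 rk0).
  have -> : (r ^+ k) `^ e = r `^ (k%:R * e) by rewrite -powR_mulrn ?(ltW r0) // powRrM.
  have -> : r `^ (2 + k%:R * e) = r ^+ 2 * r `^ (k%:R * e).
    rewrite powRD; last by apply/implyP => _; rewrite gt_eqF.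
    by rewrite -[in RHS]powR_mulrn ?(ltW r0).
  by rewrite /h; field; rewrite gt_eqF // powR_gt0.
rewrite E; apply: (@square_integral_ge _ _ _ z0) => //.
- exact: measurable_unit_disk.
- exact: measurable_funS mf.
- by move=> x _; rewrite /ratio_fun; case: ifP => // _; rewrite lee_fin divr_ge0 ?powR_ge0.
- exact: ltW.
- by rewrite divr_ge0 ?powR_ge0.
(* The three distances add up to at most kap r + r/2 + 1/2 <= 3 r/4 + 1/2 < 1. *)
- move=> x /close xz0; rewrite /unit_disk /=.
  have -> : x.1 ^+ 2 + x.2 ^+ 2 = cabs (x.1 +i* x.2)%C ^+ 2 by rewrite sqr_cabs.
  rewrite expr_lt1 ?cabs_ge0 //.
  have -> : (x.1 +i* x.2)%C = ((x.1 +i* x.2)%C - z0) + (z0 - om) + om by ring.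
  apply: le_lt_trans (cabsD _ _) _.
  apply: le_lt_trans (lerD (cabsD _ _) om2) _.
  by move: xz0 z0r kr r2 r0; set a := cabs _; set b := cabs _; lra.
- move=> x /close xz0; rewrite /ratio_fun; set z := (x.1 +i* x.2)%C in xz0 *.
  case: ifPn => [_|L0]; first by rewrite leey.
  have zom : cabs (z - om) <= r.
    have -> : z - om = (z - z0) + (z0 - om) by ring.
    apply: (le_trans (cabsD _ _)).
    by move: xz0 z0r kr r0; set a := cabs _; set b := cabs _; lra.
  have sP0 : 0 <= \sum_(i < I) cabs2 (Ps i).[z] by apply: sumr_ge0 => *; exact: cabs2_ge0.
  have sQ0 : 0 <= \sum_(j < J) cabs2 (Qs j).[z] by apply: sumr_ge0 => *; exact: cabs2_ge0.
  rewrite lee_fin /v; apply: ler_pM; rewrite ?powR_ge0 ?invr_ge0 ?powR_ge0 //.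
    rewrite powR_half //; apply: powR_monotone => //.
      by rewrite !mulr_ge0 ?invr_ge0 ?pco_ge0 ?exprn_ge0 // ltW.
    apply: (le_trans _ (cabs_le_euclid (fun i => (Ps i).[z]) i)).
    apply: (le_trans _ (Hz0 z xz0)); rewrite -mulrA ler_wpM2l ?(ltW c0) //.
    rewrite ler_pdivrMl //.
    apply: (@le_trans _ _ (I%:R * cabs (Ps i)^`N(k).[om] * r ^+ k)).
      by rewrite ler_wpM2r ?exprn_ge0 // ltW.
    rewrite -mulrA ler_wpM2l ?(ltW I0') // -coef_shift.
    by apply: cabs_coef_le; exact: ltW.
  rewrite lef_pV2; [|by rewrite posrE powR_gt0|by rewrite posrE lt0r L0 powR_ge0].
  rewrite powR_half //; apply: powR_monotone => //.
  apply: (le_trans (euclid_le_sum _)).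
  rewrite /qsum -(sum_nrm_shift _ _ sQ); apply: ler_sum => j _.
  exact: cabs_sub_le.
Qed.

Lemma dyadic_scale (r : R) : 0 < r <= 1 -> exists j, 2^-1 ^+ j.+1 < r <= 2^-1 ^+ j.
Proof.
move=> /andP[r0 r1].
have ex : exists j, 2^-1 ^+ j.+1 < r.
  have [m hm] : exists m : nat, r^-1 < m%:R.
    by exists (Num.bound r^-1); apply: archi_boundP; rewrite invr_ge0 ltW.
  exists m; rewrite -[r]invrK exprVn ltf_pV2 ?posrE ?invr_gt0 ?exprn_gt0 //.
  apply: (lt_le_trans hm); rewrite -natrX ler_nat.
  by apply: (@leq_trans (2 ^ m)%N); [apply: ltnW; exact: ltn_expl|rewrite leq_exp2l].
exists (ex_minn ex); case: ex_minnP => j jr jmin; rewrite jr /=.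
case: j jr jmin => [|j] _ jmin; first by rewrite expr0.
by rewrite leNgt; apply/negP => /jmin; rewrite ltnn.
Qed.

Definition center_poly Qs (j1 : 'I_J) (nn : nat) (j : 'I_J) : {poly R[i]} :=
  if j == j1 then Qs j1 else nn%:R *: Qs j1 + Qs j.

Lemma qsum_le_euclid Qs (j1 : 'I_J) (nn : nat) (z om : R[i]) :
  (forall j, (size (Qs j) <= N1.+1)%N) ->
  (forall j x, root (center_poly Qs j1 nn j) x -> cabs (z - om) <= cabs (z - x)) ->
  qsum N1 (qco Qs om) (cabs (z - om)) <=
  J%:R * (3 ^+ N1 * (1 + 2 * nn%:R)) * Num.sqrt (\sum_j cabs2 (Qs j).[z]).
Proof.
move=> sQ Hroot; set r := cabs _; have r0 : 0 <= r := cabs_ge0 _.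
set S := Num.sqrt _; have S0 : 0 <= S := sqrtr_ge0 _.
rewrite /qsum -(sum_nrm_shift _ _ sQ) -!mulrA mulr_natl -[X in _ *+ X]card_ord -sumr_const.
apply: ler_sum => j _; rewrite mulrA.
have sc j' : (size (center_poly Qs j1 nn j') <= N1.+1)%N.
  rewrite /center_poly; case: ifP => // _; rewrite (leq_trans (size_polyD _ _)) // geq_max sQ andbT.
  by rewrite (leq_trans (size_scale_leq _ _)).
have QS j' : cabs (Qs j').[z] <= S by exact: (cabs_le_euclid (fun j => (Qs j).[z])).
have h1 : nrm r (shift om (Qs j1)) <= 3 ^+ N1 * S.
  have := nrm_shift_le (sc j1) (Hroot j1); rewrite /center_poly eqxx => h.
  by apply: (le_trans h); rewrite ler_wpM2l ?exprn_ge0.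
have nn0 : 0 <= nn%:R :> R by [].
have T0 : 0 <= 3 ^+ N1 * S by rewrite mulr_ge0 ?exprn_ge0.
have [->|jj] := eqVneq j j1.
  by apply: (le_trans h1); rewrite mulrAC ler_peMr // lerDl mulr_ge0.
have h2 : nrm r (shift om (center_poly Qs j1 nn j)) <= 3 ^+ N1 * (S + nn%:R * S).
  apply: (le_trans (nrm_shift_le (sc j) (Hroot j))); rewrite ler_wpM2l ?exprn_ge0 //.
  rewrite /center_poly (negbTE jj) hornerD hornerZ (le_trans (cabsD _ _)) // addrC lerD //.
  by rewrite cabsM cabs_nat ler_wpM2l.
(* Origin of 1 + 2n: the factor n Q_1 + Q_j contributes 1 + n, and subtracting n Q_1 again another
   n. *)
have -> : Qs j = center_poly Qs j1 nn j + (- nn%:R) *: Qs j1.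
  by rewrite /center_poly (negbTE jj) scaleNr addrAC subrr add0r.
rewrite /shift comp_polyD comp_polyZ (le_trans (nrmD _ _ r0)) // nrmZ cabsN cabs_nat.
have h3 : nn%:R * nrm r (Qs j1 \Po ('X + om%:P)) <= nn%:R * (3 ^+ N1 * S) by rewrite ler_wpM2l.
apply: (le_trans (lerD h2 h3)).
by rewrite le_eqVlt; apply/orP; left; apply/eqP; ring.
Qed.

(** Each point of the disk is assigned to its nearest center and to the dyadic scale of its distance
    to it. The sums over scales are geometric by nondegeneracy, so any bound on the suprema over [r]
    bounds the integral. *)
Lemma integral_upper (nn : nat) :
  (forall k l, (k <= M1)%N -> (l <= N1)%N -> s0 <= `|slope (k%:R * e) d l|) ->
  exists2 c : R, 0 < c &
  forall Ps Qs (j1 : 'I_J) n (om : 'I_n -> R[i]) (X : 'I_n -> nat -> R),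
  (forall i, (size (Ps i) <= M1.+1)%N) ->
  (forall j, (size (Qs j) <= N1.+1)%N) -> measurable_fun [set: plane] (ratio_fun Ps Qs) ->
  (exists t, om t = 0) ->
  (forall j x, root (center_poly Qs j1 nn j) x -> exists t, om t = x) ->
  (forall t, 0 < qco Qs (om t) N1) ->
  (forall t k r, (k <= M1)%N -> 0 < r <= 1 ->
     pco Ps (om t) k `^ e * profile N1 (k%:R * e) d (qco Qs (om t)) r <= X t k) ->
  (\int[mu]_(x in unit_disk) ratio_fun Ps Qs x <= (c * \sum_t \sum_(k < M1.+1) X t k)%:E)%E.
Proof.
move=> slope_nz.
pose C1 : R := J%:R * (3 ^+ N1 * (1 + 2 * nn%:R)).
have C10 : 0 < C1.
  by rewrite !mulr_gt0 ?exprn_gt0 ?ltr0n // ltr_pwDl // mulr_ge0.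
pose Cv := M1.+1%:R `^ e * (C1 * 2 ^+ N1) `^ d.
have Cv0 : 0 < Cv by rewrite mulr_gt0 // powR_gt0 ?ltr0n // mulr_gt0 // exprn_gt0.
pose Cs : R := 2 * (N1.+1%:R `^ d / (1 - 2 `^ (- s0))).
have s2 : 2 `^ (- s0) < 1 :> R.
  have : 1 `^ s0 < 2 `^ s0 :> R by apply: gt0_ltr_powR; rewrite ?nnegrE // ltr1n.
  by rewrite powR1 powRN => h; rewrite invf_lt1 ?powR_gt0.
have Cs0 : 0 < Cs by rewrite mulr_gt0 // divr_gt0 ?powR_gt0 ?ltr0n // subr_gt0.
exists (4 * (Cv * Cs)); first exact: (mulr_gt0 _ (mulr_gt0 Cv0 Cs0)).
move=> Ps Qs j1 n om X sP sQ mf [t0 om0] omroot qN HX.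
have q0 t l : 0 <= qco Qs (om t) l by exact: pco_ge0.
have p0 t k : 0 <= pco Ps (om t) k by exact: pco_ge0.
pose rho j : R := 2^-1 ^+ j.
have rho0 j : 0 < rho j by rewrite exprn_gt0 // invr_gt0.
have rho1 j : rho j <= 1 by rewrite exprn_ile1 ?invr_ge0 // invf_le1 // ler1n.
pose prof t k (j : nat) := profile N1 (k%:R * e) d (qco Qs (om t)) (rho j).
have prof0 t k j : 0 < prof t k j.
  by apply: profile_gt0.
(* A pointwise bound for the integrand, hence the area rho^2 contained in the profile is divided
   out; integration over the square restores it. *)
pose v t j := Cv * \sum_(k < M1.+1) pco Ps (om t) k `^ e * prof t k j / rho j ^+ 2.
rewrite -mulrA; apply: (@dyadic_integral_le _ _ _ n om v).
- exact: measurable_unit_disk.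
- exact: measurable_funS mf.
- by move=> x _; rewrite /ratio_fun; case: ifP => // _; rewrite lee_fin divr_ge0 ?powR_ge0.
- move=> t j; rewrite mulr_ge0 ?(ltW Cv0) // sumr_ge0 // => k _.
  by rewrite divr_ge0 ?exprn_ge0 ?(ltW (rho0 _)) // mulr_ge0 ?powR_ge0 // ltW.
- move=> x xD xom; set z := (x.1 +i* x.2)%C.
  have xz : x = topt z by case: x {xD xom} @z.
  pose t := [arg min_(t < t0) cabs (z - om t)]%O.
  have tmin s : cabs (z - om t) <= cabs (z - om s).
    by rewrite /t; case: arg_minP => // i _; apply.
  set r := cabs (z - om t) in tmin.
  have r0 : 0 < r.
    rewrite cabs_gt0 subr_eq0; apply/eqP => zt; apply: (xom t).
    by rewrite xz zt.
  (* Here 0 must be a center: it bounds the distance to the nearest one by |z| < 1. *)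
  have r1 : r <= 1.
    apply: (le_trans (tmin t0)); rewrite om0 subr0.
    have : cabs z ^+ 2 < 1 by rewrite sqr_cabs; exact: xD.
    by rewrite expr_lt1 ?cabs_ge0 // => /ltW.
  have [|j /andP[jr rj]] := @dyadic_scale r; first by rewrite r0.
  exists t, j; split; first by rewrite xz; exact: square_cabs.
  have qle := @qsum_le_euclid Qs j1 nn z (om t) sQ.
  have {qle} : qsum N1 (qco Qs (om t)) r <= C1 * Num.sqrt (\sum_j cabs2 (Qs j).[z]).
    apply: qle => j' x' /omroot[s <-]; exact: tmin.
  set S := Num.sqrt _ => qle.
  (* Rounding [r] up to the dyadic radius, which is at most 2 r, costs at most 2^N1. *)
  have qrho : qsum N1 (qco Qs (om t)) (rho j) <= 2 ^+ N1 * qsum N1 (qco Qs (om t)) r.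
    rewrite /qsum mulr_sumr; apply: ler_sum => l _; rewrite mulrCA ler_wpM2l //.
    have rr : rho j <= 2 * r.
      rewrite -ler_pdivrMl //; apply: le_trans (ltW jr).
      by rewrite exprS.
    apply: (@le_trans _ _ ((2 * r) ^+ l)).
      by rewrite lerXn2r ?nnegrE ?mulr_ge0 // ltW.
    rewrite exprMn ler_wpM2r ?exprn_ge0 ?(ltW r0) // ler_weXn2l ?ler1n //.
    by rewrite -ltnS.
  have qS : qsum N1 (qco Qs (om t)) (rho j) <= C1 * 2 ^+ N1 * S.
    apply: (le_trans qrho); rewrite mulrAC mulrC ler_wpM2r ?exprn_ge0 //.
  have qgt0 : 0 < qsum N1 (qco Qs (om t)) (rho j) by exact: qsum_gt0.
  have S_gt0 : 0 < S.
    have := lt_le_trans qgt0 qS; rewrite pmulr_rgt0 // mulr_gt0 // exprn_gt0 //.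
  have sP0 : 0 <= \sum_(i < I) cabs2 (Ps i).[z] by apply: sumr_ge0 => *; exact: cabs2_ge0.
  have sQ0 : 0 <= \sum_(j < J) cabs2 (Qs j).[z] by apply: sumr_ge0 => *; exact: cabs2_ge0.
  rewrite /ratio_fun -/z !powR_half // -/S gt_eqF ?powR_gt0 // lee_fin.
  rewrite ler_pdivrMr ?powR_gt0 //.
  have KP : Num.sqrt (\sum_(i < I) cabs2 (Ps i).[z]) `^ e <=
     M1.+1%:R `^ e * \sum_(k < M1.+1) (pco Ps (om t) k * rho j ^+ k) `^ e.
    apply: (le_trans _ (@powR_sum_le _ (fun k : 'I_M1.+1 => pco Ps (om t) k * rho j ^+ k) _ _)) => //; last first.
      by move=> k; rewrite mulr_ge0 ?exprn_ge0 // ltW.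
    apply: powR_monotone => //.
    apply: (le_trans (euclid_le_sum _)).
    rewrite -(sum_nrm_shift _ _ sP); apply: ler_sum => i _.
    exact: cabs_sub_le.
  have qd : qsum N1 (qco Qs (om t)) (rho j) `^ d <= (C1 * 2 ^+ N1) `^ d * S `^ d.
    rewrite -powRM ?(ltW S_gt0) ?mulr_ge0 ?exprn_ge0 ?(ltW C10) //.
    by apply: powR_monotone => //; exact: ltW.
  apply: (le_trans KP).
  have -> : v t j * S `^ d = M1.+1%:R `^ e * (((C1 * 2 ^+ N1) `^ d * S `^ d) *
      \sum_(k < M1.+1) pco Ps (om t) k `^ e * prof t k j / rho j ^+ 2).
    by rewrite /v /Cv; ring.
  rewrite ler_wpM2l ?powR_ge0 // mulr_sumr; apply: ler_sum => k _.
  have -> : (pco Ps (om t) k * rho j ^+ k) `^ e = qsum N1 (qco Qs (om t)) (rho j) `^ d *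
     (pco Ps (om t) k `^ e * prof t k j / rho j ^+ 2).
    rewrite (powRM _ (p0 t k) (exprn_ge0 _ (ltW (rho0 j)))) /prof /profile.
    have -> : (rho j ^+ k) `^ e = rho j `^ (k%:R * e).
      by rewrite -powR_mulrn ?(ltW (rho0 j)) // powRrM.
    have -> : rho j `^ (2 + k%:R * e) = rho j ^+ 2 * rho j `^ (k%:R * e).
      rewrite powRD; last by apply/implyP => _; rewrite gt_eqF.
      by rewrite -[in RHS]powR_mulrn ?(ltW (rho0 j)).
    by field; rewrite (gt_eqF (powR_gt0 _ qgt0)) (gt_eqF (rho0 j)).
  apply: ler_wpM2r => //.
  by rewrite divr_ge0 ?exprn_ge0 ?(ltW (rho0 _)) // mulr_ge0 ?powR_ge0 // ltW.
- move=> m; rewrite -mulrA mulr_sumr mulr_sumr; apply: ler_sum => t _.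
  have -> : \sum_(j < m) v t j * (2^-1 ^+ j) ^+ 2 =
     Cv * \sum_(k < M1.+1) (pco Ps (om t) k `^ e * \sum_(j < m) prof t k j).
    rewrite mulr_sumr; under [RHS]eq_bigr do rewrite !mulr_sumr.
    rewrite [RHS]exchange_big /=; apply: eq_bigr => j _.
    rewrite /v -mulrA mulr_suml mulr_sumr; apply: eq_bigr => k _; congr (_ * _).
    by rewrite divfK // expf_neq0 // gt_eqF.
  rewrite ler_wpM2l ?(ltW Cv0) // mulr_sumr; apply: ler_sum => k _.
  have kM : (k <= M1)%N by rewrite -ltnS.
  have [pz|pz] := eqVneq (pco Ps (om t) k `^ e) 0.
    rewrite pz mul0r mulr_ge0 ?(ltW Cs0) //.
    by apply: le_trans (HX t k 1 kM _); rewrite ?ltr01 ?lexx // pz mul0r.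
  have {}pz : 0 < pco Ps (om t) k `^ e by rewrite lt0r pz powR_ge0.
  have ke0 : 0 <= k%:R * e by rewrite mulr_ge0.
  have := @profile_dyadic_sum _ N1 (k%:R * e) d s0 d0 s00 (fun l lN => slope_nz k l kM lN) (qco Qs (om t)) (q0 t) (qN t)
    (X t k / pco Ps (om t) k `^ e).
  move=> /(_ _ m) h.
  rewrite mulrC -ler_pdivlMr //; apply: (le_trans (h _)).
    by move=> r r01; rewrite ler_pdivlMr // mulrC; exact: HX.
  by rewrite /Cs le_eqVlt; apply/orP; left; apply/eqP; ring.
Qed.

End IntegralBounds.

(** * Monomials for the maximum of the profile *)

Lemma sum_inj_le (R : realType) (I I' : finType) (h : I -> I') (F : I' -> R) :
  injective h -> (forall x, 0 <= F x) -> \sum_i F (h i) <= \sum_x F x.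
Proof.
move=> hinj F0; have -> : \sum_i F (h i) = \sum_(x in [set h i | i in [set: I]]%SET) F x.
  by rewrite big_imset /=; [apply: eq_bigl => i; rewrite inE|move=> i j _ _; exact: hinj].
rewrite [leRHS](bigID (mem [set h i | i in [set: I]]%SET)) /= lerDl.
exact: sumr_ge0.
Qed.

Section RationalProfile.
Variables (R : realType) (J N1 n0 E Dn k : nat).
Hypotheses (J0 : (0 < J)%N) (n00 : (0 < n0)%N).
Let e : R := E%:R / n0%:R.
Let d : R := Dn%:R / n0%:R.
Let a := N1`!.
Let ke : R := k%:R * e.

(** With [pslope], the positive and negative parts of the integer [n0] times the slope; truncated
    subtraction makes one of them 0. *)
Definition nslope (l : nat) : nat := (2 * n0 + k * E) - l * Dn.
Definition pslope (l : nat) : nat := l * Dn - (2 * n0 + k * E).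

Hypothesis slope_nz : forall l, (l <= N1)%N -> (l * Dn != 2 * n0 + k * E)%N.

Let n0R : 0 < n0%:R :> R. Proof. by rewrite ltr0n. Qed.

Lemma slope_natE l : n0%:R * slope ke d l = (2 * n0 + k * E)%:R - (l * Dn)%:R.
Proof. by rewrite /slope /ke /e /d natrD !natrM; field; rewrite gt_eqF. Qed.

Lemma slope_pos l : (l <= N1)%N -> (0 < slope ke d l) = (l * Dn < 2 * n0 + k * E)%N.
Proof. by move=> _; rewrite -(pmulr_rgt0 _ n0R) slope_natE subr_gt0 ltr_nat. Qed.

Lemma slope_neg l : (l <= N1)%N -> (slope ke d l < 0) = (2 * n0 + k * E < l * Dn)%N.
Proof. by move=> _; rewrite -(pmulr_rlt0 _ n0R) slope_natE subr_lt0 ltr_nat. Qed.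

(** [n0] times the slope is a nonzero integer, which turns nondegeneracy into a uniform gap. *)
Lemma slope_norm_ge l : (l <= N1)%N -> n0%:R^-1 <= `|slope ke d l|.
Proof.
move=> lN; rewrite -div1r ler_pdivrMr // mulrC -(gtr0_norm n0R) -normrM slope_natE.
case: (ltngtP (l * Dn) (2 * n0 + k * E)) (slope_nz lN) => // h _.
  by rewrite -natrB ?(ltnW h) // normr_nat ler1n subn_gt0.
by rewrite distrC -natrB ?(ltnW h) // normr_nat ler1n subn_gt0.
Qed.

Variable qq : 'I_J -> nat -> R.
Hypothesis qq0 : forall j l, 0 <= qq j l.
Let q l := \sum_j qq j l.
Hypothesis qN : 0 < q N1.

Definition entry_index : finType := ('I_N1.+1 * 'I_J + 'I_N1.+1 * 'I_N1.+1 * 'I_J * 'I_J)%type.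

(** The dual constraints on Lam in [profile_lower], raised to powers that make each of them a bound
    on Lam^(n0 a). In the pair case this divides by l' - l, and a = N1! keeps the exponents
    integral. *)
Definition entry (be : entry_index) : R :=
  match be with
  | inl lj => if (lj.1 * Dn < 2 * n0 + k * E)%N then qq lj.2 lj.1 ^+ (Dn * a) else 0
  | inr lj => let: (l, l', j, j') := lj in
      if (l * Dn < 2 * n0 + k * E)%N && (2 * n0 + k * E < l' * Dn)%N then
        qq j l ^+ (pslope l' * (a %/ (l' - l))) * qq j' l' ^+ (nslope l * (a %/ (l' - l)))
      else 0
  end.

Definition entry_sum := \sum_be entry be.

(** Expanding a power m of a sum over [j] costs J^m; the exponent dominates every m that occurs. *)
Definition entry_const : R :=
  J%:R ^+ (Dn * a + (N1 * Dn * a + (2 * n0 + k * E) * a)).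

Lemma entry_ge0 be : 0 <= entry be.
Proof.
case: be => [[l j]|[[[l l'] j] j']] /=; case: ifP => // _; rewrite ?exprn_ge0 //.
by rewrite mulr_ge0 ?exprn_ge0.
Qed.

Let q0 l : 0 <= q l. Proof. exact: sumr_ge0. Qed.
Let a0 : (0 < a)%N. Proof. exact: fact_gt0. Qed.
Let JR : 1 <= J%:R :> R. Proof. by rewrite ler1n. Qed.

Lemma positive_entry_le l : (l <= N1)%N -> (l * Dn < 2 * n0 + k * E)%N ->
  q l ^+ (Dn * a) <= entry_const * entry_sum.
Proof.
move=> lN lp; have lN' : (l < N1.+1)%N by [].
apply: (le_trans (exp_sum_le _ J0 (fun j => qq0 j l))).
apply: ler_pM; rewrite ?exprn_ge0 ?sumr_ge0 //.
- by move=> j _; rewrite exprn_ge0.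
- by rewrite ler_weXn2l // leq_addr.
pose h (j : 'I_J) : entry_index := inl (Ordinal lN', j).
rewrite (eq_bigr (fun j => entry (h j))); last by move=> j _; rewrite /= lp.
by apply: sum_inj_le => [i j [->]//|]; exact: entry_ge0.
Qed.

Lemma pair_gap l l' : (l <= N1)%N -> (l' <= N1)%N ->
  (l * Dn < 2 * n0 + k * E)%N -> (2 * n0 + k * E < l' * Dn)%N ->
  [/\ (l < l')%N, (0 < Dn)%N & (a %/ (l' - l) * (l' - l) = a)%N].
Proof.
move=> lN l'N lp l'n; have lt : (l * Dn < l' * Dn)%N by apply: ltn_trans l'n.
have Dn0 : (0 < Dn)%N by case: (Dn) lt => //; rewrite !muln0.
have ll' : (l < l')%N by rewrite -(ltn_pmul2r Dn0).
split=> //; rewrite divnK // dvdn_fact // subn_gt0 ll' /=.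
by rewrite (leq_trans (leq_subr _ _)).
Qed.

Lemma pair_entry_le l l' : (l <= N1)%N -> (l' <= N1)%N ->
  (l * Dn < 2 * n0 + k * E)%N -> (2 * n0 + k * E < l' * Dn)%N ->
  q l ^+ (pslope l' * (a %/ (l' - l))) * q l' ^+ (nslope l * (a %/ (l' - l))) <=
  entry_const * entry_sum.
Proof.
move=> lN l'N lp l'n; have lN' : (l < N1.+1)%N by []. have l'N' : (l' < N1.+1)%N by [].
have [ll' Dn0 _] := pair_gap lN l'N lp l'n.
set A := (pslope l' * _)%N; set B := (nslope l * _)%N.
have := ler_pM (exprn_ge0 A (q0 l)) (exprn_ge0 B (q0 l'))
  (exp_sum_le A J0 (fun j => qq0 j l)) (exp_sum_le B J0 (fun j => qq0 j l')).
move/le_trans; apply; rewrite mulrACA -exprD.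
apply: ler_pM; rewrite ?exprn_ge0 ?mulr_ge0 ?sumr_ge0 //.
- by move=> j _; rewrite exprn_ge0.
- by move=> j _; rewrite exprn_ge0.
- rewrite ler_weXn2l //; apply: leq_trans (leq_addl _ _); apply: leq_add.
    apply: leq_mul; last exact: leq_div.
    by rewrite /pslope (leq_trans (leq_subr _ _)) // leq_mul2r l'N orbT.
  by apply: leq_mul; [exact: leq_subr|exact: leq_div].
pose h (p : 'I_J * 'I_J) : entry_index := inr (Ordinal lN', Ordinal l'N', p.1, p.2).
rewrite big_distrlr pair_bigA /= (eq_bigr (fun p => entry (h p))); last first.
  by move=> p _; rewrite /= lp l'n.
by apply: sum_inj_le => [[i1 i2] [j1 j2] [-> ->]//|]; exact: entry_ge0.
Qed.

Let na0 : 0 < (n0 * a)%:R :> R. Proof. by rewrite ltr0n muln_gt0 n00. Qed.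

Let slope_pairE l l' : slope ke d l - slope ke d l' = (l'%:R - l%:R) * d.
Proof. by rewrite /slope; ring. Qed.

Let pairE l l' : (l <= N1)%N -> (l' <= N1)%N ->
  (l * Dn < 2 * n0 + k * E)%N -> (2 * n0 + k * E < l' * Dn)%N ->
  (q l `^ d) `^ (- slope ke d l') * (q l' `^ d) `^ slope ke d l =
  (q l ^+ (pslope l' * (a %/ (l' - l))) * q l' ^+ (nslope l * (a %/ (l' - l))))
    `^ ((l'%:R - l%:R) * d / (n0 * a)%:R).
Proof.
move=> lN l'N lp l'n; have [ll' Dn0 ga] := pair_gap lN l'N lp l'n.
rewrite powRM ?exprn_ge0 // -(powR_mulrn _ (q0 l)) -(powR_mulrn _ (q0 l')) -!powRrM.
have gR : (a %/ (l' - l))%:R * (l'%:R - l%:R) = a%:R :> R.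
  by rewrite -natrB ?(ltnW ll') // -natrM ga.
have s1 : slope ke d l = (nslope l)%:R / n0%:R.
  by rewrite /nslope natrB ?(ltnW lp) // -slope_natE mulrC mulKf // gt_eqF.
have s2 : - slope ke d l' = (pslope l')%:R / n0%:R.
  by rewrite /pslope natrB ?(ltnW l'n) // -opprB -slope_natE mulNr mulrC mulKf // gt_eqF.
have aR : a%:R != 0 :> R by rewrite pnatr_eq0 -lt0n.
have [g0 L0] : (a %/ (l' - l))%:R != 0 :> R /\ l'%:R - l%:R != 0 :> R.
  by move: aR; rewrite -gR mulf_eq0 negb_or => /andP.
have n0n : n0%:R != 0 :> R by rewrite gt_eqF.
rewrite !natrM -gR s1 s2; move: (l'%:R - l%:R) L0 {gR} => L L0.
by congr (_ `^ _ * _ `^ _); field; rewrite L0 g0 n0n.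
Qed.

Lemma profile_entry_lower (Lam : R) : 0 < Lam -> entry_const * entry_sum <= Lam ^+ (n0 * a) ->
  exists2 r : R, 0 < r <= 2^-1 & 1 <= 2 `^ (2 + ke) * N1.+1%:R `^ d * Lam * profile N1 ke d q r.
Proof.
move=> L0 HL.
have ke0 : 0 <= ke by rewrite !mulr_ge0 ?invr_ge0.
have d0 : 0 <= d by rewrite mulr_ge0 ?invr_ge0.
have s00 : 0 < n0%:R^-1 :> R by rewrite invr_gt0.
apply: (profile_lower d0 s00 slope_norm_ge q0 qN L0) => [l lN|l l' lN l'N].
  rewrite slope_pos // => lp; have := le_trans (positive_entry_le lN lp) HL => h.
  have := powR_monotone (ltW (divr_gt0 ltr01 na0)) (exprn_ge0 _ (q0 l)) h.
  rewrite -!powR_mulrn ?(ltW L0) // -!powRrM.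
  rewrite mul1r mulfV ?gt_eqF // powRr1 ?(ltW L0) //; apply: le_trans.
  rewrite le_eqVlt; apply/orP; left; apply/eqP; congr (_ `^ _).
  rewrite /d !natrM; field; rewrite pnatr_eq0 -lt0n a0 gt_eqF //.
rewrite slope_pos // slope_neg // => lp l'n; rewrite pairE // slope_pairE.
have [ll' Dn0 ga] := pair_gap lN l'N lp l'n.
have -> : Lam `^ ((l'%:R - l%:R) * d) = (Lam ^+ (n0 * a)) `^ ((l'%:R - l%:R) * d / (n0 * a)%:R).
  rewrite -(powR_mulrn (n0 * a) (ltW L0)) -powRrM; congr (_ `^ _).
  by rewrite [RHS]mulrC divfK // gt_eqF.
apply: powR_monotone; first by rewrite !mulr_ge0 ?invr_ge0 // subr_ge0 ler_nat ltnW.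
  by rewrite mulr_ge0 ?exprn_ge0.
exact: le_trans (pair_entry_le lN l'N lp l'n) HL.
Qed.

(** Some entry is at least the average [sig]. It is a single power or a pair, and weak duality, in
    [profile_le_positive] or [profile_le_pair], bounds the profile by it. *)
Lemma profile_entry_upper r : 0 < r <= 1 -> 0 < entry_sum ->
  profile N1 ke d q r <= ((entry_sum / #|entry_index|%:R) `^ ((n0 * a)%:R^-1))^-1.
Proof.
move=> r01 S0.
have ke0 : 0 <= ke by rewrite !mulr_ge0 ?invr_ge0.
have d0 : 0 <= d by rewrite mulr_ge0 ?invr_ge0.
have s00 : 0 < n0%:R^-1 :> R by rewrite invr_gt0.
have r0 : 0 < r by case/andP: r01.
have c0 : (0 < #|entry_index|)%N.
  by apply/card_gt0P; exists (inl (ord0, Ordinal J0)).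
set sig := entry_sum / _; have sig0 : 0 < sig by rewrite divr_gt0 // ltr0n.
have [be hbe] : exists be, sig <= entry be.
  apply: contrapT => /forallNP h.
  have : entry_sum < entry_sum; last by rewrite ltxx.
  have {2}-> : entry_sum = \sum_(be : entry_index) sig.
    by rewrite sumr_const -[LHS](divfK (_ : #|entry_index|%:R != 0)) ?pnatr_eq0 -?lt0n // mulr_natr.
  rewrite /entry_sum; apply: ltr_sum; last by move=> be _; rewrite ltNge; apply/negP/h.
  by apply/hasP; exists (inl (ord0, Ordinal J0)); rewrite ?mem_index_enum.
have na1 : 0 <= (n0 * a)%:R^-1 :> R by rewrite invr_ge0 ltW.
have qqle j l : qq j l <= q l by rewrite /q (bigD1 j) //= lerDl sumr_ge0.
case: be hbe => [[l j]|[[[l l'] j] j']] /=; case: ifP => [|_]; last first.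
- by move=> h; move: (lt_le_trans sig0 h); rewrite ltxx.
- move=> /andP[lp l'n] h.
  have lN : (l <= N1)%N by rewrite -ltnS. have l'N : (l' <= N1)%N by rewrite -ltnS.
  have [ll' Dn0 ga] := pair_gap lN l'N lp l'n.
  set A := (pslope l' * _)%N in h; set B := (nslope l * _)%N in h.
  have g0 : (0 < a %/ (l' - l))%N.
    by move: a0; rewrite -{1}ga muln_gt0 => /andP[].
  have A0 : (0 < A)%N by rewrite muln_gt0 g0 subn_gt0 l'n.
  have B0 : (0 < B)%N by rewrite muln_gt0 g0 subn_gt0 lp.
  have hq : sig <= q l ^+ A * q l' ^+ B.
    apply: (le_trans h); apply: ler_pM; rewrite ?exprn_ge0 //;
      by rewrite lerXn2r // nnegrE.
  have qpos : 0 < q l ^+ A * q l' ^+ B by apply: lt_le_trans hq.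
  have ql0 : 0 < q l.
    rewrite lt0r q0 andbT; apply: contraTneq qpos => ->.
    by rewrite expr0n gtn_eqF // mul0r ltxx.
  have ql'0 : 0 < q l'.
    rewrite lt0r q0 andbT; apply: contraTneq qpos => ->.
    by rewrite [X in _ * X]expr0n gtn_eqF // mulr0 ltxx.
  have sl : 0 < slope ke d l by rewrite slope_pos.
  have sl' : slope ke d l' < 0 by rewrite slope_neg.
  have := profile_le_pair d0 q0 qN r0 lN l'N sl sl' ql0 ql'0.
  rewrite pairE // slope_pairE -/A -/B.
  set u := (l'%:R - l%:R) * d => hu.
  have u0 : 0 < u by rewrite mulr_gt0 ?subr_gt0 ?ltr_nat // divr_gt0 // ltr0n.
  have p0 := profile_gt0 ke d q0 qN r0.
  have {}hu : profile N1 ke d q r `^ u <= (sig `^ (u / (n0 * a)%:R))^-1.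
    apply: (le_trans hu); rewrite lef_pV2 ?posrE ?powR_gt0 //.
    by apply: powR_monotone; rewrite ?(ltW sig0) // divr_ge0 // ltW.
  have := powR_monotone (ltW (divr_gt0 ltr01 u0)) (powR_ge0 _ _) hu.
  rewrite -powRrM div1r mulfV ?gt_eqF // powRr1 ?(ltW p0) // powR_invr ?powR_ge0 //.
  rewrite -powRrM; have -> // : u / (n0 * a)%:R / u = (n0 * a)%:R^-1 by rewrite mulrAC divff ?mul1r // gt_eqF.
- by move=> h; move: (lt_le_trans sig0 h); rewrite ltxx.
- move=> lp h; have lN : (l <= N1)%N by rewrite -ltnS.
  have hq : sig <= q l ^+ (Dn * a).
    by apply: (le_trans h); rewrite lerXn2r // nnegrE.
  have qd : sig `^ (n0 * a)%:R^-1 <= q l `^ d.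
    apply: (le_trans (powR_monotone na1 (ltW sig0) hq)).
    rewrite -powR_mulrn // -powRrM le_eqVlt; apply/orP; left; apply/eqP; congr (_ `^ _).
    by rewrite /d !natrM; field; rewrite !pnatr_eq0 -!lt0n ?a0 ?n00 ?fact_gt0.
  have qd0 : 0 < q l `^ d by apply: lt_le_trans qd; exact: powR_gt0.
  apply: (@le_trans _ _ (q l `^ d)^-1); last first.
    by rewrite lef_pV2 // posrE // powR_gt0.
  (* A zero coefficient has a positive [d]-th power only if d = 0, by the convention 0^0 = 1; the
     profile is then r^(2 + ke) <= 1. *)
  have [ql0|ql0] := eqVneq (q l) 0.
    have dE : d = 0.
      apply/eqP; move: qd0; rewrite ql0; apply: contraTT => dn.
      by rewrite powR0 // ltxx.
    rewrite /profile dE !powRr0 invr1 mulr1.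
    have : r `^ (2 + ke) <= 1 `^ (2 + ke) by apply: powR_monotone; rewrite ?addr_ge0 ?(ltW r0) //; case/andP: r01.
    by rewrite powR1.
  apply: profile_le_positive => //; first by rewrite slope_pos.
  by rewrite lt0r ql0 q0.
Qed.

End RationalProfile.

(** * The centers *)

Section GenericPolynomials.
Context {R : realType} {I J : nat} {M : 'I_I -> nat} {N : 'I_J -> nat}.
Notation A := {mpoly int[#|Idx M N|]}.
Implicit Types b : Idx M N -> R[i].

Definition PZ (i : 'I_I) : {poly A} :=
  \sum_(mu < (M i).+1) 'X_(enum_rank (inl (existT _ i mu) : Idx M N)) *: 'X^mu.
Definition QZ (j : 'I_J) : {poly A} :=
  \sum_(nu < (N j).+1) 'X_(enum_rank (inr (existT _ j nu) : Idx M N)) *: 'X^nu.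

Lemma ev_var b k : ev b 'X_(enum_rank k) = b k.
Proof. by rewrite /ev /= mmapX mmap1U /bpoint enum_rankK. Qed.

Lemma map_PZ b i : map_poly (ev b) (PZ i) = \sum_(mu < (M i).+1) bP b mu *: 'X^mu.
Proof.
rewrite /PZ rmorph_sum /=; apply: eq_bigr => mu _.
by rewrite map_polyZ map_polyXn ev_var.
Qed.

Lemma map_QZ b j : map_poly (ev b) (QZ j) = \sum_(nu < (N j).+1) bQ b nu *: 'X^nu.
Proof.
rewrite /QZ rmorph_sum /=; apply: eq_bigr => mu _.
by rewrite map_polyZ map_polyXn ev_var.
Qed.

Lemma size_sum_monomials (S : nzRingType) n (c : 'I_n -> S) :
  (size (\sum_(m < n) c m *: 'X^m)%R <= n)%N.
Proof.
apply: (leq_trans (size_sum _ _ _)); apply/bigmax_leqP => m _.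
by rewrite (leq_trans (size_scale_leq _ _)) // size_polyXn.
Qed.

Lemma coef_sum_monomials (S : nzRingType) n (c : 'I_n -> S) (m : 'I_n) :
  (\sum_(k < n) c k *: 'X^k)`_m = c m.
Proof.
rewrite coef_sum (bigD1 m) //= coefZ coefXn eqxx mulr1 big1 ?addr0 // => k km.
by rewrite coefZ coefXn eq_sym (inj_eq val_inj) (negbTE km) mulr0.
Qed.

Lemma horner_PZ b i z : (map_poly (ev b) (PZ i)).[z] = Pb b i z.
Proof. by rewrite map_PZ horner_sum; apply: eq_bigr => mu _; rewrite !hornerE. Qed.

Lemma horner_QZ b j z : (map_poly (ev b) (QZ j)).[z] = Qb b j z.
Proof. by rewrite map_QZ horner_sum; apply: eq_bigr => mu _; rewrite !hornerE. Qed.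

Lemma size_map_PZ b i : (size (map_poly (ev b) (PZ i)) <= (M i).+1)%N.
Proof. by rewrite map_PZ size_sum_monomials. Qed.

Lemma size_map_QZ b j : (size (map_poly (ev b) (QZ j)) <= (N j).+1)%N.
Proof. by rewrite map_QZ size_sum_monomials. Qed.

Lemma nrm_map_QZ b j : nrm 1 (map_poly (ev b) (QZ j)) = norm3Q b j.
Proof.
rewrite (nrmE _ (size_map_QZ b j)); apply: eq_bigr => nu _.
by rewrite map_QZ coef_sum_monomials expr1n mulr1.
Qed.

Lemma nrm_map_QZ1 b j : nrm 1 (map_poly (ev b) (QZ j) - 'X^(N j)) = norm3Q1 b j.
Proof.
rewrite (@nrmE _ _ _ (N j).+1); last first.
  by rewrite (leq_trans (size_polyD _ _)) // geq_max size_map_QZ size_polyN size_polyXn /=.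
apply: eq_bigr => nu _.
by rewrite coefB map_QZ coef_sum_monomials coefXn expr1n mulr1.
Qed.

Definition center_polyZ (j1 : 'I_J) (nn : nat) (j : 'I_J) : {poly A} :=
  if j == j1 then QZ j1 else nn%:R *: QZ j1 + QZ j.

Definition centersZ (j1 : 'I_J) (nn : nat) : {poly A} := 'X * \prod_j center_polyZ j1 nn j.

Lemma map_center_polyZ b j1 nn j :
  map_poly (ev b) (center_polyZ j1 nn j) = center_poly (fun j => map_poly (ev b) (QZ j)) j1 nn j.
Proof.
rewrite /center_polyZ /center_poly; case: ifP => // _.
by rewrite rmorphD /= map_polyZ rmorph_nat.
Qed.

Lemma map_centersZ b j1 nn : map_poly (ev b) (centersZ j1 nn) =
  'X * \prod_j center_poly (fun j => map_poly (ev b) (QZ j)) j1 nn j.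
Proof.
rewrite /centersZ rmorphM /= map_polyX rmorph_prod; congr (_ * _).
by apply: eq_bigr => j _; exact: map_center_polyZ.
Qed.

End GenericPolynomials.

(** * Number and location of the centers *)

Section RootLocalisation.
Context {R : realType} {J : nat}.
Variables (Qs : 'I_J -> {poly R[i]}) (j1 : 'I_J) (nn N1 : nat) (C : R).
Let s : R := 2^-1 ^+ N1.+1.
Hypotheses (C0 : 0 < C) (Cnn : C <= nn%:R * s).
Hypothesis sQ : forall j, (size (Qs j) <= N1.+1)%N.
Hypothesis Q1near : nrm 1 (Qs j1 - 'X^N1) < s.
Hypothesis Qbound : forall j, j != j1 -> nrm 1 (Qs j) < C.

Let s0 : 0 < s. Proof. by rewrite exprn_gt0 // invr_gt0. Qed.
Let s2 : s <= 2^-1.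
Proof. by rewrite /s exprS ler_piMr ?invr_ge0 // exprn_ile1 ?invr_ge0 // invf_le1 // ler1n. Qed.

Lemma lead_near : 1 - s < cabs (Qs j1)`_N1.
Proof.
have h := cabs_coef_le (Qs j1 - 'X^N1) N1 (@ler01 R).
rewrite expr1n mulr1 coefB coefXn eqxx in h.
have := le_lt_trans h Q1near; rewrite cabsBC => h1.
have := cabsD (1 - (Qs j1)`_N1) (Qs j1)`_N1; rewrite subrK cabs1.
by move: h1; set u := cabs _; set v := cabs _; lra.
Qed.

(** The leading coefficient of n Q_1 has modulus at least n s >= C and cannot be cancelled by that
    of Q_j. The exact degree fixes the number of centers independently of [b]. *)
Lemma size_center_poly j : size (center_poly Qs j1 nn j) = N1.+1.
Proof.
have ls := lead_near.
have le : (size (center_poly Qs j1 nn j) <= N1.+1)%N.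
  rewrite /center_poly; case: ifP => // _; rewrite (leq_trans (size_polyD _ _)) // geq_max sQ andbT.
  by rewrite (leq_trans (size_scale_leq _ _)).
apply/eqP; rewrite eqn_leq le /=; rewrite ltnNge; apply/negP => h.
have : (center_poly Qs j1 nn j)`_N1 = 0 by rewrite nth_default.
rewrite /center_poly; case: (eqVneq j j1) => [_ h1|jj].
  by move: ls; rewrite h1 cabs0; move: s2; lra.
rewrite coefD coefZ => /eqP; rewrite addr_eq0 => /eqP E.
have := congr1 cabs E; rewrite cabsM cabs_nat cabsN => {}E.
have := cabs_coef_le (Qs j) N1 (@ler01 R); rewrite expr1n mulr1 -E => h1.
have := le_lt_trans h1 (Qbound jj); apply/negP; rewrite -leNgt.
apply: (le_trans Cnn); rewrite ler_wpM2l //; apply: le_trans (ltW ls).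
by move: s2; lra.
Qed.

(** Let |x| > 1/2 and m = max(1, |x|)^N1. Then |x|^N1 >= 2 s m, and the perturbation of Q_1 is below
    s m, so |Q_1(x)| > s m. Therefore |n Q_1(x)| >= C m > |Q_j(x)|, and no factor vanishes at x. *)
Lemma center_poly_root_le j x : root (center_poly Qs j1 nn j) x -> cabs x <= 2^-1.
Proof.
move=> xr; rewrite leNgt; apply/negP => xh.
pose rho := Num.max 1 (cabs x); pose m := rho ^+ N1.
have rho1 : 1 <= rho by rewrite le_max lexx.
have m1 : 1 <= m by rewrite exprn_ege1.
have m0 : 0 < m by apply: lt_le_trans m1.
have xrho : cabs x <= rho by rewrite le_max lexx orbT.
have bnd (p : {poly R[i]}) : (size p <= N1.+1)%N -> cabs p.[x] <= m * nrm 1 p.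
  move=> sp; apply: (le_trans (cabs_horner_le p xrho)).
  rewrite /nrm mulr_sumr; apply: ler_sum => i _.
  rewrite expr1n mulr1 mulrC ler_wpM2r ?cabs_ge0 // ler_weXn2l //.
  by rewrite -ltnS (leq_trans (ltn_ord i)).
have xm : 2 * s * m <= cabs x ^+ N1.
  have -> : 2 * s = 2^-1 ^+ N1 by rewrite /s exprS mulrA divff ?mul1r.
  rewrite -exprMn lerXn2r ?nnegrE ?cabs_ge0 ?mulr_ge0 ?invr_ge0 ?(le_trans _ rho1) //.
  rewrite ler_pdivrMl // ge_max; apply/andP; split; last by have := cabs_ge0 x; lra.
  by move: xh; lra.
have Q1x : s * m < cabs (Qs j1).[x].
  have h1 : cabs (Qs j1 - 'X^N1).[x] < m * s.
    apply: le_lt_trans (bnd _ _) _; last by rewrite ltr_pM2l.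
    by rewrite (leq_trans (size_polyD _ _)) // geq_max sQ size_polyN size_polyXn /=.
  have h2 : cabs (x ^+ N1) <= cabs (Qs j1).[x] + cabs (Qs j1 - 'X^N1).[x].
    have {1}-> : x ^+ N1 = (Qs j1).[x] - (Qs j1 - 'X^N1).[x] by rewrite !hornerE; ring.
    exact: cabsB.
  move: h2 h1 xm; rewrite cabsX; set u := cabs _; set v := cabs _; set w := _ ^+ _.
  by rewrite [m * s]mulrC -mulrA; lra.
move: xr; rewrite /root /center_poly; case: (eqVneq j j1) => [_ /eqP h|jj].
  by move: Q1x; rewrite h cabs0; have := mulr_gt0 s0 m0; lra.
rewrite hornerD hornerZ addr_eq0 => /eqP E.
have := congr1 cabs E; rewrite cabsM cabs_nat cabsN => {}E.
have h1 : cabs (Qs j).[x] < m * C.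
  by apply: le_lt_trans (bnd _ (sQ j)) _; rewrite ltr_pM2l // Qbound.
move: h1; rewrite -E; apply/negP; rewrite -leNgt.
apply: (@le_trans _ _ (nn%:R * (s * m))); last by rewrite ler_wpM2l // ltW.
have -> : nn%:R * (s * m) = m * (nn%:R * s) by ring.
by rewrite ler_wpM2l // ltW.
Qed.

Lemma center_roots : exists om : (1 + J * N1).-tuple R[i],
  let W := 'X * \prod_j center_poly Qs j1 nn j in
  [/\ W`_(1 + J * N1) != 0,
      W = W`_(1 + J * N1) *: \prod_(c <- om) ('X - c%:P),
      exists t, tnth om t = 0,
      forall j x, root (center_poly Qs j1 nn j) x -> exists t, tnth om t = x &
      forall t, cabs (tnth om t) <= 2^-1].
Proof.
pose W := 'X * \prod_j center_poly Qs j1 nn j.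
have cp0 j : center_poly Qs j1 nn j != 0.
  by rewrite -size_poly_eq0 size_center_poly.
have pr0 : \prod_j center_poly Qs j1 nn j != 0.
  by apply/prodf_neq0 => j _.
have W0 : W != 0 by rewrite mulf_neq0 ?polyX_eq0.
have sW : size W = (1 + J * N1).+1.
  rewrite /W mulrC size_mulX // size_prod //=.
  rewrite (eq_bigr (fun=> N1.+1)); last by move=> j _; rewrite size_center_poly.
  by rewrite sum_nat_const card_ord mulnS; lia.
have lW : W`_(1 + J * N1) = lead_coef W by rewrite /lead_coef sW.
have [rs rsE] := closed_field_poly_normal W.
have srs : size rs == (1 + J * N1)%N.
  rewrite -eqSS -sW {1}rsE size_scale ?lead_coef_eq0 //.
  by rewrite -(big_map id xpredT (fun c => 'X - c%:P)) map_id size_prod_XsubC.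
have rootW x : root W x -> exists t, tnth (Tuple srs) t = x.
  rewrite rsE rootZ ?lead_coef_eq0 // -(big_map id xpredT (fun c => 'X - c%:P)) map_id root_prod_XsubC.
  by move=> xrs; have /tnthP[t ->] : x \in Tuple srs by []; exists t.
exists (Tuple srs); rewrite -/W; split.
- by rewrite lW lead_coef_eq0.
- by rewrite lW {1}rsE.
- by apply: rootW; rewrite /W rootM rootX eqxx.
- move=> j x jx; apply: rootW; rewrite /W rootM; apply/orP; right.
  by rewrite (bigD1 j) //= rootM jx.
- move=> t; have : root W (tnth (Tuple srs) t).
    rewrite rsE rootZ ?lead_coef_eq0 // -(big_map id xpredT (fun c => 'X - c%:P)) map_id root_prod_XsubC.
    exact: mem_tnth.
  rewrite /W rootM rootX => /orP[/eqP ->|]; first by rewrite cabs0 invr_ge0.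
  rewrite /root horner_prod prodf_seq_eq0 => /hasP[j _ /= jx].
  exact: (center_poly_root_le jx).
Qed.

End RootLocalisation.

(** * The integral as a power of the largest ratio *)

Section IntegralRatio.
Variables (R : realType) (I J M1 N1 n0 E Dn nn n : nat).
Hypotheses (I0 : (0 < I)%N) (J0 : (0 < J)%N) (n00 : (0 < n0)%N).
Let e : R := E%:R / n0%:R.
Let d : R := Dn%:R / n0%:R.
Let a := N1`!.
Hypothesis slope_nz : forall k l, (k <= M1)%N -> (l <= N1)%N -> (l * Dn != 2 * n0 + k * E)%N.
Notation plane := (measurableTypeR R * measurableTypeR R)%type.
Let mu := (@lebesgue_measure R \x @lebesgue_measure R)%E.

(** Its power 1/(n0 a) is comparable to p_k^ε; likewise that of [den_sum] is comparable to the
    inverse of the supremum of the profile. *)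
Definition num_sum (Ps : 'I_I -> {poly R[i]}) om k : R := \sum_i cabs (Ps i)^`N(k).[om] ^+ (E * a).
Definition den_sum (Qs : 'I_J -> {poly R[i]}) om k : R :=
  entry_sum N1 n0 E Dn k (fun j l => cabs (Qs j)^`N(l).[om]).

Let th : R := (n0 * a)%:R^-1.
Let na_gt0 : 0 < (n0 * a)%:R :> R. Proof. by rewrite ltr0n muln_gt0 n00 fact_gt0. Qed.
Let th0 : 0 < th. Proof. by rewrite invr_gt0. Qed.
Let e0 : 0 <= e. Proof. by rewrite divr_ge0. Qed.
Let d0 : 0 <= d. Proof. by rewrite divr_ge0. Qed.

Lemma num_sum_ge0 Ps om k : 0 <= num_sum Ps om k.
Proof. by apply: sumr_ge0 => i _; rewrite exprn_ge0 ?cabs_ge0. Qed.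

Lemma den_sum_ge0 Qs om k : 0 <= den_sum Qs om k.
Proof. by apply: sumr_ge0 => be _; apply: entry_ge0 => j l; exact: cabs_ge0. Qed.

Let powE (x : R) : 0 <= x -> x `^ e = (x ^+ (E * a)) `^ th.
Proof.
move=> x0; rewrite -powR_mulrn // -powRrM; congr (_ `^ _).
rewrite /e /th !natrM; field.
by rewrite !pnatr_eq0 -!lt0n ?n00 fact_gt0.
Qed.

Lemma pco_le_num Ps om k : pco Ps om k `^ e <= I%:R `^ e * num_sum Ps om k `^ th.
Proof.
have p0 : 0 <= pco Ps om k := pco_ge0 _ _ _.
rewrite (powE p0) (@powE I%:R) // -powRM ?exprn_ge0 ?num_sum_ge0 //.
apply: powR_monotone; rewrite ?exprn_ge0 ?(ltW th0) //.
by apply: exp_sum_le => // i; exact: cabs_ge0.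
Qed.

Lemma num_le_pco Ps om k : (num_sum Ps om k / I%:R) `^ th <= pco Ps om k `^ e.
Proof.
have p0 : 0 <= pco Ps om k := pco_ge0 _ _ _.
rewrite (powE p0); apply: powR_monotone; rewrite ?(ltW th0) ?divr_ge0 ?num_sum_ge0 //.
rewrite ler_pdivrMr ?ltr0n // mulrC.
by apply: sum_exp_le => i; exact: cabs_ge0.
Qed.

(** The sum X is comparable to its largest term: the lower bound uses the center and order attaining
    it, the upper bound adds up all of them. Polynomials enter only through their degrees and the
    centers, so the constants are uniform. *)
Lemma integral_ratio_bounds : exists c1 c2 : R, [/\ 0 < c1, 0 < c2 &
  forall (Ps : 'I_I -> {poly R[i]}) (Qs : 'I_J -> {poly R[i]}) (j1 : 'I_J) (om : 'I_n -> R[i]),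
  (forall i, (size (Ps i) <= M1.+1)%N) -> (forall j, (size (Qs j) <= N1.+1)%N) ->
  measurable_fun [set: plane] (ratio_fun e d Ps Qs) ->
  (exists t, om t = 0) ->
  (forall j x, root (center_poly Qs j1 nn j) x -> exists t, om t = x) ->
  (forall t, cabs (om t) <= 2^-1) -> (forall t, 0 < qco Qs (om t) N1) ->
  let v := (\int[mu]_(x in unit_disk) ratio_fun e d Ps Qs x)%E in
  ((exists t, exists2 k, (k <= M1)%N & num_sum Ps (om t) k != 0 /\ den_sum Qs (om t) k = 0) ->
    v = +oo%E) /\
  ((forall t (k : 'I_M1.+1), num_sum Ps (om t) k != 0 -> den_sum Qs (om t) k != 0) ->
   let X := \sum_(i : 'I_n * 'I_M1.+1) num_sum Ps (om i.1) i.2 / den_sum Qs (om i.1) i.2 in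
   ((c1 * X `^ th)%:E <= v)%E /\ (v <= (c2 * X `^ th)%:E)%E)].
Proof.
have [cl cl0 Hl] := @integral_lower R I J M1 N1 e d I0 e0 d0.
have s00 : 0 < n0%:R^-1 :> R by rewrite invr_gt0 ltr0n.
have snz k l : (k <= M1)%N -> (l <= N1)%N -> n0%:R^-1 <= `|slope (k%:R * e) d l|.
  by move=> kM lN; apply: (@slope_norm_ge R N1 n0 E Dn k) => // l' l'N; exact: slope_nz.
have [cu cu0 Hu] := @integral_upper R I J M1 N1 e d n0%:R^-1 J0 e0 d0 s00 nn snz.
pose ec := entry_const R J N1 n0 E Dn.
pose B : R := 2 `^ (2 + M1%:R * e) * N1.+1%:R `^ d.
have B0 : 0 < B by rewrite mulr_gt0 // powR_gt0 // ltr0n.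
pose card : R := #|entry_index J N1|%:R.
have card0 : 0 < card.
  rewrite ltr0n; apply/card_gt0P.
  by exists (inl (ord0, Ordinal J0)).
(* One more than the number of pairs: this makes the averaging inequality strict and avoids a
   separate case n = 0. *)
pose ni : R := (n * M1.+1).+1%:R.
have ni0 : 0 < ni by rewrite ltr0n.
have IR : 0 < I%:R :> R by rewrite ltr0n.
pose C' := I%:R `^ e * card `^ th.
have C'0 : 0 < C' by rewrite mulr_gt0 // powR_gt0.
have ecM k (kM : (k <= M1)%N) : entry_const R J N1 n0 E Dn k <= entry_const R J N1 n0 E Dn M1.
  rewrite /entry_const ler_weXn2l ?ler1n // !leq_add2l leq_mul2r leq_add2l leq_mul2r kM.
  by rewrite !orbT.
have ec0 : 0 < ec M1 by rewrite exprn_gt0 // ltr0n.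
exists (cl / B / (I%:R * ec M1 * ni) `^ th), (cu * C' * ni); split.
- exact: (divr_gt0 (divr_gt0 cl0 B0) (powR_gt0 _ (mulr_gt0 (mulr_gt0 IR ec0) ni0))).
- exact: (mulr_gt0 (mulr_gt0 cu0 C'0) ni0).
move=> Ps Qs j1 om sP sQ mf om0 omroot om2 qN v.
have low t k (Lam : R) : (k <= M1)%N -> 0 < Lam -> ec M1 * den_sum Qs (om t) k <= Lam ^+ (n0 * a) ->
    ((cl / B * ((num_sum Ps (om t) k / I%:R) `^ th / Lam))%:E <= v)%E.
  move=> kM L0 hL.
  have hL' : entry_const R J N1 n0 E Dn k * den_sum Qs (om t) k <= Lam ^+ (n0 * a).
    by apply: le_trans hL; rewrite ler_wpM2r ?den_sum_ge0 // ecM.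
  have [r /andP[r0 r2] hr] := @profile_entry_lower R J N1 n0 E Dn k J0 n00 (fun l lN => slope_nz kM lN)
    (fun j l => cabs (Qs j)^`N(l).[om t]) (fun j l => cabs_ge0 _) (qN t) Lam L0 hL'.
  have r02 : 0 < r <= 2^-1 by rewrite r0.
  apply: le_trans (Hl Ps Qs (om t) r k sP sQ mf (om2 t) r02 kM (qN t)).
  rewrite lee_fin -mulrA ler_wpM2l ?(ltW cl0) // ler_pdivrMl //.
  rewrite ler_pdivrMr //.
  set pr := profile _ _ _ _ _.
  have pr0 : 0 < pr by apply: profile_gt0 => // l; exact: pco_ge0.
  have -> : B * (pco Ps (om t) k `^ e * pr) * Lam = pco Ps (om t) k `^ e * (B * Lam * pr) by ring.
  apply: (le_trans (num_le_pco _ _ _)); rewrite ler_peMr ?powR_ge0 //.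
  apply: (le_trans hr); rewrite -/pr ler_wpM2r ?(ltW pr0) // ler_wpM2r ?(ltW L0) //.
  rewrite /B ler_wpM2r ?powR_ge0 // ler_powR ?ler1n // lerD2l ler_wpM2r //.
  by rewrite ler_nat.
split.
  move=> [t [k kM [f0 g0]]]; apply/eqyP => A A0.
  have f1 : 0 < num_sum Ps (om t) k by rewrite lt0r f0 num_sum_ge0.
  (* With a vanishing denominator any positive Lam is admissible; Lam = Y/A makes the lower bound
     equal to the arbitrary A. *)
  pose Y := cl / B * (num_sum Ps (om t) k / I%:R) `^ th.
  have Y0 : 0 < Y by rewrite mulr_gt0 ?divr_gt0 // powR_gt0 // divr_gt0.
  have := low t k (Y / A) kM (divr_gt0 Y0 A0).
  rewrite g0 mulr0 exprn_ge0 ?divr_ge0 ?(ltW Y0) ?(ltW A0) // => /(_ isT).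
  rewrite mulrA -/Y; have -> // : Y / (Y / A) = A by field; rewrite !gt_eqF.
move=> fg X.
pose x (i : 'I_n * 'I_M1.+1) := num_sum Ps (om i.1) i.2 / den_sum Qs (om i.1) i.2.
have x0 i : 0 <= x i by rewrite divr_ge0 ?num_sum_ge0 ?den_sum_ge0.
have X0 : 0 <= X by apply: sumr_ge0 => i _; exact: x0.
split.
  have [XE|Xn] := eqVneq X 0.
    rewrite XE powR0 ?gt_eqF // mulr0.
    apply: integral_ge0 => y _; rewrite /ratio_fun; case: ifP => // _.
    by rewrite lee_fin divr_ge0 ?powR_ge0.
  have Xpos : 0 < X by rewrite lt0r Xn.
  have [i hi] : exists i, X <= ni * x i.
    apply: contrapT => /forallNP h.
    have : X < X; last by rewrite ltxx.
    apply: (@le_lt_trans _ _ (\sum_(i : 'I_n * 'I_M1.+1) X / ni)).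
      apply: ler_sum => i _; rewrite ler_pdivlMr // mulrC.
      by move: (h i) => /negP; rewrite -ltNge => /ltW.
    rewrite sumr_const card_prod !card_ord -mulr_natr mulrAC ltr_pdivrMr //.
    by rewrite ltr_pM2l // ltr_nat.
  have xi0 : 0 < x i by rewrite -(pmulr_rgt0 _ ni0) (lt_le_trans Xpos).
  have f1 : 0 < num_sum Ps (om i.1) i.2.
    by rewrite lt0r num_sum_ge0 andbT; apply: contraTneq xi0 => h; rewrite /x h mul0r ltxx.
  have g1 : 0 < den_sum Qs (om i.1) i.2.
    by rewrite lt0r den_sum_ge0 andbT fg // gt_eqF.
  have L0 : 0 < (ec M1 * den_sum Qs (om i.1) i.2) `^ th by rewrite powR_gt0 // mulr_gt0.
  have kM : (i.2 <= M1)%N by rewrite -ltnS.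
  have := low i.1 i.2 _ kM L0.
  rewrite -powR_mulrn ?(ltW L0) // -powRrM mulVf ?gt_eqF // powRr1 ?mulr_ge0 ?(ltW ec0) ?(ltW g1) //.
  move=> /(_ (lexx _)); apply: le_trans; rewrite lee_fin -mulrA.
  rewrite ler_wpM2l ?divr_ge0 ?(ltW cl0) ?(ltW B0) //.
  set g := den_sum _ _ _ in g1 *; set f := num_sum _ _ _ in f1 *.
  have K0 : 0 < I%:R * ec M1 * ni by rewrite (mulr_gt0 (mulr_gt0 IR ec0) ni0).
  have eg0 : 0 < ec M1 * g by rewrite mulr_gt0.
  have fI0 : 0 < f / I%:R by rewrite divr_gt0.
  rewrite -!powR_invr ?(ltW K0) ?(ltW eg0) // -!powRM ?invr_ge0 ?(ltW K0) ?(ltW eg0) ?(ltW fI0) //.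
  apply: powR_monotone; rewrite ?(ltW th0) ?mulr_ge0 ?invr_ge0 ?(ltW K0) //.
  rewrite mulrC ler_pdivrMr //; apply: (le_trans hi).
  rewrite /x -/f -/g le_eqVlt; apply/orP; left; apply/eqP; field.
  by rewrite (gt_eqF g1) (gt_eqF ec0) (gt_eqF IR).
pose Xu (t : 'I_n) (k : nat) : R := C' * (num_sum Ps (om t) k / den_sum Qs (om t) k) `^ th.
have := Hu Ps Qs j1 n om Xu sP sQ mf om0 omroot qN; rewrite -/v => hv.
apply: le_trans (hv _) _; last first.
  rewrite lee_fin (_ : cu * C' * ni * X `^ th = cu * (C' * (ni * X `^ th))); last by ring.
  rewrite ler_wpM2l ?(ltW cu0) // pair_bigA /= /Xu -mulr_sumr ler_wpM2l ?(ltW C'0) //.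
  apply: (@le_trans _ _ (\sum_(i : 'I_n * 'I_M1.+1) X `^ th)).
    apply: ler_sum => i _; apply: powR_monotone; rewrite ?(ltW th0) //; first exact: x0.
    by rewrite /X (bigD1 i) //= lerDl sumr_ge0 // => j _; exact: x0.
  rewrite sumr_const card_prod !card_ord -mulr_natl ler_wpM2r ?powR_ge0 //.
  by rewrite ler_nat.
move=> t k r kM r01.
have kM' : (k < M1.+1)%N by [].
have p0 : 0 < profile N1 (k%:R * e) d (qco Qs (om t)) r.
  by apply: profile_gt0 => //; [move=> l; exact: pco_ge0|case/andP: r01].
(* A zero denominator occurs only with a zero numerator, and then p_k^ε itself is 0. *)
have [g0|gn] := eqVneq (den_sum Qs (om t) k) 0.
  have f0 : num_sum Ps (om t) k = 0.
    apply/eqP; apply: contraT => /(fg t (Ordinal kM')) /=.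
    by rewrite g0 eqxx.
  have := pco_le_num Ps (om t) k; rewrite f0 powR0 ?gt_eqF // mulr0 => h.
  have -> : pco Ps (om t) k `^ e = 0 by apply/eqP; rewrite eq_le h powR_ge0.
  by rewrite mul0r mulr_ge0 ?powR_ge0 // ltW.
have g1 : 0 < den_sum Qs (om t) k by rewrite lt0r gn den_sum_ge0.
have hp := @profile_entry_upper R J N1 n0 E Dn k J0 n00
    (fun j l => cabs (Qs j)^`N(l).[om t]) (fun j l => cabs_ge0 _) (qN t) r r01 g1.
apply: (le_trans (ler_pM (powR_ge0 _ _) (ltW p0) (pco_le_num _ _ _) hp)).
rewrite -/th -/(den_sum Qs (om t) k) -/card /Xu /C'.
rewrite !powRM ?invr_ge0 ?num_sum_ge0 ?(ltW g1) ?(ltW card0) // !powR_invr ?(ltW g1) ?(ltW card0) //.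
rewrite le_eqVlt; apply/orP; left; apply/eqP; field.
by rewrite !gt_eqF ?powR_gt0.
Qed.

End IntegralRatio.

Lemma common_denominator (eps del : rat) : 0 <= eps -> 0 <= del ->
  exists n0 E Dn : nat, [/\ (0 < n0)%N, eps = E%:R / n0%:R & del = Dn%:R / n0%:R].
Proof.
have nonneg (x : rat) : 0 <= x -> exists p q : nat, (0 < q)%N /\ x = p%:R / q%:R.
  move=> x0; exists `|numq x|%N, `|denq x|%N; split; first by rewrite absz_gt0 denq_neq0.
  by rewrite !natr_absz ger0_norm ?numq_ge0 // gtr0_norm ?denq_gt0 // divq_num_den.
move=> /nonneg[p [q [q0 ->]]] /nonneg[p' [q' [q'0 ->]]].
exists (q * q')%N, (p * q')%N, (p' * q)%N; split; first by rewrite muln_gt0 q0.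
  by rewrite !natrM; field; rewrite !pnatr_eq0 -!lt0n q0 q'0.
by rewrite !natrM; field; rewrite !pnatr_eq0 -!lt0n q0 q'0.
Qed.

Lemma sum_nth_enum (V : nmodType) (S : nzRingType) (T : finType) (F : T -> {poly S}) (phi : {poly S} -> V) :
  \sum_(j < #|T|) phi (nth 0 [seq F i | i <- enum T] j) = \sum_i phi (F i).
Proof.
rewrite -[RHS]big_enum /= -(big_map F xpredT phi) (big_nth 0) big_mkord size_map -cardE.
by [].
Qed.

Lemma size_nth_bound (S : nzRingType) n (s : 'I_n -> seq {poly S}) :
  exists d, forall k j, (size (nth 0%R (s k) j) <= d)%N.
Proof.
exists (\max_(k < n) \max_(p <- s k) size p)%N => k j.
apply: leq_trans (leq_bigmax k).
have [jk|kj] := ltnP j (size (s k)); last by rewrite nth_default ?size_poly0.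
by apply: leq_bigmax_seq => //; exact: mem_nth.
Qed.

(** * Application to the coefficient space *)

Section Main.
Context {R : realType} {I J : nat} {M : 'I_I -> nat} {N : 'I_J -> nat}.
Notation A := {mpoly int[#|Idx M N|]}.
Variables (eps del : rat) (j1 : 'I_J) (n0 E Dn nn : nat) (C : R).
Let N1 := N j1.
Let M1 := (\max_(i < I) M i)%N.
Let s : R := 2^-1 ^+ N1.+1.
Hypotheses (I0 : (0 < I)%N) (n00 : (0 < n0)%N).
Hypotheses (epsE : eps = E%:R / n0%:R) (delE : del = Dn%:R / n0%:R).
Hypothesis NN1 : forall j, (N j <= N1)%N.
Hypotheses (C0 : 0 < C) (Cnn : C <= nn%:R * s).
Hypothesis slope_nz : forall k l, (k <= M1)%N -> (l <= N1)%N -> (l * Dn != 2 * n0 + k * E)%N.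
Let a := N1`!.
Let J0 : (0 < J)%N. Proof. by case: (J) j1 => [[]|]. Qed.

Definition good : set (Idx M N -> R[i]) :=
  [set b | norm3Q1 b j1 < s /\ forall j, j != j1 -> norm3Q b j < C].

Let Fp (k : nat) (i : 'I_I) : {poly A} := (PZ i)^`N(k) ^+ (E * a).

(** The same monomials as in [entry], before moduli are taken and with the Taylor coefficients left
    as polynomials in the center. *)
Let Gp (k : nat) (be : entry_index J N1) : {poly A} :=
  match be with
  | inl lj => if (lj.1 * Dn < 2 * n0 + k * E)%N then (QZ lj.2)^`N(lj.1) ^+ (Dn * a) else 0
  | inr lj => let: (l, l', j, j') := lj in
      if (l * Dn < 2 * n0 + k * E)%N && (2 * n0 + k * E < l' * Dn)%N then
        (QZ j)^`N(l) ^+ (pslope n0 E Dn k l' * (a %/ (l' - l))) *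
        (QZ j')^`N(l') ^+ (nslope n0 E Dn k l * (a %/ (l' - l)))
      else 0
  end.

Let horner_Fp b k i z : cabs (map_poly (ev b) (Fp k i)).[z] =
  cabs (map_poly (ev b) (PZ i))^`N(k).[z] ^+ (E * a) :> R.
Proof. by rewrite /Fp rmorphXn /= horner_exp cabsX nderivn_map. Qed.

Let horner_Gp b k be z : cabs (map_poly (ev b) (Gp k be)).[z] =
  entry n0 E Dn k (fun j l => cabs (map_poly (ev b) (QZ j))^`N(l).[z]) be :> R.
Proof.
case: be => [[l j]|[[[l l'] j] j']] /=; case: ifP => _; rewrite ?rmorph0 ?horner0 ?cabs0 //.
  by rewrite rmorphXn /= horner_exp cabsX nderivn_map.
by rewrite rmorphM /= !rmorphXn /= hornerM !horner_exp cabsM !cabsX !nderivn_map.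
Qed.

Lemma Rb_ratio_fun (b : Idx M N -> R[i]) (x : R * R) : Rb eps del b (x.1 +i* x.2)%C =
  ratio_fun (E%:R / n0%:R) (Dn%:R / n0%:R) (fun i => map_poly (ev b) (PZ i))
      (fun j => map_poly (ev b) (QZ j)) x.
Proof.
have [eE dE] : ratr eps = E%:R / n0%:R :> R /\ ratr del = Dn%:R / n0%:R :> R.
  by rewrite epsE delE !fmorph_div /= !ratr_nat.
have EP : \sum_(i < I) cabs2 (map_poly (ev b) (PZ i)).[(x.1 +i* x.2)%C] =
    \sum_(i < I) cabs2 (Pb b i (x.1 +i* x.2)%C).
  by apply: eq_bigr => i _; rewrite horner_PZ.
have EQ : \sum_(j < J) cabs2 (map_poly (ev b) (QZ j)).[(x.1 +i* x.2)%C] =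
    \sum_(j < J) cabs2 (Qb b j (x.1 +i* x.2)%C).
  by apply: eq_bigr => j _; rewrite horner_QZ.
by rewrite /Rb /ratio_fun eE dE EP EQ.
Qed.

Lemma disk_integral_ratio (b : Idx M N -> R[i]) : disk_integral eps del b =
  (\int[(@lebesgue_measure R \x @lebesgue_measure R)%E]_(x in unit_disk)
    ratio_fun (E%:R / n0%:R) (Dn%:R / n0%:R) (fun i => map_poly (ev b) (PZ i))
      (fun j => map_poly (ev b) (QZ j)) x)%E.
Proof. by rewrite /disk_integral; apply: eq_integral => x _; exact: Rb_ratio_fun. Qed.

(** The pairs are indexed by a center and a Taylor order [k]; their entries are the values at the
    center of [Fp k] and [Gp k], all scaled by the same w^d, which cancels in f/g. *)
Lemma stratified_disk_integral : stratified (disk_integral eps del) good Bset.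
Proof.
pose T := entry_index J N1.
pose Gs (k : 'I_M1.+1) j := nth 0 [seq Gp k be | be <- enum {: T}] j.
pose Fs (k : 'I_M1.+1) j := nth 0 [seq Fp k i | i <- enum 'I_I] j.
have [dG' HdG] := size_nth_bound (fun k : 'I_M1.+1 => [seq Gp k be | be <- enum {: T}]).
have [dF' HdF] := size_nth_bound (fun k : 'I_M1.+1 => [seq Fp k i | i <- enum 'I_I]).
pose d := maxn dG' dF'.
have sG k j : (size (Gs k j) <= d)%N by rewrite leq_max HdG.
have sF k j : (size (Fs k j) <= d)%N by rewrite leq_max HdF orbT.
pose NW := (1 + J * N1)%N.
have [c Hc] := @combined_coefs_exist R A (centersZ j1 nn) NW M1.+1 d #|T| #|'I_I| Gs Fs sG sF.
have [c1 [c2 [c10 c20 Hb]]] := @integral_ratio_bounds R I J M1 N1 n0 E Dn nn NW I0 J0 n00 slope_nz.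
have na0 : 0 < ((n0 * a)%:R)^-1 :> rat by rewrite invr_gt0 ltr0n muln_gt0 n00 fact_gt0.
apply: (@stratified_Bset _ _ _ _ _ _ good ('I_NW * 'I_M1.+1)%type #|T| #|'I_I| c _ c1 c2 na0 c10 c20).
move=> b Bb [gb1 gb2].
pose Ps i := map_poly (ev b) (PZ i); pose Qs j := map_poly (ev b) (QZ j).
have sP i : (size (Ps i) <= M1.+1)%N.
  by rewrite (leq_trans (size_map_PZ b i)) // ltnS /M1 (leq_bigmax i).
have sQ j : (size (Qs j) <= N1.+1)%N.
  by rewrite (leq_trans (size_map_QZ b j)) // ltnS NN1.
have Q1near : nrm 1 (Qs j1 - 'X^N1) < s by rewrite nrm_map_QZ1.
have Qbound j : j != j1 -> nrm 1 (Qs j) < C by move=> /gb2; rewrite nrm_map_QZ.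
have [om [W0 WE om0 omroot om2]] := center_roots C0 Cnn sQ Q1near Qbound.
rewrite -(map_centersZ b j1 nn) coef_map -/NW in W0 WE.
have cE := Hc (ev b) om W0 WE.
set w := ev b (centersZ j1 nn)`_NW in W0 cE.
have ww0 : 0 < cabs (w ^+ d) by rewrite cabs_gt0 expf_neq0.
have qN t : 0 < qco Qs (tnth om t) N1.
  have h : 0 < cabs (Qs j1)^`N(N1).[tnth om t].
    rewrite -coef_shift cabs_gt0.
    have s1 : size (Qs j1) = N1.+1.
      have := size_center_poly Cnn sQ Q1near Qbound j1.
      by rewrite /center_poly eqxx.
    have -> : (shift (tnth om t) (Qs j1))`_N1 = lead_coef (shift (tnth om t) (Qs j1)).
      by rewrite /lead_coef size_shift s1.
    by rewrite lead_coef_eq0 shift_eq0 -size_poly_eq0 s1.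
  apply: (lt_le_trans h); rewrite /qco (bigD1 j1) //= lerDl.
  by apply: sumr_ge0 => j _; exact: cabs_ge0.
have mf : measurable_fun [set: (measurableTypeR R * measurableTypeR R)%type]
    (ratio_fun (E%:R / n0%:R) (Dn%:R / n0%:R) Ps Qs).
  apply: eq_measurable_fun (measurable_Rb eps del b) => x _.
  exact: Rb_ratio_fun.
have [Hinf Hfin] := Hb Ps Qs j1 (tnth om) sP sQ mf om0 omroot om2 qN.
exists (fun i : 'I_NW * 'I_M1.+1 => w ^+ d *: \poly_(j < #|T|) (map_poly (ev b) (Gs i.2 j)).[tnth om i.1]).
exists (fun i : 'I_NW * 'I_M1.+1 => w ^+ d *: \poly_(j < #|'I_I|) (map_poly (ev b) (Fs i.2 j)).[tnth om i.1]).
have nrm_poly_sum n (u : nat -> R[i]) : nrm 1 (w ^+ d *: \poly_(j < n) u j) =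
    cabs (w ^+ d) * \sum_(j < n) cabs (u j).
  rewrite nrmZ (@nrmE _ _ _ n) ?size_poly //; congr (_ * _).
  by apply: eq_bigr => j _; rewrite coef_poly ltn_ord expr1n mulr1.
have nrmG (i : 'I_NW * 'I_M1.+1) :
    nrm 1 (w ^+ d *: \poly_(j < #|T|) (map_poly (ev b) (Gs i.2 j)).[tnth om i.1]) =
    cabs (w ^+ d) * den_sum N1 n0 E Dn Qs (tnth om i.1) i.2.
  rewrite nrm_poly_sum; congr (_ * _).
  rewrite (sum_nth_enum (Gp i.2) (fun p => cabs (map_poly (ev b) p).[tnth om i.1])).
  by apply: eq_bigr => be _; exact: horner_Gp.
have nrmF (i : 'I_NW * 'I_M1.+1) :
    nrm 1 (w ^+ d *: \poly_(j < #|'I_I|) (map_poly (ev b) (Fs i.2 j)).[tnth om i.1]) =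
    cabs (w ^+ d) * num_sum N1 E Ps (tnth om i.1) i.2.
  rewrite nrm_poly_sum; congr (_ * _).
  rewrite (sum_nth_enum (Fp i.2) (fun p => cabs (map_poly (ev b) p).[tnth om i.1])).
  by apply: eq_bigr => i' _; exact: horner_Fp.
split.
- by move=> i; rewrite (leq_trans (size_scale_leq _ _)) // size_poly.
- by move=> i; rewrite (leq_trans (size_scale_leq _ _)) // size_poly.
- by move=> k m t; exact: cE.
(* A nonzero P_i keeps its leading coefficient under every translation, so the Taylor coefficient of
   that order is nonzero at any center. *)
- have [i0 [mu0 hmu]] := Bb.
  have P0 : Ps i0 != 0.
    apply: contraNneq hmu => h; have := coef_sum_monomials (fun mu => bP b mu) mu0.
    by rewrite -map_PZ -/(Ps i0) h coef0 => <-.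
  have t0 : 'I_NW by exact: ord0.
  have ks : ((size (Ps i0)).-1 < M1.+1)%N.
    by rewrite (leq_trans _ (sP i0)) // prednK // size_poly_gt0.
  exists (t0, Ordinal ks); rewrite nrmF mulf_neq0 ?gt_eqF //=.
  have : 0 < cabs (Ps i0)^`N((size (Ps i0)).-1).[tnth om t0].
    rewrite -coef_shift cabs_gt0 -[X in _`_X.-1](size_shift (tnth om t0)) lead_coef_eq0.
    by rewrite shift_eq0.
  move=> h; apply: lt_le_trans (exprn_gt0 (E * a) h) _.
  rewrite /num_sum (bigD1 i0) //= lerDl.
  by apply: sumr_ge0 => i _; rewrite exprn_ge0 ?cabs_ge0.
split.
  move=> [i fi gi]; rewrite disk_integral_ratio; apply: Hinf.
  exists i.1, i.2; first by rewrite -ltnS.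
  move: fi gi; rewrite nrmF nrmG mulf_eq0 negb_or => /andP[_ fi] /eqP.
  by rewrite mulf_eq0 (gt_eqF ww0) => /eqP.
move=> fg X; rewrite disk_integral_ratio.
have [|h1 h2] := Hfin.
  move=> t k fi; have := fg (t, k); rewrite nrmF nrmG !mulf_eq0 (gt_eqF ww0) /=.
  exact.
have XE : X = \sum_(i : 'I_NW * 'I_M1.+1)
    num_sum N1 E Ps (tnth om i.1) i.2 / den_sum N1 n0 E Dn Qs (tnth om i.1) i.2.
  apply: eq_bigr => i _; rewrite nrmF nrmG invfM mulrACA divff ?mul1r // gt_eqF //.
have rE : ratr ((n0 * a)%:R)^-1 = ((n0 * a)%:R)^-1 :> R by rewrite fmorphV /= ratr_nat.
by rewrite XE rE.
Qed.

End Main.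

Theorem theorem4 (R : realType) (eps del : rat) (I J : nat)
  (M : 'I_I -> nat) (N : 'I_J -> nat) (C : R)
  (hI : (0 < I)%N) (hJ : (0 < J)%N)
  (heps : 0 <= eps) (hdel : 0 <= del)
  (hN : forall j1 j2 : 'I_J, (j1 <= j2)%N -> (N j2 <= N j1)%N)
  (hC : 0 < C)
  (hnd : nondegenerate_pair eps del M N) :
  let j1 : 'I_J := Ordinal hJ in
  exists s : R, 0 < s < 1 /\
  exists (NN : nat) (U : nat -> set (Idx M N -> R[i]))
         (T : nat -> ARP #|Idx M N|),
    U 0%N = Bset /\ U NN = set0 /\
    (forall l, (l < NN)%N -> U l.+1 `<=` U l) /\
    (forall l, (l <= NN)%N ->
       exists V, algebraic_set V /\ U l = Bset `&` [set b | V (bpoint b)]) /\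
    (* 1. *)
    (forall l, (l < NN)%N -> forall b, U l b -> ~ U l.+1 b ->
       arpK (T l) (bpoint b) != 0) /\
    (* 2. *)
    (exists c1 c2 : R, 0 < c1 /\ 0 < c2 /\
       forall l, (l < NN)%N -> forall b, U l b -> ~ U l.+1 b ->
         norm3Q1 b j1 < s ->
         (forall j : 'I_J, (0 < j)%N -> norm3Q b j < C) ->
         (c1%:E * arp_eval (T l) (bpoint b) <= disk_integral eps del b)%E /\
         (disk_integral eps del b <= c2%:E * arp_eval (T l) (bpoint b))%E) /\
    (* 3. *)
    (forall l, (l < NN)%N ->
       U l.+1 = [set b | U l b /\ arpK (T l) (bpoint b) = 0] /\
       U l.+1 = [set b | U l b /\ arpK (T l) (bpoint b) = 0 /\
                         arpL (T l) (bpoint b) = 0]).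
Proof.
move=> j1.
have [n0 [E [Dn [n00 epsE delE]]]] := common_denominator heps hdel.
pose s : R := 2^-1 ^+ (N j1).+1.
have s0 : 0 < s by rewrite exprn_gt0 // invr_gt0.
have s1 : s < 1.
  by apply: exprn_ilt1; rewrite ?invr_ge0 // invf_lt1 // ltr1n.
have NN1 j : (N j <= N j1)%N by exact: hN.
(* Depends on C and N_1 only, so the centers are given by one integral polynomial for all [b]. *)
pose nn := Num.bound (C / s).
have Cnn : C <= nn%:R * s.
  by rewrite -ler_pdivrMr // ltW // archi_boundP // divr_ge0 // ltW.
have slope_nz k l : (k <= \max_(i < I) M i)%N -> (l <= N j1)%N ->
    (l * Dn != 2 * n0 + k * E)%N.
  move=> kM lN; have t1 : (Num.truncn del).+1%:R != 0 :> rat by rewrite pnatr_eq0.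
  have n0n : n0%:R != 0 :> rat by rewrite pnatr_eq0 -lt0n.
  (* Nondegeneracy is applied at l ([δ] + 1), where the quotient is the integer l; multiplying by
     [n0] gives the inequality between naturals. *)
  have := hnd k (l * (Num.truncn del).+1)%N kM.
  rewrite mulnC leq_mul2l /= (leq_trans lN (leq_bigmax j1)) => /(_ isT).
  apply: contraNneq => lE; rewrite natrM [X in X / _]mulrC mulfK // epsE delE.
  have : l%:R * Dn%:R = 2 * n0%:R + k%:R * E%:R :> rat by rewrite -!natrM -natrD lE.
  move=> lR; apply/eqP; by rewrite mulrA lR; field.
have J1 j : j != j1 -> (0 < j)%N.
  by rewrite lt0n; apply: contraNneq => j0; apply/eqP/val_inj.
have [NN [U [T [U0 [UN [Um [Ua [[c1 [c2 [c10 [c20 Hc]]]] Ue]]]]]]]] :=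
  stratified_disk_integral hI n00 epsE delE NN1 hC Cnn slope_nz.
exists s; split; first by rewrite s0.
exists NN, U, T; do 4! [split=> //]; split.
  move=> l lN b Ub Ub'; apply/eqP => K0; apply: Ub'.
  by rewrite (Ue l lN).1.
split; last exact: Ue.
exists c1, c2; do 2! [split=> //]; move=> l lN b Ub Ub' Q1 Q2.
by apply: Hc => //; split=> // j /J1; exact: Q2.
Qed.
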